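(* Let $\xi_0\in\mathbb R$, $w\in\mathbb C$, and for $i=0,1$ let $$a_i=a_{i-}H(\xi_0-x)+a_{i+}H(x-\xi_0)+\sum_{j=0}^1A_{ij}\delta^{(j)}_{\xi_0},\qquad b_i=b_{i-}H(\xi_0-x)+b_{i+}H(x-\xi_0)+\sum_{j=0}^3B_{ij}\delta^{(j)}_{\xi_0},$$ where $a_{i\pm},b_{i\pm}\in\mathcal C^\infty(\mathbb R)$ and $A_{ij},B_{ij}\in\mathbb C$. Assume that $a_{0-}(\xi_0)+a_{1+}(\xi_0)\neq0$, and that $a_{0-}(x)+a_{1-}(x)\neq0$ and $a_{0+}(x)+a_{1+}(x)\neq0$ for all $x\in\mathbb R$. Consider the ODE $$\sum_{i=0}^{2}\binom{2}{i}\left(a_0^{(i)}*\phi^{(4-i)}+\phi^{(4-i)}*a_1^{(i)}\right)-w^2\left(b_0*\phi+\phi*b_1\right)=0 .\qquad (E)$$ For $i\in\{0,1\}$ consider the conditions: (a) $\operatorname{ord}a_i=0$ and $\operatorname{ord}b_i\le3$; (b) $\operatorname{ord}a_i\le1$ and $\operatorname{ord}b_i\le2$; (c) $\operatorname{ord}a_i\le2$ and $\operatorname{ord}b_i\le1$. If at least one of (a), (b), (c) holds for $i=0$, then for every $x_0<\xi_0$ and every $\overline C\in\mathbb C^4$ there exists a unique solution $\phi$ of (E) satisfying the boundary conditions $\overline{\phi(x_0)}=\overline C$. If at least one of (a), (b), (c) holds for $i=1$, then for every $x_0>\xi_0$ and every $\overline C\in\mathbb C^4$ there exists a unique solution $\phi$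 of (E) satisfying the boundary conditions $\overline{\phi(x_0)}=\overline C$. Here $\overline{\phi}=(\phi,\phi',\phi'',\phi''')^T$.
   Context: All functions and distributions are complex valued and all derivatives are distributional. $\mathcal D'$ is the space of Schwartz distributions on $\mathbb R$; locally integrable functions are identified with the associated regular distributions. $H$ is the Heaviside step function and $\delta_{x_0}$ the Dirac measure at $x_0$. $\mathcal C_p^\infty$ is the space of functions on $\mathbb R$ that are smooth except on a finite set of points, where they and all their derivatives have finite left and right limits. $\mathcal A\subset\mathcal D'$ is the space of all functions in $\mathcal C_p^\infty$, regarded as distributions, together with all their distributional derivatives of all orders. Equivalently, $F\in\mathcal A$ iff there are points $x_1<\dots<x_m$ such that, with $x_0=-\infty$, $x_{m+1}=+\infty$, $\Omega_i=(x_i,x_{i+1})$ and $\chi_{\Omega_i}$ the characteristic function of $\Omega_i$, $F=\sum_{i=1}^m\sum_{j=0}^n c_{ij}\delta^{(j)}_{x_i}+\sum_{i=0}^m f_i\chi_{\Omega_i}$ with $c_{ij}\in\mathbb C$ and $f_i\in\mathcal C^\infty(\mathbb R)$. Product $*$: for $F,G\in\mathcal A$, $F*G=\lim_{\epsilon\downarrow0}F(x)\cdot G(x+\epsilon)$ in the distributional sense, where for small $\epsilon>0$ the two factors have disjoint singular supports and $\cdot$ is the Hörmander product (locally, the product of a distribution by a smooth function). Explicitly, if $F=\sum_{i=1}^m\sum_{j=0}^n c_{ij}\delta^{(j)}_{x_i}+\sum_{i=0}^m f_i\chi_{\Omega_i}$ and $G=\sum_{i=1}^m\sum_{j=0}^n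 d_{ij}\delta^{(j)}_{x_i}+\sum_{i=0}^m g_i\chi_{\Omega_i}$ (same points for both, $f_i,g_i\in\mathcal C^\infty(\mathbb R)$), then $$F*G=\sum_{i=1}^m\sum_{j=0}^n\left[c_{ij}g_i+d_{ij}f_{i-1}\right]\delta^{(j)}_{x_i}+\sum_{i=0}^m f_ig_i\chi_{\Omega_i}\in\mathcal A .$$ Order: $\operatorname{ord}F=n$ iff $F$ is the $n$th distributional derivative, but not a lower order distributional derivative, of a regular distribution; so $\operatorname{ord}F=0$ iff $F$ is regular, and $\operatorname{ord}\delta^{(j)}_{x_0}=j+1$. A solution of the ODE is a $\phi\in\mathcal A$ satisfying it in the sense of distributions on $\mathbb R$. It satisfies the boundary conditions $\overline{\phi(x_0)}=\overline C=(C_1,\dots,C_4)^T$ at $x_0\neq\xi_0$ iff there are an open interval $\Omega\ni x_0$ and $\varphi\in\mathcal C^\infty(\mathbb R)$ such that $\phi=\varphi$ on $\Omega$ (as distributions) and $\varphi^{(i)}(x_0)=C_{i+1}$ for $i=0,\dots,3$. Uniqueness is within $\mathcal A$. *)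

(* Defs.v *)
From HB Require Import structures.
From mathcomp Require Import all_boot all_order all_algebra.
From mathcomp Require Import all_classical all_reals all_analysis.
From mathcomp Require Import complex.

Set Implicit Arguments.
Unset Strict Implicit.
Unset Printing Implicit Defensive.

Import Order.TTheory GRing.Theory Num.Theory.
Import numFieldNormedType.Exports.

Local Open Scope classical_set_scope.
Local Open Scope complex_scope.
Local Open Scope ring_scope.

(* [poly] claims these notations in [ring_scope] *)
Local Notation "f ^` ()" := (derive1 f) : ring_scope.
Local Notation "f ^` ( n )" := (derive1n n f) : ring_scope.

Local Notation cRe := (@complex.Re _).
Local Notation cIm := (@complex.Im _).

(** * Smooth functions *)

Definition rsmooth (R : realType) (f : R -> R) : Prop :=
  forall n x, derivable (f^`(n)) x 1.

Section real_smooth.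
Context {R : realType}.
Implicit Types (f g : R -> R) (n : nat).

Definition kderivable n f := forall k x, (k < n)%N -> derivable (f^`(k)) x 1.

Lemma rsmoothP f : rsmooth f <-> forall n, kderivable n f.
Proof.
split=> [sf n k x _|sf n x]; first exact: sf.
exact: (sf n.+1 n x (ltnSn n)).
Qed.

Lemma kderivableS n f :
  kderivable n.+1 f <-> (forall x, derivable f x 1) /\ kderivable n f^`().
Proof.
split=> [kf|[df kf] [|k] x kn]; last 2 first.
- exact: df.
- by rewrite derive1Sn; exact: kf.
split=> [x|k x kn]; first exact: (kf 0%N x).
by rewrite -derive1Sn; exact: kf.
Qed.

Lemma kderivableW n f : kderivable n.+1 f -> kderivable n f.
Proof. by move=> kf k x kn; apply: kf; rewrite ltnS ltnW. Qed.

Lemma kderivableD n f g :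
  kderivable n f -> kderivable n g -> kderivable n (f \+ g).
Proof.
elim: n f g => [//|n IH] f g /kderivableS[df kf] /kderivableS[dg kg].
apply/kderivableS; split=> [x|]; first exact: derivableD.
have -> : (f \+ g)^`() = f^`() \+ g^`().
  by apply/funext => x; rewrite /= !derive1E deriveD.
exact: IH.
Qed.

Lemma kderivableM n f g :
  kderivable n f -> kderivable n g -> kderivable n (f \* g).
Proof.
elim: n f g => [//|n IH] f g kf kg.
have /kderivableS[df kf'] := kf; have /kderivableS[dg kg'] := kg.
apply/kderivableS; split=> [x|]; first exact: derivableM.
have -> : (f \* g)^`() = (f \* g^`()) \+ (g \* f^`()).
  by apply/funext => x; rewrite /= !derive1E deriveM.
by apply: kderivableD; apply: IH => //; exact: kderivableW.
Qed.

Lemma derive1n_cst0 n : (cst 0 : R -> R)^`(n) = cst 0.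
Proof.
elim: n => [//|n IH]; rewrite derive1nS IH; apply/funext => x.
by rewrite derive1_cst.
Qed.

Lemma rsmooth_cst (c : R) : rsmooth (cst c).
Proof.
case=> [|n] x; first exact: derivable_cst.
rewrite derive1Sn; have -> : (cst c : R -> R)^`() = cst 0.
  by apply/funext => y; rewrite derive1_cst.
by rewrite derive1n_cst0; exact: derivable_cst.
Qed.

Lemma rsmoothD f g : rsmooth f -> rsmooth g -> rsmooth (f \+ g).
Proof.
by move=> /rsmoothP sf /rsmoothP sg; apply/rsmoothP => n; exact: kderivableD.
Qed.

Lemma rsmoothM f g : rsmooth f -> rsmooth g -> rsmooth (f \* g).
Proof.
by move=> /rsmoothP sf /rsmoothP sg; apply/rsmoothP => n; exact: kderivableM.
Qed.

Lemma rsmoothN f : rsmooth f -> rsmooth (\- f).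
Proof.
move=> sf; have -> : \- f = cst (- 1) \* f.
  by apply/funext => x; rewrite /= mulN1r.
by apply: rsmoothM => //; exact: rsmooth_cst.
Qed.

Lemma rsmooth_derive f : rsmooth f -> rsmooth f^`().
Proof. by move=> sf n x; rewrite -derive1Sn; exact: sf. Qed.

Lemma is_derive_shift f (c x : R) :
  derivable f (x - c) 1 -> is_derive x 1 (f \o (fun y => y - c)) (f^`() (x - c)).
Proof.
move=> df.
have dc : is_derive x 1 (fun y : R => y - c) (1 : R).
  by apply: is_derive_eq; rewrite oppr0 addr0.
have df' : is_derive (x - c) 1 f ('D_1 f (x - c)) by exact: DeriveDef.
rewrite derive1E -['D_1 f _]mulr1.
exact: (@is_derive1_comp R f (fun y => y - c) x _ _ df' dc).
Qed.

Lemma rsmooth_shift f (c : R) : rsmooth f -> rsmooth (f \o (fun y => y - c)).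
Proof.
move=> sf; have E n : (f \o (fun y => y - c))^`(n) = f^`(n) \o (fun y => y - c).
  elim: n => [//|n IH]; rewrite derive1nS IH; apply/funext => x.
  by rewrite derive1E; have [_ ->] := is_derive_shift (sf n (x - c)).
by move=> n x; rewrite E; have [] := is_derive_shift (sf n (x - c)).
Qed.

End real_smooth.

Definition smooth (R : realType) (f : R -> R[i]) : Prop :=
  rsmooth (cRe \o f) /\ rsmooth (cIm \o f).

(** Iterated derivative of a complex-valued function of a real variable. *)
Definition cderive (R : realType) (n : nat) (f : R -> R[i]) : R -> R[i] :=
  fun x => (cRe \o f)^`(n) x +i* (cIm \o f)^`(n) x.

Definition cderivable (R : realType) (f : R -> R[i]) (x : R) : Prop :=
  derivable (cRe \o f) x 1 /\ derivable (cIm \o f) x 1.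

(** Convergence of a complex-valued function along a filter (componentwise). *)
Definition ccvg_to (R : realType) (T : Type) (F : set_system T) (g : T -> R[i])
    (l : R[i]) : Prop :=
  (cRe (g t) @[t --> F] --> cRe l) /\
  (cIm (g t) @[t --> F] --> cIm l).

(** Topological support. *)
Definition tsupp (R : realType) (f : R -> R[i]) : set R :=
  closure [set x | f x != 0].

Section complex_smooth.
Context {R : realType}.
Implicit Types f g : R -> R[i]^o.

Lemma smooth0 : smooth (0 : R -> R[i]^o).
Proof. by split; exact: rsmooth_cst. Qed.

Lemma smoothD f g : smooth f -> smooth g -> smooth (f + g).
Proof.
move=> [rf jf] [rg jg]; split.
- have -> : cRe \o (f + g) = (cRe \o f) \+ (cRe \o g).
    by apply/funext => x /=; rewrite fctE raddfD.
  exact: rsmoothD.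
- have -> : cIm \o (f + g) = (cIm \o f) \+ (cIm \o g).
    by apply/funext => x /=; rewrite fctE raddfD.
  exact: rsmoothD.
Qed.

Lemma smoothM (f g : R -> R[i]) :
  smooth f -> smooth g -> smooth (fun x => f x * g x).
Proof.
move=> [rf jf] [rg jg]; split.
- have -> : cRe \o (fun x => f x * g x) =
     ((cRe \o f) \* (cRe \o g))
     \+ (\- ((cIm \o f) \* (cIm \o g))).
    by apply/funext => x /=; case: (f x) => a b; case: (g x).
  by apply: rsmoothD; last apply: rsmoothN; exact: rsmoothM.
- have -> : cIm \o (fun x => f x * g x) =
     ((cRe \o f) \* (cIm \o g))
     \+ ((cIm \o f) \* (cRe \o g)).
    by apply/funext => x /=; case: (f x) => a b; case: (g x).
  by apply: rsmoothD; exact: rsmoothM.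
Qed.

Lemma smooth_cst (c : R[i]) : smooth (cst c : R -> R[i]).
Proof. by split; exact: rsmooth_cst. Qed.

Lemma smoothZ (c : R[i]) f : smooth f -> smooth (c *: f).
Proof. by move=> sf; exact: (smoothM (smooth_cst c) sf). Qed.

Lemma smooth_cderive f : smooth f -> smooth (cderive 1 f).
Proof.
move=> [rf jf]; split.
- exact: (rsmooth_derive rf).
- exact: (rsmooth_derive jf).
Qed.

Lemma smooth_shift f (c : R) : smooth f -> smooth (fun x => f (x - c)).
Proof.
move=> [rf jf]; split.
- exact: (@rsmooth_shift _ (cRe \o f) c).
- exact: (@rsmooth_shift _ (cIm \o f) c).
Qed.

Lemma tsupp_sub f (A : set R) :
  closed A -> (forall x, ~ A x -> f x = 0) -> tsupp f `<=` A.
Proof.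
move=> cA fA; rewrite (closure_id A).1 //; apply: closureS => x /=.
by apply: contraNP => /fA ->.
Qed.

Lemma tsupp0 f x : ~ tsupp f x -> f x = 0.
Proof.
move=> nx; apply/eqP; apply: contra_notT nx => fx0.
exact: subset_closure.
Qed.

Lemma closed_tsupp f : closed (tsupp f).
Proof. exact: closed_closure. Qed.

Lemma tsuppD f g : tsupp (f + g) `<=` tsupp f `|` tsupp g.
Proof.
apply: tsupp_sub; first by apply: closedU; exact: closed_tsupp.
move=> x /not_orP[fx gx].
by rewrite fctE (tsupp0 fx) (tsupp0 gx) addr0.
Qed.

Lemma tsuppMr (f g : R -> R[i]) : tsupp (fun x => f x * g x) `<=` tsupp g.
Proof.
apply: tsupp_sub; first exact: closed_tsupp.
by move=> x gx; rewrite (tsupp0 gx) mulr0.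
Qed.

Lemma tsupp_cderive f : tsupp (cderive 1 f) `<=` tsupp f.
Proof.
apply: tsupp_sub; first exact: closed_tsupp.
move=> x nx; have nf : \forall y \near x, f y = 0.
  have : nbhs x (~` tsupp f).
    by apply: open_nbhs_nbhs; split=> //; exact/closed_openC/closed_tsupp.
  by apply: filterS => y; exact: tsupp0.
have z (h : R -> R) : (\forall y \near x, h y = 0) -> h^`() x = 0.
  by move=> hx; rewrite derive1E (@near_eq_derive _ _ _ h (cst 0)) ?derive_cst.
rewrite /cderive /= !z //.
- by apply: filterS nf => y /= ->.
- by apply: filterS nf => y /= ->.
Qed.

Lemma compact_tsuppS (A : set R) f : compact A -> tsupp f `<=` A ->
  compact (tsupp f).
Proof.
by move=> cA fA; apply: subclosed_compact cA fA; exact: closed_tsupp.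
Qed.

Lemma compact_tsupp_shift f (c : R) :
  compact (tsupp f) -> compact (tsupp (fun x => f (x - c))).
Proof.
move=> cf; have cA : compact ((fun y => y + c) @` tsupp f).
  apply: continuous_compact => //; apply: continuous_subspaceT => y.
  by apply: cvgD; [exact: cvg_id|exact: cvg_cst].
apply: (compact_tsuppS cA); apply: tsupp_sub.
  by apply: compact_closed => //; exact: norm_hausdorff.
move=> x nx; apply: tsupp0; apply: contra_not nx => h.
by exists (x - c) => //; rewrite subrK.
Qed.

End complex_smooth.

(** * Test functions and distributions *)

Section testfun.
Context {R : realType}.

Definition testfun_pred : {pred R -> R[i]^o} :=
  mem [set f : R -> R[i]^o | smooth f /\ compact (tsupp f)].

Lemma testfun_submod : submod_closed testfun_pred.
Proof.
split=> [|c f g].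
  rewrite inE; split; first exact: smooth0.
  by apply: compact_tsuppS; [exact: compact0|exact: tsupp_sub closed0 _].
rewrite !inE => -[sf cf] [sg cg]; split.
  by apply: smoothD => //; exact: smoothZ.
apply: (compact_tsuppS (compactU cf cg)).
apply: (subset_trans (@tsuppD _ _ _)); apply: setSU.
exact: (@tsuppMr _ (cst c)).
Qed.

HB.instance Definition _ := GRing.isSubmodClosed.Build R[i] (R -> R[i]^o)
  testfun_pred testfun_submod.

Record testfun : Type := TestFun {
  tfun :> R -> R[i]^o ;
  tfunP : tfun \in testfun_pred }.

HB.instance Definition _ := [isSub for tfun].
HB.instance Definition _ := [Choice of testfun by <:].
HB.instance Definition _ := [SubChoice_isSubLmodule of testfun by <:].

Lemma tfun_smooth (psi : testfun) : smooth psi.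
Proof. by have := tfunP psi; rewrite inE => -[]. Qed.

Lemma tfun_compact (psi : testfun) : compact (tsupp psi).
Proof. by have := tfunP psi; rewrite inE => -[]. Qed.

Arguments tfun_compact : clear implicits.

Lemma tderive_subproof (psi : testfun) : cderive 1 psi \in testfun_pred.
Proof.
rewrite inE; split; first exact/smooth_cderive/tfun_smooth.
by apply: (compact_tsuppS (tfun_compact psi)); exact: tsupp_cderive.
Qed.

Definition tderive (psi : testfun) : testfun := TestFun (tderive_subproof psi).

Lemma tshift_subproof (e : R) (psi : testfun) :
  (fun x => psi (x - e)) \in testfun_pred.
Proof.
rewrite inE; split; first exact/smooth_shift/tfun_smooth.
exact/compact_tsupp_shift/tfun_compact.
Qed.

Definition tshift (e : R) (psi : testfun) : testfun :=
  TestFun (tshift_subproof e psi).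

Lemma tmul_subproof (g : R -> R[i]) (sg : smooth g) (psi : testfun) :
  (fun x => g x * psi x) \in testfun_pred.
Proof.
rewrite inE; split; first exact/smoothM/tfun_smooth.
by apply: (compact_tsuppS (tfun_compact psi)); exact: tsuppMr.
Qed.

Definition tmul (g : R -> R[i]) (sg : smooth g) (psi : testfun) : testfun :=
  TestFun (tmul_subproof sg psi).

End testfun.

Arguments testfun R : clear implicits.

(** Arbitrary complex functionals on test functions; they form a complex vector
    space, in which the distributions are the linear continuous ones. *)
Notation functional R := (testfun R -> R[i]^o).

Section distributions.
Context {R : realType}.
Implicit Types (F G P : functional R) (psi : testfun R).

Local Notation mu := (@lebesgue_measure R).
Local Notation normc := (@Normc.normc R).

Definition is_distribution F : Prop :=
  linear F /\
  forall K : set R, compact K -> exists (C : R) (N : nat),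
    forall psi, tsupp psi `<=` K ->
      normc (F psi) <=
        C * \sum_(k < N.+1) sup (range (fun x => normc (cderive k psi x))).

Definition dderive F : functional R := fun psi => - F (tderive psi).

Definition ddern (n : nat) F : functional R := iter n dderive F.

(** [dtrans e F] is [F (x + e)]. *)
Definition dtrans (e : R) F : functional R := fun psi => F (tshift e psi).

Definition dmul (g : R -> R[i]) (sg : smooth g) F : functional R :=
  fun psi => F (tmul sg psi).

Definition delta (x0 : R) : functional R := fun psi => psi x0.

Definition cintegral (g : R -> R[i]) : R[i] :=
  (\int[mu]_x cRe (g x)) +i* (\int[mu]_x cIm (g x)).

Definition loc_integrable (f : R -> R[i]) : Prop :=
  locally_integrable setT (cRe \o f) /\
  locally_integrable setT (cIm \o f).

(** The regular distribution of [f], meaningful for locally integrable [f]. *)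
Definition reg (f : R -> R[i]) : functional R :=
  fun psi => cintegral (fun x => f x * psi x).

Definition is_regular F : Prop := exists2 f, loc_integrable f & F = reg f.

Definition deq_on (U : set R) F G : Prop :=
  forall psi, tsupp psi `<=` U -> F psi = G psi.

(** * Order of a distribution *)

Definition is_nth_derivative (n : nat) F : Prop :=
  exists2 G, is_regular G & F = ddern n G.

Definition has_order F (n : nat) : Prop :=
  is_nth_derivative n F /\ forall k, (k < n)%N -> ~ is_nth_derivative k F.

Definition order_le F (n : nat) : Prop :=
  exists2 k, (k <= n)%N & has_order F k.

(** * The spaces of piecewise smooth functions and of their derivatives *)

Definition piecewise_smooth (f : R -> R[i]) : Prop :=
  exists s : seq R,
    (forall n x, x \notin s -> cderivable (cderive n f) x) /\
    (forall n x, x \in s ->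
       (exists l, ccvg_to x^'- (cderive n f) l) /\
       (exists l, ccvg_to x^'+ (cderive n f) l)).

Definition calA : set (functional R) :=
  [set F | exists n f, piecewise_smooth f /\ F = ddern n (reg f)].

(** * The product [*] *)

(** [P] is the Hörmander product of [F] and [G], for distributions with disjoint
    singular supports: near each point one factor is a smooth function, and [P]
    is the product of the other factor by that function. *)
Definition is_hormander_product F G P : Prop :=
  forall x : R, exists2 U : set R, open_nbhs x U &
    (exists f (sf : smooth f), deq_on U F (reg f) /\ deq_on U P (dmul sf G)) \/
    (exists g (sg : smooth g), deq_on U G (reg g) /\ deq_on U P (dmul sg F)).

Definition is_star F G P : Prop :=
  is_distribution P /\
  exists Pe : R -> functional R,
    (\forall e \near 0^'+, is_distribution (Pe e) /\
       is_hormander_product F (dtrans e G) (Pe e)) /\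
    (forall psi, ccvg_to 0^'+ (fun e => Pe e psi) (P psi)).

(** The limit exists and is unique for [F] and [G] in [calA]; the value is
    arbitrarily [0] when it does not exist. *)
Definition star F G : functional R := xget 0 [set P | is_star F G P].

(** * The ODE and its boundary conditions *)

Definition heaviside (x : R) : R[i] := (0 < x)%R%:R.

(** The distribution
    [fm H(xi - x) + fp H(x - xi) + \sum_(j < n) c j delta_xi^(j)]. *)
Definition sing_coef (xi : R) (fm fp : R -> R[i]) (n : nat) (c : 'I_n -> R[i]) :
    functional R :=
  reg (fun x => fm x * heaviside (xi - x) + fp x * heaviside (x - xi))
  + \sum_(j < n) c j *: ddern j (delta xi).

Definition is_solution (a b : 'I_2 -> functional R) (w : R[i])
    (phi : functional R) : Prop :=
  calA phi /\
  \sum_(i < 3) 'C(2, i)%:R *: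
     (star (ddern i (a 0)) (ddern (4 - i) phi)
      + star (ddern (4 - i) phi) (ddern i (a 1)))
  - w ^+ 2 *: (star (b 0) phi + star phi (b 1)) = 0.

Definition boundary_cond (phi : functional R) (x0 : R) (C : 'cV[R[i]]_4) : Prop :=
  exists a b (f : R -> R[i]),
    [/\ a < x0 < b, smooth f, deq_on `]a, b[ phi (reg f) &
        forall i : 'I_4, cderive i f x0 = C i 0].

Definition order_cond (ai bi : functional R) : Prop :=
  [\/ has_order ai 0 /\ order_le bi 3,
      order_le ai 1 /\ order_le bi 2
    | order_le ai 2 /\ order_le bi 1].

End distributions.

(* Main.v *)
(* By the Leibniz rule for the product, the equation reads
     D^2 (a_0 * phi'' + phi'' * a_1) = w^2 (b_0 * phi + phi * b_1).
   Away from xi the product is the multiplication by the smooth coefficients, so that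
   phi solves the regular equation ((a_0 + a_1) u'')'' = w^2 (b_0 + b_1) u on each side
   of xi, where distributional solutions are smooth and determined by their jets.
   Hence phi = u_- H(xi - x) + u_+ H(x - xi) + S with S supported at xi; the most
   singular term is (a_0-(xi) + a_1+(xi)) D^4 S, which forces S = 0.  The coefficients
   of delta^(3), ..., delta at xi then give four linear relations between the jets of
   u_- and u_+ at xi.  The order conditions say that some of the A_0j, B_0j vanish,
   and in each of the three cases the relations are triangular in the jet of u_+, so
   that u_+ is uniquely determined by u_- (and symmetrically for i = 1). *)
Require Import Defs.
From HB Require Import structures.
From mathcomp Require Import all_boot all_order all_algebra.
From mathcomp Require Import all_classical all_reals all_analysis.
From mathcomp Require Import measurable_realfun.
From mathcomp Require Import complex.
From mathcomp Require Import ring lra.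
Set Implicit Arguments.
Unset Strict Implicit.
Unset Printing Implicit Defensive.
Import Order.TTheory GRing.Theory Num.Theory.
Import numFieldNormedType.Exports.

Local Open Scope classical_set_scope.
Local Open Scope complex_scope.
Local Open Scope ring_scope.

Local Notation cRe := (@complex.Re _).
Local Notation cIm := (@complex.Im _).
Local Notation "f ^` ()" := (derive1 f) : ring_scope.
Local Notation "f ^` ( n )" := (derive1n n f) : ring_scope.

(** * Smooth functions on open sets and cut-offs *)

(** [star] is a choice among limits, so each product in the equation must first be shown to exist
    and to have one value, although a priori [phi] in [calA] may be singular anywhere. Uniqueness
    comes from the locality of distributions. Existence is by induction on the order of
    differentiation: [F * G] and [DF * G] yield [F * DG] as [D(F * G) - DF * G], which is also the
    Leibniz rule. An explicit formula is needed only when both factors are singular at [xi] alone.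
    The shift in [F(x) G(x + e)] fixes the sides: Diracs of the left factor see the right branch of
    the other, Diracs of the right factor its left branch. Hence the mixed value in front of the
    Diracs of [phi'']; hence also the Diracs of [a_0], [b_0] meet only the jet of [u_+] and those of
    [a_1], [b_1] only the jet of [u_-], so that the conditions for [i = 0] serve data on the left
    and those for [i = 1] data on the right. That [S] is a finite sum of Diracs is seen on the
    piecewise smooth [g] with [phi = D^n g]: smoothness of [phi] on a side passes to [g], up to
    [xi]. *)

Section real_smooth_on.
Context {R : realType}.
Implicit Types (f g : R -> R) (D : set R).

Lemma near_open D x (P : R -> Prop) : open D -> D x -> (forall y, D y -> P y) ->
  \forall y \near x, P y.
Proof. by move=> oD Dx DP; apply: filterS (open_nbhs_nbhs (conj oD Dx)). Qed.

Definition rsmooth_on D f : Prop :=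
  forall n x, D x -> derivable (derive1n n f) x 1.

Lemma derive1_eq_on D f g x : open D -> D x -> (forall y, D y -> f y = g y) ->
  derive1 f x = derive1 g x.
Proof.
move=> oD Dx fg; rewrite !derive1E; apply: near_eq_derive.
by apply: filterS (open_nbhs_nbhs (conj oD Dx)) => y; exact: fg.
Qed.

Lemma derivable_eq_on D f g x : open D -> D x -> (forall y, D y -> f y = g y) ->
  derivable f x 1 -> derivable g x 1.
Proof.
move=> oD Dx fg; apply: near_eq_derivable.
by apply: filterS (open_nbhs_nbhs (conj oD Dx)) => y; exact: fg.
Qed.

Lemma derive1n_eq_on D f g : open D -> (forall y, D y -> f y = g y) ->
  forall n x, D x -> derive1n n f x = derive1n n g x.
Proof.
move=> oD fg; elim=> [|n IH] x Dx; first exact: fg.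
by rewrite !derive1nS; apply: (derive1_eq_on oD Dx).
Qed.

(** Smoothness by coinduction: a class that is differentiable on [D] and stable under
    differentiation is enough, so that no formula for iterated derivatives is ever computed.
    Equality on [D] suffices because [D] is open. *)
Lemma rsmooth_on_coind (P : (R -> R) -> Prop) D : open D ->
  (forall f, P f -> (forall x, D x -> derivable f x 1) /\
     exists2 g, P g & forall x, D x -> derive1 f x = g x) ->
  forall f, P f -> rsmooth_on D f.
Proof.
move=> oD HP f Pf n.
have [g Pg E] : exists2 g, P g & forall x, D x -> derive1n n f x = g x.
  elim: n => [|n [g Pg E]]; first by exists f.
  have [_ [h Ph E']] := HP _ Pg; exists h => // x Dx.
  by rewrite derive1nS (derive1_eq_on oD Dx E) E'.
move=> x Dx; apply: (@derivable_eq_on D g) => //; first by move=> y Dy; rewrite E.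
by have [dg _] := HP _ Pg; exact: dg.
Qed.

Lemma rsmooth_on_derive1 D f : rsmooth_on D f -> rsmooth_on D (derive1 f).
Proof. by move=> sf n x Dx; rewrite -derive1Sn; exact: sf. Qed.

Lemma rsmooth_on_eq D f g : open D -> (forall y, D y -> f y = g y) ->
  rsmooth_on D f -> rsmooth_on D g.
Proof.
move=> oD fg sf n x Dx; apply: (@derivable_eq_on D (derive1n n f)) => //.
- by move=> y Dy; exact: (derive1n_eq_on oD).
- exact: sf.
Qed.

(** A class for [rsmooth_on_coind]. The derivative of a reciprocal contains the reciprocal again, so
    sums, products and reciprocals are closed off simultaneously rather than one operation at a
    time. *)
Inductive smooth_gen D : (R -> R) -> Prop :=
| SmoothGen f : rsmooth_on D f -> smooth_gen D f
| SmoothAdd f g : smooth_gen D f -> smooth_gen D g -> smooth_gen D (f \+ g)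
| SmoothMul f g : smooth_gen D f -> smooth_gen D g -> smooth_gen D (f \* g)
| SmoothInv f : smooth_gen D f -> (forall x, D x -> f x != 0) ->
    smooth_gen D (fun x => (f x)^-1).

Lemma smooth_gen_smooth D f : open D -> smooth_gen D f -> rsmooth_on D f.
Proof.
move=> oD; apply: rsmooth_on_coind => // {}f.
elim=> {f} [f sf|f g _ [df [f' Pf Ef]] _ [dg [g' Pg Eg]]
  |f g Hf [df [f' Pf Ef]] Hg [dg [g' Pg Eg]]|f Hf [df [f' Pf Ef]] f0].
- split; first exact: (sf 0%N).
  by exists (derive1 f); last by []; exact/SmoothGen/rsmooth_on_derive1.
- split=> [x Dx|]; first by apply: derivableD; [exact: df|exact: dg].
  exists (f' \+ g'); first exact: SmoothAdd.
  move=> x Dx; rewrite derive1E deriveD; [|exact: df|exact: dg].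
  by rewrite -!derive1E Ef ?Eg.
- split=> [x Dx|]; first by apply: derivableM; [exact: df|exact: dg].
  exists ((f \* g') \+ (g \* f')).
    by apply: SmoothAdd; exact: SmoothMul.
  move=> x Dx; rewrite derive1E deriveM; [|exact: df|exact: dg].
  by rewrite -!derive1E Ef ?Eg.
- split=> [x Dx|]; first by apply: derivableV; [exact: f0|exact: df].
  exists (cst (-1) \* ((fun x => (f x)^-1) \* (fun x => (f x)^-1) \* f')).
    apply: SmoothMul.
      by apply: SmoothGen => n x _; exact: rsmooth_cst.
    by apply: SmoothMul => //; apply: SmoothMul; exact: SmoothInv.
  move=> x Dx; rewrite derive1E deriveV; [|exact: f0|exact: df].
  by rewrite -derive1E Ef //= mulN1r -exprVn expr2 scaleNr.
Qed.

Lemma rsmooth_onM D f g : open D -> rsmooth_on D f -> rsmooth_on D g ->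
  rsmooth_on D (f \* g).
Proof.
by move=> oD sf sg; apply: smooth_gen_smooth => //; apply: SmoothMul; exact: SmoothGen.
Qed.

Lemma rsmooth_onD D f g : open D -> rsmooth_on D f -> rsmooth_on D g ->
  rsmooth_on D (f \+ g).
Proof.
by move=> oD sf sg; apply: smooth_gen_smooth => //; apply: SmoothAdd; exact: SmoothGen.
Qed.

Lemma rsmooth_onN D f : open D -> rsmooth_on D f -> rsmooth_on D (\- f).
Proof.
move=> oD sf; have -> : \- f = cst (- 1) \* f.
  by apply/funext => x; rewrite /= mulN1r.
by apply: (rsmooth_onM oD _ sf) => n x _; exact: rsmooth_cst.
Qed.

Lemma rsmooth_onT f : rsmooth f <-> rsmooth_on setT f.
Proof. by split=> sf n x; [move=> _|]; exact: sf. Qed.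

Lemma rsmoothV f : rsmooth f -> (forall x, f x != 0) -> rsmooth (fun x => (f x)^-1).
Proof.
move=> /rsmooth_onT sf f0; apply/rsmooth_onT/smooth_gen_smooth; first exact: openT.
by apply: SmoothInv => //; exact: SmoothGen.
Qed.

Lemma is_derive_affine (a b x : R) : is_derive x 1 (fun y : R => a * y + b) a.
Proof.
by apply: is_derive_eq; rewrite addr0 /GRing.scale /= mulr1.
Qed.

Lemma derive1n_affine f (a b : R) n : rsmooth f ->
  derive1n n (fun y => f (a * y + b)) = fun y => a ^+ n * derive1n n f (a * y + b).
Proof.
move=> sf; elim: n => [|n IH]; first by apply/funext => y; rewrite mul1r.
rewrite derive1nS IH; apply/funext => y.
have dx := is_derive_affine a b y.
have df : is_derive (a * y + b) 1 (derive1n n f) (derive1n n.+1 f (a * y + b)).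
  by rewrite derive1nS derive1E; apply: DeriveDef => //; exact: sf.
have dc := @is_derive1_comp R (derive1n n f) (fun y => a * y + b) y _ _ df dx.
rewrite derive1E.
have -> : (fun y0 : R => a ^+ n * derive1n n f (a * y0 + b)) =
   cst (a ^+ n) \* (derive1n n f \o (fun y => a * y + b)) by [].
rewrite deriveM; [|exact: derivable_cst|by case: dc].
rewrite derive_cst scaler0 addr0; case: dc => _ ->.
by rewrite [LHS]/GRing.scale /= exprSr -mulrA; congr (_ * _); exact: mulrC.
Qed.

Lemma rsmooth_affine f (a b : R) : rsmooth f -> rsmooth (fun y => f (a * y + b)).
Proof.
move=> sf n x; rewrite derive1n_affine //.
have -> : (fun y => a ^+ n * derive1n n f (a * y + b)) =
   cst (a ^+ n) \* (derive1n n f \o (fun y => a * y + b)) by [].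
apply: derivableM; first exact: derivable_cst.
have df : is_derive (a * x + b) 1 (derive1n n f) (derive1n n.+1 f (a * x + b)).
  by rewrite derive1nS derive1E; apply: DeriveDef => //; exact: sf.
have dx := is_derive_affine a b x.
by have [] := @is_derive1_comp R (derive1n n f) (fun y => a * y + b) x _ _ df dx.
Qed.

Lemma rsmooth_id : rsmooth (id : R -> R).
Proof.
apply/rsmooth_onT => -[|n] x _; first exact: derivable_id.
rewrite derive1Sn; have -> : derive1 (id : R -> R) = cst 1.
  by apply/funext => y; rewrite derive1_id.
exact: rsmooth_cst.
Qed.

Lemma rsmooth_exp f n : rsmooth f -> rsmooth (fun x => f x ^+ n).
Proof.
move=> sf; elim: n => [|n IH].
  have -> : (fun x => f x ^+ 0) = cst 1 by apply/funext => x; rewrite expr0.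
  exact: rsmooth_cst.
have -> : (fun x => f x ^+ n.+1) = f \* (fun x => f x ^+ n).
  by apply/funext => x; rewrite /= exprS.
exact: rsmoothM.
Qed.

End real_smooth_on.

(** * Smooth cut-offs built from [exp(-1/x)] *)

Section bump.
Context {R : realType}.

(** The functions [p(1/x) exp(-1/x)], extended by 0 to the left. Unlike [exp(-1/x)] alone, this
    family is stable under differentiation, which turns [p] into [X^2 (p - p')]. *)
Definition flat (p : {poly R}) (x : R) : R :=
  if 0 < x then p.[x^-1] * expR (- x^-1) else 0.

Lemma horner_le_expR (p : {poly R}) :
  exists2 C, 0 <= C & forall y, 0 <= y -> `|p.[y]| <= C * expR y.
Proof.
exists (\sum_(i < size p) `|p`_i| * i`!%:R).
  by apply: sumr_ge0 => i _; apply: mulr_ge0.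
move=> y y0; rewrite horner_coef mulr_suml.
apply: (le_trans (ler_norm_sum _ _ _)); apply: ler_sum => i _.
rewrite normrM -mulrA ler_wpM2l ?normr_ge0 // ger0_norm ?exprn_ge0 //.
case: (nat_of_ord i) => [|n].
  by rewrite fact0 expr0 mul1r -expR0 ler_expR.
rewrite mulrC -ler_pdivrMr ?ltr0n ?fact_gt0 //.
by apply: le_trans (expR_ge1Dxn n y0); rewrite lerDr.
Qed.

(** The exponential bound is applied to [p X^2] at [y = 1/x]; the two extra powers give vanishing to
    second order at 0, hence a zero derivative there. *)
Definition flat_bound (p : {poly R}) :
  exists C, forall x, 0 < x -> `|flat p x| <= C * x ^+ 2.
Proof.
have [C C0 HC] := horner_le_expR (p * 'X^2).
exists C => x x0; rewrite /flat x0.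
have y0 : 0 <= x^-1 by rewrite invr_ge0 ltW.
have := HC _ y0; rewrite hornerM hornerXn normrM normrX (ger0_norm y0) => H.
rewrite normrM (ger0_norm (expR_ge0 _)) expRN ler_pdivrMr ?expR_gt0 //.
move: H; rewrite exprVn ler_pdivrMr ?exprn_gt0 //.
by rewrite mulrAC.
Qed.

Lemma derivable_flat (p : {poly R}) (x : R) :
  is_derive x 1 (flat p) (flat ('X^2 * (p - deriv p)) x).
Proof.
have [x0|x0|->] := ltgtP x 0.
- have E : flat ('X^2 * (p - deriv p)) x = 0 by rewrite /flat ltNge (ltW x0).
  rewrite E; apply: (@near_eq_is_derive _ _ _ (cst 0)).
    apply: (near_open (@open_lt R 0) x0) => y /= y0.
    by rewrite /flat ltNge (ltW y0).
- have xn0 : x != 0 by rewrite gt_eqF.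
  have dV : is_derive x 1 (fun y : R => y^-1) (- x ^- 2).
    apply: is_derive_eq; first exact: is_deriveV.
    by rewrite /GRing.scale /= mulr1.
  have dNV : is_derive x 1 (fun y : R => - y^-1) (x ^- 2).
    by apply: is_derive_eq; rewrite opprK.
  have dp : is_derive x 1 (fun y : R => p.[y^-1]) ((deriv p).[x^-1] * - x ^- 2).
    exact: (@is_derive1_comp R (horner p) (fun y => y^-1) x _ _ (is_derive_poly p _) dV).
  have de : is_derive x 1 (fun y : R => expR (- y^-1)) (expR (- x^-1) * x ^- 2).
    exact: (@is_derive1_comp R expR (fun y => - y^-1) x _ _ (is_derive_expR _) dNV).
  have d : is_derive x 1 (fun y : R => p.[y^-1] * expR (- y^-1))
      (flat ('X^2 * (p - deriv p)) x).
    apply: is_derive_eq.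
    rewrite /flat x0 /GRing.scale /= hornerM hornerXn hornerD hornerN exprVn; ring.
  apply: near_eq_is_derive d.
  apply: (near_open (@open_gt R 0) x0) => y /= y0.
  by rewrite /flat y0.
- have -> : flat ('X^2 * (p - deriv p)) 0 = 0 by rewrite /flat ltxx.
  have [C HC] := flat_bound p.
  have cv : h^-1 *: ((flat p \o shift 0) (h *: (1 : R)) - flat p 0) @[h --> (0:R)^'] --> (0 : R).
    apply/cvgr0Pnorm_le => e e0; near=> h.
    rewrite /= addr0 {2}/flat ltxx subr0 /GRing.scale /= mulr1.
    have [h0|h0] := ltP 0 h; last by rewrite /flat ltNge h0 mulr0 normr0 ltW.
    have hn0 : `|h| != 0 by rewrite normr_eq0 gt_eqF.
    rewrite normrM normfV mulrC ler_pdivrMr ?normr_gt0 ?gt_eqF //.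
    apply: (le_trans (HC _ h0)); rewrite (gtr0_norm h0) expr2 mulrA ler_pM2r //.
    have C1 : 0 < `|C| + 1 by rewrite ltr_wpDl.
    have : `|h| <= e / (`|C| + 1).
      by near: h; apply: dnbhs0_le; rewrite divr_gt0.
    rewrite (gtr0_norm h0) ler_pdivlMr // mulrC; apply: le_trans.
    by rewrite ler_pM2r // (le_trans (ler_norm _)) // lerDl.
  exact: (DeriveDef (cvgP _ cv) (cvg_lim _ cv)).
Unshelve. all: by end_near. Qed.

Lemma rsmooth_flat (p : {poly R}) : rsmooth (flat p).
Proof.
apply/rsmooth_onT.
apply: (@rsmooth_on_coind _ (fun f => exists p, f = flat p) setT); first exact: openT.
  move=> _ [q ->]; split=> [x _|]; first by case: (derivable_flat q x).
  exists (flat ('X^2 * (q - deriv q))); first by eexists.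
  by move=> x _; rewrite derive1E; case: (derivable_flat q x).
by eexists.
Qed.

(* The step is [e / (e + e \o (1 - _))] with [e = exp (- 1 / x)] on the positive side. *)
Lemma exists_step : exists2 S : R -> R, rsmooth S &
  [/\ forall x, 0 <= S x <= 1, forall x, x <= 0 -> S x = 0 &
      forall x, 1 <= x -> S x = 1].
Proof.
pose e : R -> R := flat 1.
have se : rsmooth e by exact: rsmooth_flat.
have eE x : e x = if 0 < x then expR (- x^-1) else 0 by rewrite /e /flat hornerC mul1r.
have e0 x : 0 <= e x by rewrite eE; case: ifP => // _; exact: expR_ge0.
have ep x : 0 < x -> 0 < e x by rewrite eE => ->; exact: expR_gt0.
have en x : x <= 0 -> e x = 0 by rewrite eE ltNge => ->.
pose e' x := e (- 1 * x + 1).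
have se' : rsmooth e' by exact: rsmooth_affine.
have dp x : 0 < e x + e' x.
  have [x0|x0] := ltP 0 x; first by rewrite ltr_wpDr ?ep ?e0.
  by rewrite ltr_wpDl ?e0 // ep //; lra.
exists (e \* (fun x => (e x + e' x)^-1)).
  apply: rsmoothM; first exact: se.
  apply: (@rsmoothV _ (e \+ e')); first exact: (rsmoothD se se').
  by move=> x; rewrite gt_eqF //; exact: dp.
split=> x.
- apply/andP; split; first by rewrite /= divr_ge0 ?e0 ?ltW.
  by rewrite /= ler_pdivrMr ?dp // mul1r lerDl; exact: e0.
- by move=> x0; rewrite /= en ?mul0r.
- move=> x1; rewrite /= [e' x]en ?addr0; last by lra.
  by rewrite divff // gt_eqF // ep //; lra.
Qed.

Lemma exists_cut (a b : R) : a < b -> exists2 S : R -> R, rsmooth S &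
  [/\ forall x, 0 <= S x <= 1, forall x, x <= a -> S x = 0 &
      forall x, b <= x -> S x = 1].
Proof.
move=> ab; have [S sS [S01 S0 S1]] := exists_step.
have d : 0 < b - a by rewrite subr_gt0.
exists (fun x => S ((b - a)^-1 * x + (- a / (b - a)))); first exact: rsmooth_affine.
split=> x.
- exact: S01.
- move=> xa; apply: S0; rewrite [_ * x]mulrC -mulrDl mulr_le0_ge0 ?subr_le0 //.
  by rewrite invr_ge0 ltW.
- move=> xa; apply: S1; rewrite [_ * x]mulrC -mulrDl ler_pdivlMr // mul1r.
  by rewrite lerD2r.
Qed.

Lemma exists_bump (a b c d : R) : a < b -> c < d -> exists2 S : R -> R, rsmooth S &
  [/\ forall x, 0 <= S x <= 1, forall x, x <= a \/ d <= x -> S x = 0 &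
      forall x, b <= x <= c -> S x = 1].
Proof.
move=> ab cd; have [S sS [S01 S0 S1]] := exists_cut ab.
have dc : - d < - c by rewrite ltrN2.
have [T sT [T01 T0 T1]] := exists_cut dc.
exists (S \* (fun x => T (- 1 * x + 0))).
  by apply: rsmoothM; [exact: sS|exact: rsmooth_affine].
split=> x /=.
- have /andP[s0 s1] := S01 x; have /andP[t0 t1] := T01 (- 1 * x + 0).
  by rewrite mulr_ge0 // mulr_ile1.
- case=> h; first by rewrite S0 ?mul0r.
  by rewrite T0 ?mulr0 // addr0 mulN1r lerN2.
- by move=> /andP[bx xc]; rewrite S1 ?T1 ?mulr1 // addr0 mulN1r lerN2.
Qed.

End bump.

(** * Complex-valued smooth functions and test functions *)

Section complex_parts.
Context {R : realType}.
Implicit Types z w : R[i].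

Lemma complex_eq z w : cRe z = cRe w -> cIm z = cIm w -> z = w.
Proof. by case: z => a b; case: w => c d /= -> ->. Qed.

Lemma cReD z w : cRe (z + w) = cRe z + cRe w. Proof. by case: z; case: w. Qed.
Lemma cImD z w : cIm (z + w) = cIm z + cIm w. Proof. by case: z; case: w. Qed.
Lemma cReN z : cRe (- z) = - cRe z. Proof. by case: z. Qed.
Lemma cImN z : cIm (- z) = - cIm z. Proof. by case: z. Qed.
Lemma cReM z w : cRe (z * w) = cRe z * cRe w - cIm z * cIm w.
Proof. by case: z; case: w. Qed.
Lemma cImM z w : cIm (z * w) = cRe z * cIm w + cIm z * cRe w.
Proof. by case: z; case: w. Qed.
Definition cE := (cReD, cImD, cReN, cImN, cReM, cImM).

End complex_parts.

Section smooth_on.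
Context {R : realType}.
Implicit Types (f g : R -> R[i]) (D : set R).

Definition smooth_on D f : Prop := forall n x, D x -> cderivable (cderive n f) x.

Lemma smooth_onP D f :
  smooth_on D f <-> rsmooth_on D (cRe \o f) /\ rsmooth_on D (cIm \o f).
Proof.
split=> [sf|[rf jf] n x Dx]; first by split=> n x Dx; case: (sf n x Dx).
by split; [exact: rf|exact: jf].
Qed.

Lemma smooth_onT f : smooth f <-> smooth_on setT f.
Proof. by rewrite smooth_onP -!rsmooth_onT. Qed.

Lemma smooth_on_sub D D' f : D `<=` D' -> smooth_on D' f -> smooth_on D f.
Proof. by move=> sD sf n x /sD; exact: sf. Qed.

Lemma smooth_onW D f : smooth f -> smooth_on D f.
Proof. by move=> /smooth_onT; exact: smooth_on_sub. Qed.

Lemma smooth_onU D D' f : smooth_on D f -> smooth_on D' f -> smooth_on (D `|` D') f.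
Proof. by move=> s s' n x [Dx|Dx]; [exact: s|exact: s']. Qed.

Lemma smooth_on_eq D f g : open D -> (forall x, D x -> f x = g x) ->
  smooth_on D f -> smooth_on D g.
Proof.
move=> oD fg /smooth_onP[rf jf]; apply/smooth_onP; split.
- by apply: rsmooth_on_eq rf => // x Dx /=; rewrite fg.
- by apply: rsmooth_on_eq jf => // x Dx /=; rewrite fg.
Qed.

Lemma cderive_eq_on D f g : open D -> (forall x, D x -> f x = g x) ->
  forall n x, D x -> cderive n f x = cderive n g x.
Proof.
move=> oD fg n x Dx; rewrite /cderive; congr (_ +i* _).
- by apply: (derive1n_eq_on oD) => // y Dy /=; rewrite fg.
- by apply: (derive1n_eq_on oD) => // y Dy /=; rewrite fg.
Qed.

Lemma smooth_onM D f g : open D -> smooth_on D f -> smooth_on D g ->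
  smooth_on D (fun x => f x * g x).
Proof.
move=> oD /smooth_onP[rf jf] /smooth_onP[rg jg]; apply/smooth_onP; split.
- have -> : cRe \o (fun x => f x * g x) =
     ((cRe \o f) \* (cRe \o g)) \+ (\- ((cIm \o f) \* (cIm \o g))).
    by apply/funext => x; rewrite /= cE.
  exact: (rsmooth_onD oD (rsmooth_onM oD rf rg) (rsmooth_onN oD (rsmooth_onM oD jf jg))).
- have -> : cIm \o (fun x => f x * g x) =
     ((cRe \o f) \* (cIm \o g)) \+ ((cIm \o f) \* (cRe \o g)).
    by apply/funext => x; rewrite /= cE.
  exact: (rsmooth_onD oD (rsmooth_onM oD rf jg) (rsmooth_onM oD jf rg)).
Qed.

Lemma smoothDp f g : smooth f -> smooth g -> smooth (fun x => f x + g x).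
Proof. exact: smoothD. Qed.

Lemma smoothNp f : smooth f -> smooth (fun x => - f x).
Proof.
move=> sf; have -> : (fun x => - f x) = (fun x => cst (-1) x * f x).
  by apply/funext => x; rewrite mulN1r.
exact: (smoothM (smooth_cst (-1)) sf).
Qed.

Lemma smoothBp f g : smooth f -> smooth g -> smooth (fun x => f x - g x).
Proof. by move=> sf sg; exact: (smoothDp sf (smoothNp sg)). Qed.

(** The reciprocal is the conjugate divided by [N = |f|^2], which reduces the claim to a
    nonvanishing real function. *)
Lemma smoothV f : smooth f -> (forall x, f x != 0) -> smooth (fun x => (f x)^-1).
Proof.
move=> [rf jf] f0.
pose N x := cRe (f x) ^+ 2 + cIm (f x) ^+ 2.
have sN : rsmooth (fun x => (N x)^-1).
  apply: rsmoothV => [|x].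
    apply: (@rsmoothD _ (fun x => cRe (f x) ^+ 2) (fun x => cIm (f x) ^+ 2)).
    - exact: (@rsmooth_exp _ (cRe \o f)).
    - exact: (@rsmooth_exp _ (cIm \o f)).
  apply: contra (f0 x); rewrite paddr_eq0 ?sqr_ge0 // !sqrf_eq0 => /andP[/eqP a /eqP b].
  by apply/eqP/complex_eq; rewrite ?a ?b.
split.
- have -> : cRe \o (fun x => (f x)^-1) = (cRe \o f) \* (fun x => (N x)^-1).
    by apply/funext => x; rewrite /N /=; case: (f x).
  exact: (rsmoothM rf sN).
- have -> : cIm \o (fun x => (f x)^-1) = (\- (cIm \o f)) \* (fun x => (N x)^-1).
    by apply/funext => x; rewrite /N /=; case: (f x) => a b; rewrite /= mulNr.
  exact: (rsmoothM (rsmoothN jf) sN).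
Qed.

Lemma smooth_real (f : R -> R) : rsmooth f -> smooth (fun x => (f x)%:C).
Proof.
move=> sf; split; first exact: sf.
by have -> : cIm \o (fun x => (f x)%:C) = cst 0 by []; exact: rsmooth_cst.
Qed.

Lemma cderive0 f : cderive 0 f = f.
Proof. by apply/funext => x; rewrite /cderive /=; case: (f x). Qed.

Lemma cderiveSr n f : cderive n.+1 f = cderive n (cderive 1 f).
Proof. by apply/funext => x; rewrite /cderive !derive1Sn. Qed.

Lemma cderiveS n f : cderive n.+1 f = cderive 1 (cderive n f).
Proof. by apply/funext => x; rewrite /cderive !derive1nS. Qed.

Lemma cderive_cderive m n f : cderive m (cderive n f) = cderive (m + n) f.
Proof.
elim: m => [|m IH]; first exact: cderive0.
rewrite addSn [in LHS]cderiveS IH [in RHS]cderiveS; reflexivity.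
Qed.

Lemma smooth_on_cderive D n f : smooth_on D f -> smooth_on D (cderive n f).
Proof. by move=> sf k x Dx; rewrite cderive_cderive; exact: sf. Qed.

Lemma smooth_cderiven n f : smooth f -> smooth (cderive n f).
Proof. by rewrite !smooth_onT; exact: smooth_on_cderive. Qed.

Lemma cderive1D f g x : cderivable f x -> cderivable g x ->
  cderive 1 (fun y => f y + g y) x = cderive 1 f x + cderive 1 g x.
Proof.
move=> [rf jf] [rg jg]; rewrite /cderive /= !derive1E.
have -> : cRe \o (fun x => f x + g x) = (cRe \o f) + (cRe \o g).
  by apply/funext => y; rewrite fctE /= cReD.
have -> : cIm \o (fun x => f x + g x) = (cIm \o f) + (cIm \o g).
  by apply/funext => y; rewrite fctE /= cImD.
by rewrite (deriveD rf rg) (deriveD jf jg).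
Qed.

Lemma cderive1M f g x : cderivable f x -> cderivable g x ->
  cderive 1 (fun y => f y * g y) x = cderive 1 f x * g x + f x * cderive 1 g x.
Proof.
move=> [rf jf] [rg jg]; rewrite /cderive /= !derive1E.
have -> : cRe \o (fun x => f x * g x) =
   ((cRe \o f) * (cRe \o g)) - ((cIm \o f) * (cIm \o g)).
  by apply/funext => y; rewrite fctE /= cReM.
have -> : cIm \o (fun x => f x * g x) =
   ((cRe \o f) * (cIm \o g)) + ((cIm \o f) * (cRe \o g)).
  by apply/funext => y; rewrite fctE /= cImM.
rewrite (deriveB (derivableM rf rg) (derivableM jf jg)).
rewrite (deriveD (derivableM rf jg) (derivableM jf rg)).
rewrite (deriveM rf rg) (deriveM jf jg) (deriveM rf jg) (deriveM jf rg).
move: ('D_1 (cRe \o f) x) ('D_1 (cIm \o f) x) ('D_1 (cRe \o g) x) ('D_1 (cIm \o g) x).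
move=> a b c d; rewrite /GRing.scale /=.
by apply: complex_eq; rewrite !cE /=; ring.
Qed.

Lemma smooth_cderivable f x : smooth f -> cderivable f x.
Proof. by move=> [rf jf]; split; [exact: (rf 0%N)|exact: (jf 0%N)]. Qed.

Lemma cderive_cst (c : R[i]) : cderive 1 (cst c : R -> R[i]) = cst 0.
Proof.
apply/funext => x; rewrite /cderive /=.
have -> : cRe \o (cst c : R -> R[i]) = cst (cRe c) by [].
have -> : cIm \o (cst c : R -> R[i]) = cst (cIm c) by [].
by rewrite !derive1_cst.
Qed.

Lemma cderive1Z (c : R[i]) f x : cderivable f x ->
  cderive 1 (fun y => c * f y) x = c * cderive 1 f x.
Proof.
move=> df; have dc : cderivable (cst c) x by exact/smooth_cderivable/smooth_cst.
by rewrite (cderive1M dc df) cderive_cst mul0r add0r.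
Qed.

Lemma cderive_affine f (a b : R) n : smooth f ->
  cderive n (fun y => f (a * y + b)) = fun y => (a ^+ n)%:C * cderive n f (a * y + b).
Proof.
move=> [rf jf]; apply/funext => y; rewrite /cderive.
have -> : cRe \o (fun y => f (a * y + b)) = fun y => (cRe \o f) (a * y + b) by [].
have -> : cIm \o (fun y => f (a * y + b)) = fun y => (cIm \o f) (a * y + b) by [].
rewrite !derive1n_affine //.
by apply: complex_eq; rewrite !cE /=; ring.
Qed.

Lemma smooth_affine f (a b : R) : smooth f -> smooth (fun y => f (a * y + b)).
Proof.
move=> [rf jf]; split.
- exact: (@rsmooth_affine _ (cRe \o f)).
- exact: (@rsmooth_affine _ (cIm \o f)).
Qed.

Lemma cderivable_continuous f x : cderivable f x ->
  {for x, continuous (cRe \o f)} /\ {for x, continuous (cIm \o f)}.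
Proof.
move=> [rf jf]; split.
- exact/differentiable_continuous/derivable1_diffP.
- exact/differentiable_continuous/derivable1_diffP.
Qed.

Lemma smooth_continuous f : smooth f ->
  continuous (cRe \o f) /\ continuous (cIm \o f).
Proof.
move=> sf; split=> x; first by case: (cderivable_continuous (smooth_cderivable x sf)).
by case: (cderivable_continuous (smooth_cderivable x sf)).
Qed.

(** The definition of the Hörmander product asks for factors smooth on the whole line. Multiplying
    [f] by a bump equal to 1 up to distance [e / 4] and to 0 beyond [e / 2] provides one without
    changing [f] near [x]. *)
Lemma smooth_on_extend D f x : open D -> D x -> smooth_on D f ->
  exists2 r : R, 0 < r & exists2 h, smooth h &
    forall y, `|y - x| < r -> D y /\ h y = f y.
Proof.
move=> oD Dx sf.
have /nbhs_ballP[e /= e0 He] : nbhs x D by exact: open_nbhs_nbhs.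
have e4 : 0 < e / 4 by rewrite divr_gt0.
have ab : x - e / 2 < x - e / 4 by lra.
have cd : x + e / 4 < x + e / 2 by lra.
have [S sS [S01 S0 S1]] := exists_bump ab cd.
exists (e / 4) => //; exists (fun y => (S y)%:C * f y); last first.
  move=> y; rewrite ltr_norml => /andP[y1 y2]; split.
    by apply: He; rewrite /ball /= distrC ltr_norml; apply/andP; split; lra.
  by rewrite S1 ?mul1r //; apply/andP; split; lra.
apply/smooth_onT.
have -> : [set: R] = ball x e `|` [set y | y < x - e / 2] `|` [set y | y > x + e / 2].
  apply/seteqP; split=> // y _.
  have [h1|h1] := ltP y (x - e / 2); first by left; right.
  have [h2|h2] := ltP (x + e / 2) y; first by right.
  left; left; rewrite /ball /= distrC.
  by rewrite ltr_norml; apply/andP; split; lra.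
apply: smooth_onU; first apply: smooth_onU.
- apply: smooth_onM; first exact: ball_open.
    exact/smooth_onW/smooth_real.
  by apply: smooth_on_sub sf => y; exact: He.
- apply: (@smooth_on_eq _ (cst 0)); first exact: open_lt.
    by move=> y /= y1; rewrite S0 ?mul0r //; left; exact: ltW.
  exact/smooth_onW/smooth_cst.
- apply: (@smooth_on_eq _ (cst 0)); first exact: open_gt.
    by move=> y /= y1; rewrite S0 ?mul0r //; right; exact: ltW.
  exact/smooth_onW/smooth_cst.
Qed.

End smooth_on.

Section testfun_theory.
Context {R : realType}.
Implicit Types (psi : testfun R) (f : R -> R[i]).

Lemma testfun_ext psi1 psi2 : (forall x, psi1 x = psi2 x) -> psi1 = psi2.
Proof. by move=> h; apply: val_inj; apply/funext => x; exact: h. Qed.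

Lemma tfunD psi1 psi2 x : (psi1 + psi2) x = psi1 x + psi2 x. Proof. by []. Qed.
Lemma tfunZ c psi x : (c *: psi) x = c * psi x. Proof. by []. Qed.
Lemma tfunN psi x : (- psi) x = - psi x. Proof. by []. Qed.
Lemma tfun0 x : (0 : testfun R) x = 0. Proof. by []. Qed.

Lemma tsupp_itv f (a b : R) : (forall x, x < a \/ b < x -> f x = 0) ->
  tsupp f `<=` [set` `[a, b]].
Proof.
move=> h; apply: tsupp_sub; first exact: interval_closed.
move=> x; rewrite /= in_itv /= => /negP; rewrite negb_and -!ltNge => /orP xab.
exact: h.
Qed.

Lemma exists_testfun f (a b : R) : smooth f ->
  (forall x, x < a \/ b < x -> f x = 0) ->
  exists2 psi : testfun R, forall x, psi x = f x & tsupp psi `<=` [set` `[a, b]].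
Proof.
move=> sf f0; have sab := tsupp_itv f0.
have P : f \in testfun_pred.
  rewrite inE; split=> //; apply: compact_tsuppS sab; exact: segment_compact.
by exists (TestFun P).
Qed.

Lemma tsupp_bounded psi : exists2 M : R, 0 < M & forall x, M < `|x| -> psi x = 0.
Proof.
have /compact_bounded [M [_ HM]] := @tfun_compact R psi.
exists (`|M| + 1); first by rewrite ltr_wpDl.
move=> x Mx; apply: tsupp0 => /(HM (`|M| + 1) _) h.
have : `|x| <= `|M| + 1 by apply: h; rewrite (le_lt_trans (ler_norm M)) // ltrDl.
by rewrite leNgt Mx.
Qed.

Lemma tderiveE psi x : tderive psi x = cderive 1 psi x. Proof. by []. Qed.

Lemma tderiveD psi1 psi2 : tderive (psi1 + psi2) = tderive psi1 + tderive psi2.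
Proof.
apply: testfun_ext => x.
rewrite tfunD !tderiveE -(@cderive1D _ psi1 psi2) //.
- exact/smooth_cderivable/tfun_smooth.
- exact/smooth_cderivable/tfun_smooth.
Qed.

Lemma tderiveZ c psi : tderive (c *: psi) = c *: tderive psi.
Proof.
apply: testfun_ext => x; rewrite tfunZ !tderiveE -(@cderive1Z _ c psi) //.
exact/smooth_cderivable/tfun_smooth.
Qed.

Lemma tsupp_tderive psi : tsupp (tderive psi) `<=` tsupp psi.
Proof. exact: tsupp_cderive. Qed.

End testfun_theory.

(** * Integrals of locally bounded functions *)

Section real_integral.
Context {R : realType}.
Local Notation mu := (@lebesgue_measure R).
Implicit Types (f g h : R -> R).

(** Local boundedness, unlike local integrability, is stable under products, and it gives
    integrability as soon as the support is bounded. *)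
Definition rlocb f : Prop := measurable_fun setT f /\
  forall M : R, exists C : R, forall x, `|x| <= M -> `|f x| <= C.

Definition bsupp f : Prop := exists M : R, forall x, M < `|x| -> f x = 0.

Definition rintegrable f : Prop := mu.-integrable setT (EFin \o f).

Definition rint f : R := Rintegral mu setT f.

Lemma rlocbD f g : rlocb f -> rlocb g -> rlocb (f \+ g).
Proof.
move=> [mf bf] [mg bg]; split; first exact: measurable_funD.
move=> M; have [C HC] := bf M; have [C' HC'] := bg M; exists (C + C') => x xM.
by apply: le_trans (ler_normD _ _) _; apply: lerD; [exact: HC|exact: HC'].
Qed.

Lemma rlocbN f : rlocb f -> rlocb (\- f).
Proof.
move=> [mf bf]; split; first exact: measurable_funN.
by move=> M; have [C HC] := bf M; exists C => x xM; rewrite normrN; exact: HC.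
Qed.

Lemma rlocbM f g : rlocb f -> rlocb g -> rlocb (f \* g).
Proof.
move=> [mf bf] [mg bg]; split; first exact: measurable_funM.
move=> M; have [C HC] := bf M; have [C' HC'] := bg M; exists (C * C') => x xM.
by rewrite normrM ler_pM //; [exact: HC|exact: HC'].
Qed.

Lemma rlocb_continuous f : continuous f -> rlocb f.
Proof.
move=> cf; split; first exact: continuous_measurable_fun.
move=> M.
have := @continuous_compact _ _ f _ (continuous_subspaceT cf) (@segment_compact R (- M) M).
move=> /compact_bounded[C [_ HC]]; exists (`|C| + 1) => x; rewrite ler_norml => xM.
apply: (HC (`|C| + 1)); first by rewrite (le_lt_trans (ler_norm _)) // ltrDl.
by exists x => //=; rewrite in_itv.
Qed.

Lemma rlocb_integrable f : rlocb f -> bsupp f -> rintegrable f.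
Proof.
move=> [mf bf] [M fM]; have [C HC] := bf M.
have -> : f = f \_ [set` `[- M, M]].
  apply/funext => x; rewrite patchE; case: ifPn => // /negP; rewrite inE /= in_itv /=.
  by rewrite -ler_norml => /negP; rewrite -ltNge => /fM.
rewrite /rintegrable -restrict_EFin.
have H := @integrable_mkcond _ _ R mu [set` `[- M, M]] (EFin \o f) (measurable_itv _).
apply: H.1 => {H}.
apply: measurable_bounded_integrable; first exact: measurable_itv.
- by apply: compact_finite_measure; exact: segment_compact.
- exact: measurable_funS mf.
- exists C; split; first exact: num_real.
  move=> D CD x /=; rewrite in_itv /= -ler_norml => xM.
  by apply: le_trans (ltW CD); exact: HC.
Qed.

Lemma rintegrableD f g : rintegrable f -> rintegrable g -> rintegrable (f \+ g).
Proof.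
move=> fi gi; rewrite /rintegrable.
have -> : EFin \o (f \+ g) = (EFin \o f) \+ (EFin \o g) by [].
exact: integrableD.
Qed.

Lemma rintegrableZ c f : rintegrable f -> rintegrable (fun x => c * f x).
Proof.
move=> fi; rewrite /rintegrable.
have -> : EFin \o (fun x => c * f x) = (fun x => c%:E * (EFin \o f) x)%E by [].
exact: integrableZl.
Qed.

Lemma rintD f g : rintegrable f -> rintegrable g ->
  rint (fun x => f x + g x) = rint f + rint g.
Proof. by move=> fi gi; exact: RintegralD. Qed.

Lemma rintZ c f : rintegrable f -> rint (fun x => c * f x) = c * rint f.
Proof. by move=> fi; exact: RintegralZl. Qed.

Lemma ae_notin (s : seq R) (P : R -> Prop) : (forall x, x \notin s -> P x) ->
  {ae mu, forall x, setT x -> P x}.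
Proof.
move=> HP; exists [set` s]; split.
- apply: countable_measurable; [exact: measurable_set1|exact: (finite_set_countable (finite_seq s))].
- by apply: countable_lebesgue_measure0; exact: (finite_set_countable (finite_seq s)).
- move=> x /= nP; apply/negP => /negP xs; apply: nP => _; exact: HP.
Qed.

Lemma rint_eq_ae (s : seq R) f g : measurable_fun setT f -> measurable_fun setT g ->
  (forall x, x \notin s -> f x = g x) -> rint f = rint g.
Proof.
move=> mf mg fg; rewrite /rint /Rintegral; congr fine.
apply: ae_eq_integral => //; [exact/measurable_EFinP|exact/measurable_EFinP|].
by apply: (@ae_notin s) => x xs /=; rewrite fg.
Qed.

Lemma rint_dct (s : seq R) (f_ : nat -> R -> R) f g :
  (forall n, measurable_fun setT (f_ n)) -> measurable_fun setT f ->
  rintegrable g -> (forall n x, `|f_ n x| <= g x) ->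
  (forall x, x \notin s -> f_ n x @[n --> \oo] --> f x) ->
  rint (f_ n) @[n --> \oo] --> rint f.
Proof.
move=> mf_ mf gi fg cv.
have [|||||fi _ c] := @dominated_convergence _ _ R mu setT measurableT
   (fun n => EFin \o f_ n) (EFin \o f) (EFin \o g).
- by move=> n; apply/measurable_EFinP; exact: mf_.
- by apply/measurable_EFinP; exact: mf.
- by apply: (@ae_notin s) => x xs /=; apply/cvg_EFin; [exact: nearW|exact: cv].
- exact: gi.
- by apply: aeW => x n _ /=; rewrite lee_fin.
rewrite /rint /Rintegral; apply: fine_cvg.
by rewrite fineK; [exact: c|exact: integrable_fin_num].
Qed.

Lemma ler_rint f g : rintegrable f -> rintegrable g -> (forall x, f x <= g x) ->
  rint f <= rint g.
Proof. by move=> fi gi fg; apply: le_Rintegral. Qed.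

Lemma norm_rint_le f g : rintegrable f -> rintegrable g -> (forall x, `|f x| <= g x) ->
  `|rint f| <= rint g.
Proof.
move=> fi gi fg; apply: (le_trans (le_normr_Rintegral measurableT fi)).
apply: ler_rint => //.
by have := integrable_norm fi; rewrite /rintegrable.
Qed.

Lemma derive1_eq0_far h M x : (forall x, M < `|x| -> h x = 0) -> M < `|x| -> derive1 h x = 0.
Proof.
move=> h0 Mx; have oD : open [set x : R | M < `|x|].
  have -> : [set x : R | M < `|x|] = (fun x : R => `|x|) @^-1` [set y : R | M < y] by [].
  by apply: open_comp; [move=> y _; exact: norm_continuous|exact: open_gt].
by rewrite (@derive1_eq_on _ _ h (cst 0) x oD Mx) ?derive1_cst.
Qed.

Section half_line.
Variables (h : R -> R) (xi : R).
Hypotheses (dh : forall x, derivable h x 1) (ch : continuous (derive1 h)) (sh : bsupp h).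

Lemma rint_segment a b : a < b -> Rintegral mu [set` `[a, b]] (derive1 h) = h b - h a.
Proof.
move=> ab; rewrite /Rintegral (@continuous_FTC2 _ (derive1 h) h a b ab).
- by [].
- exact: continuous_subspaceT.
- have hc x : {for x, continuous h} by exact/differentiable_continuous/derivable1_diffP.
  split; first by move=> x _; exact: dh.
  + exact/cvg_at_right_filter/hc.
  + exact/cvg_at_left_filter/hc.
- by move=> x _.
Qed.

Lemma integrable_segment a b : mu.-integrable [set` `[a, b]] (EFin \o derive1 h).
Proof.
apply: continuous_compact_integrable; first exact: segment_compact.
exact: continuous_subspaceT.
Qed.

Lemma rint_derive_lt : rint (fun x => derive1 h x * (x < xi)%R%:R) = h xi.
Proof.
have [M HM] := sh.
(* [a] lies to the left of [xi] and of the support of [h], so that the fundamental theorem of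
   calculus on [[a, xi]] leaves only the term at [xi]. *)
pose a := Num.min (- `|M| - 1) (xi - 1).
have axi : a < xi by rewrite /a gt_min; apply/orP; right; lra.
have aM : a < - `|M| by rewrite /a gt_min; apply/orP; left; lra.
have far x : x <= a -> M < `|x|.
  move=> xa; rewrite (le_lt_trans (ler_norm M)) // lter_normr; apply/orP; right; lra.
have -> : (fun x => derive1 h x * (x < xi)%R%:R) = (derive1 h) \_ [set` `[a, xi[].
  apply/funext => x; rewrite patchE; case: ifPn; rewrite mem_setE in_itv /=.
    by move=> /andP[_ ->]; rewrite mulr1.
  rewrite negb_and -ltNge => /orP[xa|/negbTE ->]; last by rewrite mulr0.
  by rewrite (derive1_eq0_far HM) ?mul0r //; exact/far/ltW.
rewrite /rint -Rintegral_mkcond Rintegral_itv_bndo_bndc; last first.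
  apply: integrableS (@integrable_segment a xi) => //.
  by apply: subset_itvl; rewrite bnd_simp.
by rewrite rint_segment // (HM a) ?subr0 //; exact: far.
Qed.

Lemma rint_derive_gt : rint (fun x => derive1 h x * (xi < x)%R%:R) = - h xi.
Proof.
have [M HM] := sh.
pose a := Num.max (`|M| + 1) (xi + 1).
have axi : xi < a by rewrite /a lt_max; apply/orP; right; lra.
have aM : `|M| < a by rewrite /a lt_max; apply/orP; left; lra.
have far x : a <= x -> M < `|x|.
  move=> xa; rewrite (le_lt_trans (ler_norm M)) // lter_normr; apply/orP; left; lra.
have -> : (fun x => derive1 h x * (xi < x)%R%:R) = (derive1 h) \_ [set` `]xi, a]].
  apply/funext => x; rewrite patchE; case: ifPn; rewrite mem_setE in_itv /=.
    by move=> /andP[-> _]; rewrite mulr1.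
  rewrite negb_and => /orP[/negbTE ->|]; first by rewrite mulr0.
  rewrite -ltNge => xa.
  by rewrite (derive1_eq0_far HM) ?mul0r //; exact/far/ltW.
rewrite /rint -Rintegral_mkcond Rintegral_itv_obnd_cbnd; last first.
  apply: integrableS (@integrable_segment xi a) => //.
  by apply: subset_itvr; rewrite bnd_simp.
by rewrite rint_segment // (HM a) ?sub0r //; exact: far.
Qed.

End half_line.
End real_integral.

(** * Complex integrals, seminorms and regular distributions *)

Section complex_integral.
Context {R : realType}.
Local Notation mu := (@lebesgue_measure R).
Local Notation normc := (@Normc.normc R).
Implicit Types (f g : R -> R[i]) (psi : testfun R).

Definition locb f : Prop := rlocb (cRe \o f) /\ rlocb (cIm \o f).

Definition cbsupp f : Prop := exists M : R, forall x, M < `|x| -> f x = 0.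

Definition cintegrable f : Prop := rintegrable (cRe \o f) /\ rintegrable (cIm \o f).

Lemma locbD f g : locb f -> locb g -> locb (fun x => f x + g x).
Proof.
move=> [rf jf] [rg jg]; split.
- have -> : cRe \o (fun x => f x + g x) = (cRe \o f) \+ (cRe \o g).
    by apply/funext => y; rewrite /= cReD.
  exact: rlocbD.
- have -> : cIm \o (fun x => f x + g x) = (cIm \o f) \+ (cIm \o g).
    by apply/funext => y; rewrite /= cImD.
  exact: rlocbD.
Qed.

Lemma locbM f g : locb f -> locb g -> locb (fun x => f x * g x).
Proof.
move=> [rf jf] [rg jg]; split.
- have -> : cRe \o (fun x => f x * g x) =
     ((cRe \o f) \* (cRe \o g)) \+ (\- ((cIm \o f) \* (cIm \o g))).
    by apply/funext => x; rewrite /= cReM.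
  exact: (rlocbD (rlocbM rf rg) (rlocbN (rlocbM jf jg))).
- have -> : cIm \o (fun x => f x * g x) =
     ((cRe \o f) \* (cIm \o g)) \+ ((cIm \o f) \* (cRe \o g)).
    by apply/funext => x; rewrite /= cImM.
  exact: (rlocbD (rlocbM rf jg) (rlocbM jf rg)).
Qed.

Lemma locb_smooth f : smooth f -> locb f.
Proof.
by move=> /smooth_continuous[cr cj]; split; exact: rlocb_continuous.
Qed.

Lemma locb_tfun psi : locb psi.
Proof. exact/locb_smooth/tfun_smooth. Qed.

Lemma cbsupp_bsupp f : cbsupp f -> bsupp (cRe \o f) /\ bsupp (cIm \o f).
Proof. by move=> [M HM]; split; exists M => x /HM /= ->. Qed.

Lemma locb_integrable f : locb f -> cbsupp f -> cintegrable f.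
Proof.
by move=> [rf jf] /cbsupp_bsupp[sr sj]; split; exact: rlocb_integrable.
Qed.

Lemma cintegralE f : cintegral f = rint (cRe \o f) +i* rint (cIm \o f).
Proof. by []. Qed.

Lemma cintegralD f g : cintegrable f -> cintegrable g ->
  cintegral (fun x => f x + g x) = cintegral f + cintegral g.
Proof.
move=> [rf jf] [rg jg]; rewrite !cintegralE.
have -> : cRe \o (fun x => f x + g x) = (fun x => (cRe \o f) x + (cRe \o g) x).
  by apply/funext => y; rewrite /= cReD.
have -> : cIm \o (fun x => f x + g x) = (fun x => (cIm \o f) x + (cIm \o g) x).
  by apply/funext => y; rewrite /= cImD.
by rewrite !rintD.
Qed.

Lemma cintegralZ c f : cintegrable f ->
  cintegral (fun x => c * f x) = c * cintegral f.
Proof.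
move=> [rf jf]; rewrite !cintegralE.
have -> : cRe \o (fun x => c * f x) =
    (fun x => cRe c * (cRe \o f) x + (- cIm c) * (cIm \o f) x).
  by apply/funext => y; rewrite /= cReM mulNr.
have -> : cIm \o (fun x => c * f x) =
    (fun x => cRe c * (cIm \o f) x + cIm c * (cRe \o f) x).
  by apply/funext => y; rewrite /= cImM.
have Z (a : R) (h : R -> R) : rintegrable h -> rintegrable (fun x => a * h x).
  exact: rintegrableZ.
rewrite (rintD (Z _ _ rf) (Z _ _ jf)) (rintD (Z _ _ jf) (Z _ _ rf)).
rewrite !rintZ //; apply: complex_eq; rewrite !cE /=; ring.
Qed.

Lemma cbsuppM f psi : cbsupp (fun x => f x * psi x).
Proof.
have [M _ HM] := tsupp_bounded psi; exists M => x Mx.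
by rewrite HM // mulr0.
Qed.

Lemma reg_integrable f psi : locb f -> cintegrable (fun x => f x * psi x).
Proof.
by move=> lf; apply: locb_integrable (cbsuppM _ _); exact: locbM (locb_tfun _).
Qed.

Lemma reg_linear f : locb f -> linear (reg f).
Proof.
move=> lf a u v.
have -> : a *: reg f u = cintegral (fun x => a * (f x * u x)).
  by rewrite (@cintegralZ a _ (reg_integrable u lf)).
rewrite /reg -cintegralD; first last.
- exact: reg_integrable.
- have -> : (fun x => a * (f x * u x)) = (fun x => (cst a x * f x) * u x).
    by apply/funext => x; rewrite mulrA.
  by apply: reg_integrable; apply: locbM lf; exact/locb_smooth/smooth_cst.
congr cintegral; apply/funext => x; rewrite tfunD tfunZ; ring.
Qed.

Lemma cintegral_eq_off (s : seq R) f g : locb f -> locb g ->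
  (forall x, x \notin s -> f x = g x) -> cintegral f = cintegral g.
Proof.
move=> [[mf _] [mf' _]] [[mg _] [mg' _]] fg; rewrite !cintegralE; congr (_ +i* _).
- by apply: (rint_eq_ae mf mg (s := s)) => x xs /=; rewrite fg.
- by apply: (rint_eq_ae mf' mg' (s := s)) => x xs /=; rewrite fg.
Qed.

Lemma reg_eq_off (s : seq R) f g : locb f -> locb g ->
  (forall x, x \notin s -> f x = g x) -> reg f = reg g.
Proof.
move=> lf lg fg; apply/funext => psi; apply: (@cintegral_eq_off s).
- exact/locbM/locb_tfun.
- exact/locbM/locb_tfun.
- by move=> x xs; rewrite fg.
Qed.

Lemma regD f g : locb f -> locb g -> reg (fun x => f x + g x) = reg f + reg g.
Proof.
move=> lf lg; apply/funext => psi; rewrite /reg fctE -cintegralD; first last.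
- exact: reg_integrable.
- exact: reg_integrable.
by congr cintegral; apply/funext => x; rewrite mulrDl.
Qed.

Lemma regZ c f : locb f -> reg (fun x => c * f x) = c *: reg f.
Proof.
move=> lf; apply/funext => psi; rewrite /reg.
have -> : (fun x => c * f x * psi x) = (fun x => c * (f x * psi x)).
  by apply/funext => x; rewrite mulrA.
by rewrite cintegralZ //; exact: reg_integrable.
Qed.

Lemma ccvg_dct (s : seq R) (f_ : nat -> R -> R[i]) f (g : R -> R) :
  (forall n, locb (f_ n)) -> locb f -> rintegrable g ->
  (forall n x, `|cRe (f_ n x)| <= g x /\ `|cIm (f_ n x)| <= g x) ->
  (forall x, x \notin s -> ccvg_to \oo (f_ ^~ x) (f x)) ->
  ccvg_to \oo (fun n => cintegral (f_ n)) (cintegral f).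
Proof.
move=> lf_ [[mr _] [mj _]] gi fg cv; split.
- apply: (rint_dct (s := s) _ mr gi).
  + by move=> n; case: (lf_ n) => -[].
  + by move=> n x; case: (fg n x).
  + by move=> x /cv[].
- apply: (rint_dct (s := s) _ mj gi).
  + by move=> n; case: (lf_ n) => _ [].
  + by move=> n x; case: (fg n x).
  + by move=> x /cv[].
Qed.

Lemma normc_le (z : R[i]) : normc z <= `|cRe z| + `|cIm z|.
Proof.
case: z => a b /=; rewrite -[leRHS]ger0_norm ?addr_ge0 // -sqrtr_sqr ler_sqrt ?sqr_ge0 //.
by rewrite sqrrD !real_normK ?num_real // lerD2r lerDl mulrn_wge0 // mulr_ge0.
Qed.

Lemma ler_normc (z : R[i]) : `|cRe z| <= normc z /\ `|cIm z| <= normc z.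
Proof.
case: z => a b /=; rewrite -!sqrtr_sqr !ler_sqrt ?addr_ge0 ?sqr_ge0 //.
by rewrite lerDl lerDr !sqr_ge0.
Qed.

Lemma normc_ge0 (z : R[i]) : 0 <= normc z.
Proof. by apply: le_trans (normr_ge0 (cRe z)) _; case: (ler_normc z). Qed.

Lemma normcN (z : R[i]) : normc (- z) = normc z.
Proof. by case: z => a b /=; rewrite !sqrrN. Qed.

Lemma le_normcD (z w : R[i]) : normc (z + w) <= normc z + normc w.
Proof.
have E (u : R[i]) : `|u| = (normc u)%:C by rewrite normc_def; case: u.
by rewrite -lecR; have := ler_normD z w; rewrite !E -raddfD.
Qed.

Definition seminorm k psi : R := sup (range (fun x => normc (cderive k psi x))).

Lemma seminorm_ge k psi x : normc (cderive k psi x) <= seminorm k psi.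
Proof.
apply: ub_le_sup; last by exists x.
have [rk jk] : locb (cderive k psi) by exact/locb_smooth/smooth_cderiven/tfun_smooth.
have [M M0 HM] := tsupp_bounded (iter k tderive psi).
have itE : (iter k tderive psi : R -> _) = cderive k psi.
  by elim: k {rk jk HM} => [|k IH]; rewrite ?cderive0 // cderiveS -IH.
have [C HC] := rk.2 M; have [C' HC'] := jk.2 M.
exists (`|C| + `|C'|) => _ [y _ <-].
have [yM|yM] := leP `|y| M.
  apply: (le_trans (normc_le _)); apply: lerD.
    by apply: (le_trans (HC _ yM)); exact: ler_norm.
  by apply: (le_trans (HC' _ yM)); exact: ler_norm.
by rewrite -itE HM // Normc.normc0 addr_ge0.
Qed.

Lemma seminorm_ge0 k psi : 0 <= seminorm k psi.
Proof. exact: le_trans (normc_ge0 _) (seminorm_ge k psi 0). Qed.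

Lemma seminorm_tderive k psi : seminorm k (tderive psi) = seminorm k.+1 psi.
Proof. by rewrite /seminorm cderiveSr. Qed.

Definition bounded_on (K : set R) (F : functional R) : Prop :=
  exists2 C : R, 0 <= C & exists N, forall psi, tsupp psi `<=` K ->
    normc (F psi) <= C * \sum_(k < N.+1) seminorm k psi.

Lemma is_distributionP (F : functional R) :
  is_distribution F <-> linear F /\ forall K, compact K -> bounded_on K F.
Proof.
split=> -[lF bF]; split=> // K /bF.
  move=> [C [N H]]; exists `|C| => //; exists N => psi /H h.
  apply: (le_trans h); apply: ler_wpM2r; last exact: ler_norm.
  by apply: sumr_ge0 => k _; exact: seminorm_ge0.
by move=> [C C0 [N H]]; exists C, N.
Qed.

Lemma sum_seminorm_le (N N' : nat) psi : (N <= N')%N ->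
  \sum_(k < N.+1) seminorm k psi <= \sum_(k < N'.+1) seminorm k psi.
Proof.
move=> NN; rewrite (big_ord_widen N'.+1 (fun k => seminorm k psi)) //.
rewrite [leRHS](bigID (fun k : 'I_N'.+1 => (k < N.+1)%N)) /= lerDl.
by apply: sumr_ge0 => k _; exact: seminorm_ge0.
Qed.

Lemma dderive_linear (F : functional R) : linear F -> linear (dderive F).
Proof.
move=> lF a u v; rewrite /dderive tderiveD tderiveZ lF opprD /GRing.scale /=; ring.
Qed.

Lemma is_distribution_dderive (F : functional R) :
  is_distribution F -> is_distribution (dderive F).
Proof.
move=> /is_distributionP[lF bF]; apply/is_distributionP; split.
  exact: dderive_linear.
move=> K /bF[C C0 [N H]]; exists C => //; exists N.+1 => psi pK.
rewrite /dderive normcN.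
have /H h : tsupp (tderive psi) `<=` K by move=> x /tsupp_tderive; exact: pK.
apply: (le_trans h); apply: ler_wpM2l => //.
under eq_bigr do rewrite seminorm_tderive.
by rewrite [leRHS]big_ord_recl lerDr seminorm_ge0.
Qed.

Lemma linear_addf (F G : functional R) : linear F -> linear G -> linear (F + G).
Proof.
move=> lF lG a u v; rewrite !fctE lF lG scalerDr; exact: addrACA.
Qed.

Lemma linear_scalef (c : R[i]) (F : functional R) : linear F -> linear (c *: F).
Proof.
move=> lF a u v; rewrite !fctE lF scalerDr; congr (_ + _).
by rewrite /GRing.scale /= mulrCA.
Qed.

Lemma is_distributionD (F G : functional R) :
  is_distribution F -> is_distribution G -> is_distribution (F + G).
Proof.
move=> /is_distributionP[lF bF] /is_distributionP[lG bG]; apply/is_distributionP.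
split=> [|K cK]; first exact: linear_addf.
have [C C0 [N H]] := bF K cK; have [C' C0' [N' H']] := bG K cK.
exists (C + C'); first exact: addr_ge0.
exists (maxn N N') => psi pK; rewrite fctE.
apply: (le_trans (le_normcD _ _)); rewrite mulrDl; apply: lerD.
- by apply: (le_trans (H _ pK)); apply: ler_wpM2l => //; exact/sum_seminorm_le/leq_maxl.
- by apply: (le_trans (H' _ pK)); apply: ler_wpM2l => //; exact/sum_seminorm_le/leq_maxr.
Qed.

Lemma is_distributionZ (c : R[i]) (F : functional R) :
  is_distribution F -> is_distribution (c *: F).
Proof.
move=> /is_distributionP[lF bF]; apply/is_distributionP.
split=> [|K cK]; first exact: linear_scalef.
have [C C0 [N H]] := bF K cK.
exists (normc c * C); first by rewrite mulr_ge0 ?normc_ge0.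
exists N => psi pK; rewrite fctE /GRing.scale /= Normc.normcM -mulrA.
by apply: ler_wpM2l; [exact: normc_ge0|exact: H].
Qed.

Lemma is_distribution0 : is_distribution (0 : functional R).
Proof.
apply/is_distributionP; split; first by move=> a u v; rewrite [RHS]addr0 [RHS]scaler0.
move=> K cK; exists 0 => //; exists 0%N => psi _; rewrite mul0r.
by rewrite [X in normc X](_ : _ = 0) ?Normc.normc0.
Qed.

Lemma is_distribution_sum n (F : 'I_n -> functional R) :
  (forall i, is_distribution (F i)) -> is_distribution (\sum_i F i).
Proof.
move=> dF; elim/big_ind: _ => //; first exact: is_distribution0.
exact: is_distributionD.
Qed.

Lemma is_distribution_delta (x : R) : is_distribution (delta x).
Proof.
apply/is_distributionP; split=> [a u v|K cK]; first exact: tfunD.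
exists 1 => //; exists 0%N => psi _; rewrite mul1r big_ord_recl big_ord0 addr0.
by have := seminorm_ge 0 psi x; rewrite cderive0.
Qed.

Lemma is_distribution_reg f : locb f -> is_distribution (reg f).
Proof.
move=> lf; apply/is_distributionP; split; first exact: reg_linear.
move=> K /compact_bounded[M [_ HM]].
pose M' := `|M| + 1.
have KM x : K x -> `|x| <= M'.
  by apply: (HM M'); rewrite /M' (le_lt_trans (ler_norm _)) // ltrDl.
have [[mr br] [mj bj]] := lf.
have [C HC] := br M'; have [C' HC'] := bj M'.
pose I (x : R) : R := (`|x| <= M')%R%:R.
have lI : rlocb I.
  split; last by move=> M0; exists 1 => x _; rewrite /I; case: (_ <= M'); rewrite ?normr1 ?normr0.
  have -> : I = \1_[set` `[- M', M']].
    apply/funext => x; rewrite /I indicE ler_norml; congr (_%:R).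
    by rewrite mem_setE in_itv.
  by apply: measurable_indic; exact: measurable_itv.
have sI : bsupp I by exists M' => x; rewrite ltNge /I => /negbTE ->.
have iI := rlocb_integrable lI sI.
have I0 : 0 <= rint I by apply: Rintegral_ge0 => x _; rewrite /I; case: (_ <= M').
pose D := `|C| + `|C'|; have D0 : 0 <= D by rewrite addr_ge0.
(* [D] bounds [f] on the interval [|x| <= M'] containing [K], [rint I] is the length of that
   interval, and the factor 2 accounts for the real and the imaginary part. *)
exists (2 * (D * rint I)); first by rewrite !mulr_ge0.
exists 0%N => psi pK; rewrite big_ord_recl big_ord0 addr0.
have b x : `|cRe (f x * psi x)| <= D * seminorm 0 psi * I x /\
           `|cIm (f x * psi x)| <= D * seminorm 0 psi * I x.
  rewrite /I; have [xM|xM] := leP `|x| M'; last first.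
    have -> : psi x = 0.
      by apply: tsupp0 => /pK /KM; rewrite leNgt xM.
    by rewrite mulr0 normr0 mulr0.
  rewrite mulr1; have n : normc (f x * psi x) <= D * seminorm 0 psi.
    rewrite Normc.normcM ler_pM ?normc_ge0 //.
      apply: (le_trans (normc_le _)); apply: lerD.
        by apply: (le_trans (HC _ xM)); exact: ler_norm.
      by apply: (le_trans (HC' _ xM)); exact: ler_norm.
    by have := seminorm_ge 0 psi x; rewrite cderive0.
  by have [a1 a2] := ler_normc (f x * psi x); split; [exact: (le_trans a1 n)|exact: (le_trans a2 n)].
have [ir ij] := reg_integrable psi lf.
have iB := rintegrableZ (D * seminorm 0 psi) iI.
rewrite /reg cintegralE; apply: (le_trans (normc_le _)).
have -> : 2 * (D * rint I) * seminorm 0 psi =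
    D * seminorm 0 psi * rint I + D * seminorm 0 psi * rint I by ring.
rewrite -rintZ //; apply: lerD; apply: norm_rint_le => // x; by case: (b x).
Qed.

End complex_integral.

(** * Multiplication by smooth functions and differentiation *)

Section dmul_theory.
Context {R : realType}.
Implicit Types (F G : functional R) (psi : testfun R).

Lemma dderiveE F psi : dderive F psi = - F (tderive psi). Proof. by []. Qed.

Lemma ddernS n F : ddern n.+1 F = dderive (ddern n F). Proof. by []. Qed.

Lemma ddern_add m n F : ddern m (ddern n F) = ddern (m + n) F.
Proof. by rewrite /ddern iterD. Qed.

Lemma dderiveD F G : dderive (F + G) = dderive F + dderive G.
Proof. by apply/funext => psi; rewrite !(fctE, dderiveE) opprD. Qed.

Lemma dderiveZ c F : dderive (c *: F) = c *: dderive F.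
Proof. by apply/funext => psi; rewrite !(fctE, dderiveE) scalerN. Qed.

Lemma dderive0 : dderive (0 : functional R) = 0.
Proof. by apply/funext => psi; rewrite dderiveE oppr0. Qed.

Lemma dderive_sum n (F : 'I_n -> functional R) :
  dderive (\sum_i F i) = \sum_i dderive (F i).
Proof. by elim/big_rec2: _ => [|i x y _ <-]; rewrite ?dderive0 ?dderiveD. Qed.

Lemma dderiveN F : dderive (- F) = - dderive F.
Proof. by rewrite -scaleN1r dderiveZ scaleN1r. Qed.

Lemma ddern_linear n F : linear F -> linear (ddern n F).
Proof. by move=> lF; elim: n => // n IH; exact: dderive_linear. Qed.

Lemma is_distribution_ddern n F : is_distribution F -> is_distribution (ddern n F).
Proof. by move=> dF; elim: n => // n IH; exact: is_distribution_dderive. Qed.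

Lemma linear_opp F psi : linear F -> F (- psi) = - F psi.
Proof.
move=> lF; have f0 : F 0 = 0.
  by have := lF (-1) 0 0; rewrite scaler0 addr0 scaleN1r addNr.
by have := lF (-1) psi 0; rewrite addr0 f0 addr0 !scaleN1r.
Qed.

Lemma linear_add F psi1 psi2 : linear F -> F (psi1 + psi2) = F psi1 + F psi2.
Proof. by move=> lF; have := lF 1 psi1 psi2; rewrite !scale1r. Qed.

Lemma linear_scale F c psi : linear F -> F (c *: psi) = c * F psi.
Proof.
move=> lF; have f0 : F 0 = 0.
  by have := lF (-1) 0 0; rewrite scaler0 addr0 scaleN1r addNr.
by have := lF c psi 0; rewrite !addr0 f0 addr0.
Qed.

Section dmul.
Variables (g : R -> R[i]) (sg : smooth g).

Lemma dmulE F psi : dmul sg F psi = F (tmul sg psi). Proof. by []. Qed.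

Lemma dmulD F G : dmul sg (F + G) = dmul sg F + dmul sg G. Proof. by []. Qed.

Lemma dmulZ c F : dmul sg (c *: F) = c *: dmul sg F. Proof. by []. Qed.

Lemma dmul0 : dmul sg 0 = 0. Proof. by []. Qed.

Lemma dmul_sum n (F : 'I_n -> functional R) :
  dmul sg (\sum_i F i) = \sum_i dmul sg (F i).
Proof. by elim/big_rec2: _ => [|i x y _ <-]; rewrite ?dmul0 ?dmulD. Qed.

Lemma tmulE psi x : tmul sg psi x = g x * psi x. Proof. by []. Qed.

Lemma dmul_linear F : linear F -> linear (dmul sg F).
Proof.
move=> lF a u v; rewrite !dmulE -lF; congr F; apply: testfun_ext => x.
by rewrite tmulE !tfunD !tfunZ mulrDr mulrCA.
Qed.

Lemma dmul_reg f : dmul sg (reg f) = reg (fun x => f x * g x).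
Proof.
apply/funext => psi; rewrite dmulE /reg; congr cintegral.
by apply/funext => x; rewrite tmulE mulrA.
Qed.

Lemma dmul_delta x : dmul sg (delta x) = g x *: delta x.
Proof. by apply/funext => psi. Qed.

End dmul.

Lemma dmul_ext g g' (sg : smooth g) (sg' : smooth g') F :
  (forall x, g x = g' x) -> dmul sg F = dmul sg' F.
Proof.
move=> E; apply/funext => psi; rewrite !dmulE; congr F; apply: testfun_ext => x.
by rewrite !tmulE E.
Qed.

Lemma dmul_addl g g' h (sg : smooth g) (sg' : smooth g') (sh : smooth h) F :
  linear F -> (forall x, h x = g x + g' x) -> dmul sh F = dmul sg F + dmul sg' F.
Proof.
move=> lF E; apply/funext => psi; rewrite fctE !dmulE -linear_add //; congr F.
by apply: testfun_ext => x; rewrite tfunD !tmulE E mulrDl.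
Qed.

Lemma dmul_cst (c : R[i]) (sc : smooth (cst c)) F : linear F -> dmul sc F = c *: F.
Proof.
move=> lF; apply/funext => psi; rewrite dmulE.
transitivity (F (c *: psi)); last exact: linear_scale.
by congr F; apply: testfun_ext => x.
Qed.

Lemma dderive_dmul g (sg : smooth g) F : linear F ->
  dderive (dmul sg F) = dmul (smooth_cderiven 1 sg) F + dmul sg (dderive F).
Proof.
move=> lF; apply/funext => psi; rewrite fctE !dmulE !dderiveE dmulE.
have -> : tderive (tmul sg psi) = tmul (smooth_cderiven 1 sg) psi + tmul sg (tderive psi).
  apply: testfun_ext => x; rewrite tderiveE tfunD !tmulE.
  rewrite (@cderive1M _ g psi) //; first exact: smooth_cderivable.
  exact/smooth_cderivable/tfun_smooth.
by rewrite linear_add // opprD addrA subrr add0r.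
Qed.

Lemma deq_onS (U V : set R) F G : V `<=` U -> deq_on U F G -> deq_on V F G.
Proof. by move=> VU FG psi pV; apply: FG => x /pV; exact: VU. Qed.

Lemma deq_on_dderive (U : set R) F G : deq_on U F G ->
  deq_on U (dderive F) (dderive G).
Proof.
by move=> FG psi pU; rewrite !dderiveE FG // => x /tsupp_tderive; exact: pU.
Qed.

Lemma deq_on_ddern n (U : set R) F G : deq_on U F G ->
  deq_on U (ddern n F) (ddern n G).
Proof. by move=> FG; elim: n => // n IH; exact: deq_on_dderive. Qed.

Lemma deq_on_dmul (U : set R) g (sg : smooth g) F G : deq_on U F G ->
  deq_on U (dmul sg F) (dmul sg G).
Proof.
by move=> FG psi pU; rewrite !dmulE FG // => x /tsuppMr; exact: pU.
Qed.

Lemma deq_on_trans (U : set R) F G P : deq_on U F G -> deq_on U G P -> deq_on U F P.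
Proof. by move=> FG GP psi pU; rewrite FG ?GP. Qed.

Lemma deq_on_sym (U : set R) F G : deq_on U F G -> deq_on U G F.
Proof. by move=> FG psi pU; rewrite FG. Qed.

Lemma deq_onD (U : set R) F G F' G' : deq_on U F G -> deq_on U F' G' ->
  deq_on U (F + F') (G + G').
Proof. by move=> FG FG' psi pU; rewrite !fctE FG ?FG'. Qed.

Lemma deq_onN (U : set R) F G : deq_on U F G -> deq_on U (- F) (- G).
Proof. by move=> FG psi pU; rewrite !fctE FG. Qed.

Lemma deq_onZ c (U : set R) F G : deq_on U F G -> deq_on U (c *: F) (c *: G).
Proof. by move=> FG psi pU; rewrite !fctE FG. Qed.

Lemma deq_on_dmul_ext (U : set R) g g' (sg : smooth g) (sg' : smooth g') F :
  (forall x, U x -> g x = g' x) -> deq_on U (dmul sg F) (dmul sg' F).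
Proof.
move=> E psi pU; rewrite !dmulE; congr F; apply: testfun_ext => x; rewrite !tmulE.
have [Ux|nUx] := pselect (U x); first by rewrite E.
by rewrite (@tsupp0 _ psi x) ?mulr0 // => /pU.
Qed.

Lemma deq_on_reg_ext (U : set R) f g : (forall x, U x -> f x = g x) ->
  deq_on U (reg f) (reg g).
Proof.
move=> E psi pU; rewrite /reg; congr cintegral; apply/funext => x.
have [Ux|nUx] := pselect (U x); first by rewrite E.
by rewrite (@tsupp0 _ psi x) ?mulr0 // => /pU.
Qed.

End dmul_theory.

(** * Functions with one breakpoint and the jump formula *)

Section piecewise.
Context {R : realType}.
Variable xi : R.
Implicit Types (f g : R -> R[i]) (psi : testfun R).

Definition pc fm fp : R -> R[i] :=
  fun x => fm x * heaviside (xi - x) + fp x * heaviside (x - xi).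

Lemma pc_lt fm fp x : x < xi -> pc fm fp x = fm x.
Proof.
move=> xx; rewrite /pc /heaviside subr_gt0 xx subr_gt0 ltNge ltW //=.
by rewrite mulr1 mulr0 addr0.
Qed.

Lemma pc_gt fm fp x : xi < x -> pc fm fp x = fp x.
Proof.
move=> xx; rewrite /pc /heaviside !subr_gt0 xx ltNge ltW //=.
by rewrite mulr1 mulr0 add0r.
Qed.

Lemma pc_xi fm fp : pc fm fp xi = 0.
Proof. by rewrite /pc /heaviside subrr ltxx !mulr0 addr0. Qed.

Lemma cRe_bool (b : bool) : cRe (b%:R : R[i]) = b%:R. Proof. by case: b. Qed.
Lemma cIm_bool (b : bool) : cIm (b%:R : R[i]) = 0. Proof. by case: b. Qed.

Lemma rlocb_itv (i : interval R) : rlocb (fun x : R => (x \in i)%:R : R).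
Proof.
split; last by move=> M; exists 1 => x _; case: (_ \in _); rewrite ?normr1 ?normr0.
have -> : (fun x : R => (x \in i)%:R : R) = \1_[set` i].
  by apply/funext => x; rewrite indicE mem_setE.
by apply: measurable_indic; exact: measurable_itv.
Qed.

Lemma locb_itv (i : interval R) : locb (fun x : R => (x \in i)%:R).
Proof.
split.
- have -> : cRe \o (fun x : R => (x \in i)%:R) = (fun x => (x \in i)%:R : R).
    by apply/funext => x /=; rewrite cRe_bool.
  exact: rlocb_itv.
- have -> : cIm \o (fun x : R => (x \in i)%:R) = (cst 0 : R -> R).
    by apply/funext => x /=; rewrite cIm_bool.
  by apply: rlocb_continuous => x; exact: cvg_cst.
Qed.

Lemma heaviside_lt x : heaviside (xi - x) = (x \in `]-oo, xi[)%:R.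
Proof. by rewrite /heaviside subr_gt0 in_itv. Qed.

Lemma heaviside_gt x : heaviside (x - xi) = (x \in `]xi, +oo[)%:R.
Proof. by rewrite /heaviside subr_gt0 in_itv /= andbT. Qed.

Lemma locb_heaviside_lt : locb (fun x => heaviside (xi - x)).
Proof. by under eq_fun do rewrite heaviside_lt; exact: locb_itv. Qed.

Lemma locb_heaviside_gt : locb (fun x => heaviside (x - xi)).
Proof. by under eq_fun do rewrite heaviside_gt; exact: locb_itv. Qed.

Lemma locb_pc fm fp : locb fm -> locb fp -> locb (pc fm fp).
Proof.
move=> lm lp; apply: locbD.
- exact: locbM lm locb_heaviside_lt.
- exact: locbM lp locb_heaviside_gt.
Qed.

Lemma cintegral_derive_lt h : smooth h -> cbsupp h ->
  cintegral (fun x => cderive 1 h x * heaviside (xi - x)) = h xi.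
Proof.
move=> [rh jh] /cbsupp_bsupp[sr sj]; rewrite cintegralE.
have E x : heaviside (xi - x) = ((x < xi)%R%:R : R)%:C.
  by rewrite /heaviside subr_gt0; case: (x < xi).
have cont (k : R -> R) : rsmooth k -> continuous (derive1 k).
  by move=> sk x; exact/differentiable_continuous/derivable1_diffP/(sk 1%N).
have -> : cRe \o (fun x => cderive 1 h x * heaviside (xi - x)) =
    (fun x => derive1 (cRe \o h) x * (x < xi)%R%:R).
  by apply/funext => x; rewrite /= E cReM /= mulr0 subr0.
have -> : cIm \o (fun x => cderive 1 h x * heaviside (xi - x)) =
    (fun x => derive1 (cIm \o h) x * (x < xi)%R%:R).
  by apply/funext => x; rewrite /= E cImM /= mulr0 add0r.
rewrite (rint_derive_lt _ (rh 0%N) (cont _ rh) sr).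
rewrite (rint_derive_lt _ (jh 0%N) (cont _ jh) sj).
by apply: complex_eq.
Qed.

Lemma cintegral_derive_gt h : smooth h -> cbsupp h ->
  cintegral (fun x => cderive 1 h x * heaviside (x - xi)) = - h xi.
Proof.
move=> [rh jh] /cbsupp_bsupp[sr sj]; rewrite cintegralE.
have E x : heaviside (x - xi) = ((xi < x)%R%:R : R)%:C.
  by rewrite /heaviside subr_gt0; case: (xi < x).
have cont (k : R -> R) : rsmooth k -> continuous (derive1 k).
  by move=> sk x; exact/differentiable_continuous/derivable1_diffP/(sk 1%N).
have -> : cRe \o (fun x => cderive 1 h x * heaviside (x - xi)) =
    (fun x => derive1 (cRe \o h) x * (xi < x)%R%:R).
  by apply/funext => x; rewrite /= E cReM /= mulr0 subr0.
have -> : cIm \o (fun x => cderive 1 h x * heaviside (x - xi)) =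
    (fun x => derive1 (cIm \o h) x * (xi < x)%R%:R).
  by apply/funext => x; rewrite /= E cImM /= mulr0 add0r.
rewrite (rint_derive_gt _ (rh 0%N) (cont _ rh) sr).
rewrite (rint_derive_gt _ (jh 0%N) (cont _ jh) sj).
by apply: complex_eq; rewrite /= ?cReN ?cImN.
Qed.

(** Integration by parts on each half-line: the integrals of [(fm psi)'] and [(fp psi)'] over the
    two sides leave [fm xi * psi xi] and [- fp xi * psi xi]. *)
Lemma dderive_reg_pc fm fp : smooth fm -> smooth fp ->
  dderive (reg (pc fm fp)) =
  reg (pc (cderive 1 fm) (cderive 1 fp)) + (fp xi - fm xi) *: delta xi.
Proof.
move=> sm sp; apply/funext => psi; rewrite dderiveE !fctE.
have spsi := tfun_smooth psi.
have lm' : locb (cderive 1 fm) by exact/locb_smooth/smooth_cderiven.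
have lp' : locb (cderive 1 fp) by exact/locb_smooth/smooth_cderiven.
have lpc := locb_pc (locb_smooth sm) (locb_smooth sp).
have i1 := reg_integrable (tderive psi) lpc.
have i2 := reg_integrable psi (locb_pc lm' lp').
have sM f : smooth f -> smooth (fun x => f x * psi x) by move=> sf; exact: smoothM.
have bM f : cbsupp (cderive 1 (fun x => f x * psi x)).
  have [M HM] := cbsuppM f psi; exists M => x Mx.
  have oD : open [set x : R | M < `|x|].
    have -> : [set x : R | M < `|x|] = (fun x : R => `|x|) @^-1` [set y : R | M < y] by [].
    by apply: open_comp; [move=> y _; exact: norm_continuous|exact: open_gt].
  by rewrite (cderive_eq_on oD (g := cst 0)) // cderive_cst.
have iH f (k : R -> R[i]) : smooth f -> locb k ->
    cintegrable (fun x => cderive 1 (fun x => f x * psi x) x * k x).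
  move=> sf lk; apply: locb_integrable.
    by apply: locbM lk; exact/locb_smooth/smooth_cderiven/sM.
  by have [M HM] := bM f; exists M => x /HM ->; rewrite mul0r.
have S : reg (pc fm fp) (tderive psi) + reg (pc (cderive 1 fm) (cderive 1 fp)) psi =
    fm xi * psi xi - fp xi * psi xi.
  rewrite /reg -cintegralD //.
  rewrite -(cintegral_derive_lt (sM _ sm) (cbsuppM _ _)).
  rewrite -(cintegral_derive_gt (sM _ sp) (cbsuppM _ _)) -cintegralD; first last.
  - exact: iH locb_heaviside_gt.
  - exact: iH locb_heaviside_lt.
  congr cintegral; apply/funext => x.
  rewrite (@cderive1M _ fm psi) ?(@cderive1M _ fp psi); try exact: smooth_cderivable.
  by rewrite /pc tderiveE; ring.
apply/eqP; rewrite eq_sym -subr_eq0 opprK addrAC [X in X + _]addrC S /delta.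
by apply/eqP; rewrite /GRing.scale /=; ring.
Qed.

Lemma pc_same f x : x != xi -> pc f f x = f x.
Proof. by rewrite neq_lt => /orP[h|h]; [exact: pc_lt|exact: pc_gt]. Qed.

End piecewise.

Lemma reg_pc_same {R : realType} (xi : R) f : locb f -> reg (pc xi f f) = reg f.
Proof.
move=> lf; apply: (@reg_eq_off _ [:: xi]) => //; first exact: locb_pc.
by move=> x; rewrite inE => /pc_same ->.
Qed.

Lemma dderive_reg {R : realType} (f : R -> R[i]) : smooth f ->
  dderive (reg f) = reg (cderive 1 f).
Proof.
move=> sf; rewrite -(reg_pc_same 0 (locb_smooth sf)) dderive_reg_pc // subrr scale0r addr0.
by rewrite reg_pc_same //; exact/locb_smooth/smooth_cderiven.
Qed.

(** * Distributions supported at a point *)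

Section point_support.
Context {R : realType}.
Implicit Types (F G : functional R) (v : nat -> R[i]) (y : R) (m n : nat).

(* [jetmul j v y] is the product of [delta_y^(j)] by a function whose successive
   derivatives at [y] are [v 0, v 1, ...]. *)
Fixpoint jetmul (j : nat) v y : functional R :=
  if j is j'.+1 then dderive (jetmul j' v y) - jetmul j' (fun k => v k.+1) y
  else v 0%N *: delta y.

(** The recursion of [jetmul] is the Leibniz rule [g DF = D(g F) - g' F]. As only a jet enters it,
    [jetmul] also makes sense for the one-sided limits of the derivatives of a piecewise smooth
    function. *)
Lemma dmul_ddelta (g : R -> R[i]) (sg : smooth g) j y :
  dmul sg (ddern j (delta y)) = jetmul j (fun k => cderive k g y) y.
Proof.
elim: j g sg => [|j IH] g sg; first by rewrite dmul_delta /= cderive0.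
have lin : linear (ddern j (delta y)).
  by apply: ddern_linear; case: (is_distribution_delta y).
have := dderive_dmul sg lin; rewrite -ddernS !IH /= => ->.
rewrite (_ : (fun k => cderive k (cderive 1 g) y) = fun k => cderive k.+1 g y).
  by rewrite addrAC subrr add0r.
by apply/funext => k; rewrite [in RHS]cderiveSr.
Qed.

Lemma is_distribution_jetmul j v y : is_distribution (jetmul j v y).
Proof.
elim: j v => [|j IH] v; first exact/is_distributionZ/is_distribution_delta.
apply: is_distributionD; first exact/is_distribution_dderive/IH.
by rewrite -scaleN1r; exact/is_distributionZ/IH.
Qed.

Lemma jetmul_notin j v y (psi : testfun R) : ~ tsupp psi y -> jetmul j v y psi = 0.
Proof.
elim: j v psi => [|j IH] v psi ny.
  by rewrite /= fctE /delta (tsupp0 ny) scaler0.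
rewrite /= fctE dderiveE IH; last by move=> /tsupp_tderive.
rewrite oppr0 add0r; apply/eqP; rewrite oppr_eq0; apply/eqP; exact: IH.
Qed.

Lemma ddelta_notin j y (psi : testfun R) : ~ tsupp psi y -> ddern j (delta y) psi = 0.
Proof.
elim: j psi => [|j IH] psi ny; first exact: tsupp0.
by rewrite ddernS dderiveE IH ?oppr0 // => /tsupp_tderive.
Qed.

(** The coefficients form a sequence over [nat], so that the bound [m] can be raised or lowered
    without casts between ordinals. *)
Definition delta_span m y F : Prop :=
  exists c : nat -> R[i], F = \sum_(k < m) c k *: ddern k (delta y).

Lemma delta_span0 m y : delta_span m y 0.
Proof. by exists (fun=> 0); rewrite big1 // => k _; rewrite scale0r. Qed.

Lemma delta_spanD m y F G : delta_span m y F -> delta_span m y G ->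
  delta_span m y (F + G).
Proof.
move=> [c ->] [d ->]; exists (fun k => c k + d k); rewrite -big_split /=.
by apply: eq_bigr => k _; rewrite scalerDl.
Qed.

Lemma delta_spanZ m y a F : delta_span m y F -> delta_span m y (a *: F).
Proof.
move=> [c ->]; exists (fun k => a * c k); rewrite scaler_sumr.
by apply: eq_bigr => k _; rewrite scalerA.
Qed.

Lemma delta_spanN m y F : delta_span m y F -> delta_span m y (- F).
Proof. by rewrite -scaleN1r; exact: delta_spanZ. Qed.

Lemma delta_span_ddern m n y : (n < m)%N -> delta_span m y (ddern n (delta y)).
Proof.
move=> nm; exists (fun k => (k == n)%:R); rewrite (bigD1 (Ordinal nm)) //= eqxx scale1r.
rewrite big1 ?addr0 // => k kn; have /negbTE -> : (k : nat) != n by [].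
by rewrite scale0r.
Qed.

Lemma delta_span_sum m y p (c : 'I_p -> R[i]) (F : 'I_p -> functional R) :
  (forall i, delta_span m y (F i)) -> delta_span m y (\sum_i c i *: F i).
Proof.
move=> sF; elim/big_ind: _ => //; first exact: delta_span0.
  exact: delta_spanD.
by move=> i _; exact: delta_spanZ.
Qed.

Lemma delta_spanW m n y F : (m <= n)%N -> delta_span m y F -> delta_span n y F.
Proof.
move=> mn [c ->]; apply: delta_span_sum => k; apply: delta_span_ddern.
exact: leq_trans (ltn_ord k) mn.
Qed.

Lemma delta_span_dderive m y F : delta_span m y F -> delta_span m.+1 y (dderive F).
Proof.
move=> [c ->]; rewrite dderive_sum.
under eq_bigr do rewrite dderiveZ -ddernS.
by apply: delta_span_sum => k; apply: delta_span_ddern; rewrite ltnS.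
Qed.

Lemma jetmul_lead j v y :
  exists2 S, delta_span j y S & jetmul j v y = v 0%N *: ddern j (delta y) + S.
Proof.
elim: j v => [|j IH] v; first by exists 0; [exact: delta_span0|rewrite addr0].
have [S sS E] := IH v; have [S' sS' E'] := IH (fun k => v k.+1).
exists (dderive S - (v 1%N *: ddern j (delta y) + S')).
  apply: delta_spanD; first exact: delta_span_dderive.
  apply/delta_spanN/delta_spanD; last exact: delta_spanW sS'.
  exact/delta_spanZ/delta_span_ddern.
by rewrite /= E E' dderiveD dderiveZ addrA.
Qed.

Lemma delta_span_dmul m y g (sg : smooth g) F : delta_span m y F ->
  delta_span m y (dmul sg F).
Proof.
move=> [c ->]; rewrite dmul_sum.
under eq_bigr do rewrite dmulZ dmul_ddelta.
apply: delta_span_sum => k; have [S sS ->] := jetmul_lead k (fun k => cderive k g y) y.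
apply: delta_spanD; first exact/delta_spanZ/delta_span_ddern.
by apply: delta_spanW sS; exact: ltnW.
Qed.

Lemma is_distribution_delta_span m y F : delta_span m y F -> is_distribution F.
Proof.
move=> [c ->]; apply: is_distribution_sum => k.
exact/is_distributionZ/is_distribution_ddern/is_distribution_delta.
Qed.

Lemma delta_span_notin m y F (psi : testfun R) : delta_span m y F ->
  ~ tsupp psi y -> F psi = 0.
Proof.
move=> [c ->] ny; rewrite fct_sumE big1 // => k _.
by rewrite fctE ddelta_notin ?scaler0.
Qed.

Lemma delta_span_recr m y F : delta_span m.+1 y F ->
  exists c, exists2 S, delta_span m y S & F = c *: ddern m (delta y) + S.
Proof.
move=> [c ->]; exists (c m); exists (\sum_(k < m) c k *: ddern k (delta y)).
  by exists c.
by rewrite big_ord_recr addrC.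
Qed.

Lemma smooth_X y : smooth (fun x : R => (x - y)%:C).
Proof.
apply: (@smooth_real _ (fun x => x - y)).
have -> : (fun x : R => x - y) = id \+ cst (- y) by [].
by apply: (@rsmoothD R id (cst (- y))); [exact: rsmooth_id|exact: rsmooth_cst].
Qed.

Lemma cderive_X (y x : R) : cderive 1 (fun x : R => (x - y)%:C) x = 1.
Proof.
rewrite /cderive /=.
have -> : cRe \o (fun x : R => (x - y)%:C) = (fun x => 1 * x + (- y)).
  by apply/funext => z /=; rewrite mul1r.
have -> : cIm \o (fun x : R => (x - y)%:C) = cst 0 by [].
by rewrite derive1_cst derive1E; have [_ ->] := is_derive_affine 1 (- y) x.
Qed.

(** Multiplication by [x - y] lowers the order of a Dirac by one. This isolates leading coefficients
    and, dually, builds test functions with prescribed moments. At [j = 0] the factor [- j] makes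
    the truncated [j.-1] harmless. *)
Lemma dmul_X_ddelta j y :
  dmul (smooth_X y) (ddern j (delta y)) = (- j%:R) *: ddern j.-1 (delta y).
Proof.
elim: j => [|j IH]; first by rewrite dmul_delta subrr oppr0 !scale0r.
have lin : linear (ddern j (delta y)).
  by apply: ddern_linear; case: (is_distribution_delta y).
have := dderive_dmul (smooth_X y) lin; rewrite -ddernS IH dderiveZ.
rewrite (dmul_ext _ (smooth_cst 1)); last by move=> x; exact: cderive_X.
rewrite dmul_cst // => /eqP; rewrite addrC -subr_eq => /eqP <-.
rewrite -scaleNr; case: j {IH lin} => [|j]; first by rewrite oppr0 scale0r add0r.
by rewrite -ddernS -scalerDl -opprD natr1.
Qed.

Lemma exists_plateau (y r : R) : 0 < r -> exists psi : testfun R,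
  [/\ forall x, `|x - y| <= r -> psi x = 1,
      tsupp psi `<=` [set` `[y - 2 * r, y + 2 * r]] &
      forall x, exists2 t : R, 0 <= t <= 1 & psi x = t%:C].
Proof.
move=> r0; have ab : y - 2 * r < y - r by lra.
have cd : y + r < y + 2 * r by lra.
have [S sS [S01 S0 S1]] := exists_bump ab cd.
have [|psi E Hs] := exists_testfun (smooth_real sS) (a := y - 2 * r) (b := y + 2 * r).
  by move=> x [/ltW h|/ltW h]; rewrite S0 //; [left|right].
exists psi; split=> // x.
  by rewrite ler_norml => /andP[h1 h2]; rewrite E S1 //; apply/andP; split; lra.
by exists (S x); [exact: S01|exact: E].
Qed.

(** Multiplying by [x - y] lowers the leading Dirac by one order with a nonzero factor and keeps the
    rest below it. At order 0 a test function equal to 1 at [y] reads off the coefficient. *)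
Lemma delta_span_lead_eq0 m y a S : delta_span m y S ->
  a *: ddern m (delta y) + S = 0 -> a = 0.
Proof.
elim: m a S => [|m IH] a S sS E.
  have [psi [p1 _ _]] := exists_plateau y (@ltr01 R).
  case: sS E => c ->; rewrite big_ord0 addr0 => /(congr1 (fun F => F psi)).
  by rewrite fctE /= /delta p1 ?subrr ?normr0 // /GRing.scale /= mulr1.
have := congr1 (dmul (smooth_X y)) E.
rewrite dmulD dmulZ dmul_X_ddelta dmul0 scalerA => /IH.
case: (delta_span_recr sS) => b [S' sS' ->].
have sX : delta_span m y (dmul (smooth_X y) (b *: ddern m (delta y) + S')).
  rewrite dmulD dmulZ dmul_X_ddelta; apply: delta_spanD.
    case: m {IH sS E sS' } => [|m]; first by rewrite oppr0 scale0r scaler0; exact: delta_span0.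
    exact/delta_spanZ/delta_spanZ/delta_span_ddern.
  exact: delta_span_dmul.
move=> /(_ sX) /eqP; rewrite mulf_eq0 oppr_eq0 pnatr_eq0 orbF => /eqP ->.
by [].
Qed.

Lemma ddelta_free m y (c : 'I_m -> R[i]) :
  \sum_k c k *: ddern k (delta y) = 0 -> forall k, c k = 0.
Proof.
elim: m c => [|m IH] c; first by move=> _ [].
rewrite big_ord_recr /= addrC => E.
have c0 : c ord_max = 0.
  apply: delta_span_lead_eq0 E; apply: delta_span_sum => k.
  exact: delta_span_ddern.
move: E; rewrite c0 scale0r add0r => /IH H k.
have [k0|k1] := unliftP ord_max k; last by rewrite k1.
by move=> ->; have := H k0; congr (c _ = 0); apply: val_inj; rewrite /= /bump leqNgt ltn_ord.
Qed.

End point_support.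

(** * Locality and uniqueness of products *)

Section locality.
Context {R : realType}.
Implicit Types (F G P L : functional R) (psi : testfun R) (U V : set R).

Lemma linear_at0 L : linear L -> L 0 = 0.
Proof. by move=> lL; have := linear_scale 0 0 lL; rewrite scale0r mul0r. Qed.

(* Sweep a cut-off from left to right: the set of [t] such that [L] kills [chi * psi]
   for every [chi] vanishing on [[t, +oo[] cannot have a supremum. *)
Lemma locally_zero U L : linear L ->
  (forall x, U x -> exists2 V, open_nbhs x V & deq_on V L 0) -> deq_on U L 0.
Proof.
move=> lL HU psi pU.
pose S : set R := [set t | forall chi (sc : smooth chi),
  (forall x, t <= x -> chi x = 0) -> L (tmul sc psi) = 0].
have [M M0 HM] := tsupp_bounded psi.
have zero chi (sc : smooth chi) : (forall x, chi x * psi x = 0) -> L (tmul sc psi) = 0.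
  move=> h; have -> : tmul sc psi = 0 by apply: testfun_ext => x; rewrite tmulE h.
  exact: linear_at0.
have S0 : S (- M - 1).
  move=> chi sc h; apply: zero => x.
  have [h1|h1] := leP (- M - 1) x; first by rewrite h ?mul0r.
  by rewrite HM ?mulr0 // lter_normr; apply/orP; right; lra.
(* Around every [t] there is a window in which [L] kills all cut-offs of [psi]: for [t] in [U] by
   hypothesis, for [t] outside [U] because [psi] vanishes near [t]. *)
have local t : exists2 r : R, 0 < r & forall chi (sc : smooth chi),
    (forall x, x <= t - r \/ t + r <= x -> chi x = 0) -> L (tmul sc psi) = 0.
  have [Ut|nUt] := pselect (U t).
    have [V oV HV] := HU t Ut.
    have /nbhs_ballP[e /= e0 He] : nbhs t V by exact: open_nbhs_nbhs.
    exists (e / 2); first by rewrite divr_gt0.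
    move=> chi sc h; apply: HV => x xs; apply: He.
    have : [set` `[t - e / 2, t + e / 2]] x.
      apply: (tsupp_itv (f := tmul sc psi)) xs => z zz.
      by rewrite tmulE h ?mul0r //; case: zz => /ltW; [left|right].
    rewrite /= in_itv /= => /andP[h1 h2].
    by rewrite /ball /= ltr_norml; apply/andP; split; lra.
  have : open_nbhs t (~` tsupp psi).
    by split; [exact/closed_openC/closed_tsupp|move=> /pU].
  move=> /open_nbhs_nbhs /nbhs_ballP[e /= e0 He].
  exists (e / 2); first by rewrite divr_gt0.
  move=> chi sc h; apply: zero => x.
  have [h1|h1] := leP x (t - e / 2); first by rewrite h ?mul0r //; left.
  have [h2|h2] := leP (t + e / 2) x; first by rewrite h ?mul0r //; right.
  rewrite (@tsupp0 _ psi x) ?mulr0 //; apply: He.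
  by rewrite /ball /= ltr_norml; apply/andP; split; lra.
(* [chi] is split as [chi (1 - T) + chi T] with [T] passing from 0 at [t - r] to 1 at [s]: the first
   piece vanishes beyond [s] and falls under [S s], the second lives in the window. Applied at the
   supremum of [S], this goes beyond it. *)
have step t r s : 0 < r -> (forall chi (sc : smooth chi),
    (forall x, x <= t - r \/ t + r <= x -> chi x = 0) -> L (tmul sc psi) = 0) ->
    t - r < s -> S s -> S (t + r).
  move=> r0 loc ts Ss chi sc h.
  have [T sT [_ T0 T1]] := exists_cut ts.
  have sT' := smooth_real sT.
  have s1 : smooth (fun x => chi x * (1 - (T x)%:C)).
    exact: (smoothM sc (smoothBp (smooth_cst 1) sT')).
  have s2 : smooth (fun x => chi x * (T x)%:C) by exact: (smoothM sc sT').
  have -> : tmul sc psi = tmul s1 psi + tmul s2 psi.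
    by apply: testfun_ext => x; rewrite tfunD !tmulE; ring.
  rewrite linear_add // Ss ?add0r; last first.
    by move=> x sx; rewrite T1 // subrr mulr0.
  apply: loc => x [h1|h1]; first by rewrite T0 ?mulr0.
  by rewrite h // mul0r.
have down t t' : t' <= t -> S t -> S t'.
  move=> tt St chi sc h; apply: St => x tx; apply: h; exact: le_trans tx.
have all t : S t.
  apply: contrapT => nSt.
  have hs : has_sup S.
    split; first by exists (- M - 1).
    exists t => s Ss; rewrite leNgt; apply/negP => /ltW ts.
    exact/nSt/(down _ _ ts).
  have [r r0 loc] := local (sup S).
  have [s Ss ss] := sup_adherent r0 hs.
  have := step _ _ _ r0 loc ss Ss => /(sup_upper_bound hs).
  by rewrite gerDl leNgt r0.
have ab : - M - 1 < - M by lra.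
have cd : M < M + 1 by lra.
have [T sT [_ T0 T1]] := exists_bump ab cd.
have -> : psi = tmul (smooth_real sT) psi.
  apply: testfun_ext => x; rewrite tmulE.
  have [xM|xM] := leP `|x| M; first by rewrite T1 ?mul1r // -ler_norml.
  by rewrite HM ?mulr0.
by apply: (all (M + 1)) => x h; rewrite T0 //; right.
Qed.

Lemma deq_on_local U F G : linear F -> linear G ->
  (forall x, U x -> exists2 V, open_nbhs x V & deq_on V F G) -> deq_on U F G.
Proof.
move=> lF lG H psi pU; apply/eqP; rewrite -subr_eq0; apply/eqP.
apply: (@locally_zero U (F - G)) pU.
  by rewrite -scaleN1r; exact/linear_addf/linear_scalef.
move=> x /H[V oV FG]; exists V => // th thV.
by rewrite !fctE FG // subrr.
Qed.

Lemma deq_onT F G : deq_on setT F G -> F = G.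
Proof. by move=> FG; apply/funext => psi; exact: FG. Qed.

(** Continuity is asked at [x] alone, because the lemma has to apply to a piecewise smooth function,
    continuous only off a finite set. If the values at [x] differed, a constant multiple of the
    difference would have real part bounded below near [x], and a plateau function would have a
    nonzero integral against it. *)
Lemma fundamental_lemma U (f g : R -> R[i]) x : locb f -> locb g -> open U -> U x ->
  {for x, continuous (cRe \o f)} /\ {for x, continuous (cIm \o f)} ->
  {for x, continuous (cRe \o g)} /\ {for x, continuous (cIm \o g)} ->
  deq_on U (reg f) (reg g) -> f x = g x.
Proof.
move=> lf lg oU Ux [cf1 cf2] [cg1 cg2] fg; apply: contrapT => /eqP fgx.
(* The conjugate of [h x] makes [k x] equal to [|h x|^2], so only one real part has to be
   estimated. *)
pose h y := f y - g y; pose c : R[i] := (cRe (h x) -i* cIm (h x))%C.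
pose k y := c * h y.
have lh : locb h.
  have -> : h = fun y => f y + cst (-1) y * g y.
    by apply/funext => y; rewrite /h mulN1r.
  by apply: locbD => //; apply: locbM => //; exact/locb_smooth/smooth_cst.
have lk : locb k by apply: locbM lh; exact/locb_smooth/smooth_cst.
have regk psi : tsupp psi `<=` U -> reg k psi = 0.
  move=> pU; rewrite /k regZ // fctE.
  have -> : h = fun y => f y + (-1) * g y by apply/funext => y; rewrite /h mulN1r.
  rewrite regD //; last by apply: (@locbM _ (cst (-1))) lg; exact/locb_smooth/smooth_cst.
  by rewrite regZ // !fctE fg // /GRing.scale /= mulN1r subrr mulr0.
have kE y : cRe (k y) = cRe (h x) * (cRe (f y) - cRe (g y)) +
                        cIm (h x) * (cIm (f y) - cIm (g y)).
  by rewrite /k cReM /= /h !cE; ring.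
have a0 : 0 < cRe (k x).
  rewrite kE -cReN -cReD -cImN -cImD -/(h x) -!expr2 lt0r addr_ge0 ?sqr_ge0 // andbT.
  rewrite paddr_eq0 ?sqr_ge0 // !sqrf_eq0; apply: contra fgx => /andP[/eqP h1 /eqP h2].
  by rewrite -subr_eq0; apply/eqP/complex_eq.
have ck : {for x, continuous (cRe \o k)}.
  have -> : cRe \o k = fun y => cRe (h x) * ((cRe \o f) y - (cRe \o g) y) +
                        cIm (h x) * ((cIm \o f) y - (cIm \o g) y).
    by apply/funext => y; exact: kE.
  apply: cvgD; apply: cvgM; try exact: cvg_cst.
  - exact: cvgB.
  - exact: cvgB.
pose a := cRe (k x) / 2; have ax : a < cRe (k x) by rewrite /a; lra.
have ap : 0 < a by rewrite divr_gt0.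
have /nbhs_ballP[e /= e0 He] : nbhs x (U `&` [set y | a < cRe (k y)]).
  apply: filterI; first exact: open_nbhs_nbhs.
  exact: (ck [set z | a < z] (open_nbhs_nbhs (conj (@open_gt R a) ax))).
pose r := e / 4; have r0 : 0 < r by rewrite divr_gt0.
have [psi [p1 p2 p3]] := exists_plateau x r0.
have sub y : y \in `[x - 2 * r, x + 2 * r] -> ball x e y.
  rewrite in_itv /= /r => /andP[h1 h2].
  by rewrite /ball /= ltr_norml; apply/andP; split; lra.
have : reg k psi = 0.
  by apply: regk => y /p2 /sub /He[].
move=> /(congr1 cRe); rewrite /reg cintegralE /=.
apply/eqP; rewrite gt_eqF //.
pose I (y : R) : R := (y \in `[x - r, x + r])%:R.
have iI : rintegrable I.
  apply: rlocb_integrable; first exact: rlocb_itv.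
  exists (`|x| + r) => y; rewrite /I in_itv /= -ler_distl ltNge.
  move=> /negP h1; case: leP => // h2; case: h1.
  by rewrite -[y](subrK x) (le_trans (ler_normD _ _)) // addrC lerD2l.
have [ir _] := reg_integrable psi lk.
have iB := rintegrableZ a iI.
apply: (@lt_le_trans _ _ (rint (fun y => a * I y))); last first.
  apply: ler_rint => // y /=; rewrite cReM.
  have [t /andP[t0 t1] tE] := p3 y; rewrite tE /= mulr0 subr0.
  have [yb|yb] := boolP (y \in `[x - 2 * r, x + 2 * r]).
    have [_ /= ay] := He _ (sub _ yb).
    rewrite /I; case: (boolP (y \in _)) => yI.
      move: tE; rewrite p1 => [[<-]|]; first by rewrite ler_pM2r // ltW.
      by move: yI; rewrite in_itv /= -ler_distl.
    by rewrite mulr0 mulr_ge0 // ltW // (lt_trans ap).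
  have -> : t = 0.
    have : psi y = 0 by apply: tsupp0 => /p2; exact/negP.
    by rewrite tE => -[].
  rewrite /I; case: (boolP (y \in _)) => yI; last by rewrite !mulr0.
  move: yb; rewrite in_itv /= => /negP; case; move: yI; rewrite in_itv /= => /andP[h1 h2].
  by apply/andP; split; lra.
rewrite rintZ // pmulr_rgt0 //.
have -> : rint I = 2 * r; last by lra.
have xrr : x - r < x + r by lra.
have -> : rint I = Rintegral lebesgue_measure [set` `[x - r, x + r]] (cst 1).
  rewrite [RHS]Rintegral_mkcond /rint; congr Rintegral; apply/funext => y.
  by rewrite patchE mem_setE /I; case: (y \in _).
rewrite Rintegral_cst; last exact: measurable_itv.
have E := lebesgue_measure_itv `[x - r, x + r]; rewrite /= lte_fin xrr in E.
rewrite mul1r; transitivity (fine ((x + r)%:E + (- (x - r))%:E)%E).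
  by congr fine; exact: E.
by rewrite -EFinD /=; lra.
Qed.

Lemma reg_smooth_inj U (f g : R -> R[i]) : smooth f -> smooth g -> open U ->
  deq_on U (reg f) (reg g) -> forall x, U x -> f x = g x.
Proof.
move=> sf sg oU fg x Ux.
apply: (fundamental_lemma (locb_smooth sf) (locb_smooth sg) oU Ux) fg.
- exact/cderivable_continuous/smooth_cderivable.
- exact/cderivable_continuous/smooth_cderivable.
Qed.

(** Frees the product from the local choices in its definition. Where the same factor was chosen,
    two smooth representatives of [F] agree as functions; where the other was chosen, both factors
    are smooth and multiplication commutes. *)
Lemma hormander_left U F G P (f : R -> R[i]) (sf : smooth f) : linear P -> linear G ->
  is_hormander_product F G P -> open U -> deq_on U F (reg f) ->
  deq_on U P (dmul sf G).
Proof.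
move=> lP lG FGP oU Ff; apply: deq_on_local => //; first exact: dmul_linear.
move=> x Ux; have [V [oV Vx] H] := FGP x.
exists (U `&` V); first by split=> //; exact: openI.
have iU : U `&` V `<=` U by exact: subIsetl.
have iV : U `&` V `<=` V by exact: subIsetr.
case: H => [[f1 [sf1 [F1 P1]]]|[g [sg [Gg Pg]]]].
  have E : forall y, (U `&` V) y -> f1 y = f y.
    apply: reg_smooth_inj => //; first exact: openI.
    apply: deq_on_trans (deq_onS iU Ff); exact/deq_on_sym/(deq_onS iV).
  exact: deq_on_trans (deq_onS iV P1) (deq_on_dmul_ext _ _ _ E).
apply: deq_on_trans (deq_onS iV Pg) _.
apply: deq_on_trans (deq_on_dmul sg (deq_onS iU Ff)) _.
apply: deq_on_trans (deq_on_sym (deq_on_dmul sf (deq_onS iV Gg))).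
by rewrite !dmul_reg; apply: deq_on_reg_ext => y _; rewrite mulrC.
Qed.

Lemma hormander_right U F G P (g : R -> R[i]) (sg : smooth g) : linear P -> linear F ->
  is_hormander_product F G P -> open U -> deq_on U G (reg g) ->
  deq_on U P (dmul sg F).
Proof.
move=> lP lF FGP; apply: hormander_left => //.
by move=> x; have [V oV [H|H]] := FGP x; exists V => //; [right|left].
Qed.

Lemma hormander_unique F G P P' : linear F -> linear G -> linear P -> linear P' ->
  is_hormander_product F G P -> is_hormander_product F G P' -> P = P'.
Proof.
move=> lF lG lP lP' H H'; apply/deq_onT/deq_on_local => // x _.
have [V oV [[f [sf [Ff Pf]]]|[g [sg [Gg Pg]]]]] := H x; exists V => //.
- apply: deq_on_trans Pf (deq_on_sym _).
  by apply: hormander_left Ff => //; exact: oV.1.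
- apply: deq_on_trans Pg (deq_on_sym _).
  by apply: hormander_right Gg => //; exact: oV.1.
Qed.

Lemma tshift_linear e a psi1 psi2 :
  tshift e (a *: psi1 + psi2) = a *: tshift e psi1 + tshift e psi2.
Proof. exact: testfun_ext. Qed.

Lemma dtrans_linear e F : linear F -> linear (dtrans e F).
Proof. by move=> lF a u v; rewrite /dtrans tshift_linear lF. Qed.

Lemma tderive_tshift e psi : tderive (tshift e psi) = tshift e (tderive psi).
Proof.
apply: testfun_ext => x.
have := cderive_affine 1 (- e) 1 (tfun_smooth psi) => /(congr1 (fun h => h x)).
rewrite expr1 [1 * x]mul1r [_ * _]mul1r => E; rewrite tderiveE [RHS](esym E).
by congr (cderive 1 _ x); apply/funext => y; rewrite mul1r.
Qed.

Lemma dtrans_dderive e F : dtrans e (dderive F) = dderive (dtrans e F).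
Proof. by apply/funext => psi; rewrite /dtrans !dderiveE tderive_tshift. Qed.

Lemma ccvg_to_unique (T : Type) (FF : set_system T) (PF : ProperFilter FF)
  (g : T -> R[i]) l l' : ccvg_to FF g l -> ccvg_to FF g l' -> l = l'.
Proof.
move=> [c1 c2] [d1 d2]; apply: complex_eq.
- exact: cvg_unique c1 d1.
- exact: cvg_unique c2 d2.
Qed.

Lemma ccvg_to_near (T : Type) (FF : set_system T) (PF : Filter FF)
  (g h : T -> R[i]) l : (\forall t \near FF, g t = h t) ->
  ccvg_to FF g l -> ccvg_to FF h l.
Proof.
move=> gh [c1 c2]; split.
- by apply: cvg_trans c1; apply: near_eq_cvg; apply: filterS gh => t ->.
- by apply: cvg_trans c2; apply: near_eq_cvg; apply: filterS gh => t ->.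
Qed.

Lemma ccvg_toN (T : Type) (FF : set_system T) (PF : Filter FF) (g : T -> R[i]) l :
  ccvg_to FF g l -> ccvg_to FF (fun t => - g t) (- l).
Proof.
move=> [c1 c2]; split.
- by rewrite cReN; under eq_fun do rewrite cReN; exact: cvgN.
- by rewrite cImN; under eq_fun do rewrite cImN; exact: cvgN.
Qed.

Lemma ccvg_toD (T : Type) (FF : set_system T) (PF : Filter FF) (g h : T -> R[i]) l m :
  ccvg_to FF g l -> ccvg_to FF h m -> ccvg_to FF (fun t => g t + h t) (l + m).
Proof.
move=> [c1 c2] [d1 d2]; split.
- by rewrite cReD; under eq_fun do rewrite cReD; exact: cvgD.
- by rewrite cImD; under eq_fun do rewrite cImD; exact: cvgD.
Qed.

Lemma ccvg_toM (T : Type) (FF : set_system T) (PF : Filter FF) (g h : T -> R[i]) l m :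
  ccvg_to FF g l -> ccvg_to FF h m -> ccvg_to FF (fun t => g t * h t) (l * m).
Proof.
move=> [c1 c2] [d1 d2]; split.
- by rewrite cReM; under eq_fun do rewrite cReM; apply: cvgB; exact: cvgM.
- by rewrite cImM; under eq_fun do rewrite cImM; apply: cvgD; exact: cvgM.
Qed.

Lemma ccvg_to_cst (T : Type) (FF : set_system T) (PF : Filter FF) (c : R[i]) :
  ccvg_to FF (fun=> c) c.
Proof. by split; exact: cvg_cst. Qed.

Lemma is_star_unique F G P P' : linear F -> linear G ->
  is_star F G P -> is_star F G P' -> P = P'.
Proof.
move=> lF lG [_ [Pe [H C]]] [_ [Pe' [H' C']]]; apply/funext => psi.
apply: (ccvg_to_unique (FF := 0^'+)) (C' psi).
apply: ccvg_to_near (C psi).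
near=> e.
have [[lP _] h] : is_distribution (Pe e) /\ is_hormander_product F (dtrans e G) (Pe e).
  by near: e.
have [[lP' _] h'] : is_distribution (Pe' e) /\ is_hormander_product F (dtrans e G) (Pe' e).
  by near: e.
by congr (_ psi); apply: hormander_unique h h' => //; exact: dtrans_linear.
Unshelve. all: by end_near. Qed.

(** Limits are unique, so exhibiting one family of products with its limit determines what [xget]
    returns. Every evaluation of [star] below goes through this. *)
Lemma star_eq F G P : linear F -> linear G -> is_star F G P -> star F G = P.
Proof.
move=> lF lG sP; rewrite /star; case: xgetP => [P' _ sP'|/(_ P)[]//].
exact: is_star_unique sP' sP.
Qed.

Lemma is_distributionB F G : is_distribution F -> is_distribution G ->
  is_distribution (F - G).
Proof. by move=> dF dG; rewrite -scaleN1r; exact/is_distributionD/is_distributionZ. Qed.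

Lemma hormander_leibniz F G P P1 : linear F -> linear G -> linear P -> linear P1 ->
  is_hormander_product F G P -> is_hormander_product (dderive F) G P1 ->
  is_hormander_product F (dderive G) (dderive P - P1).
Proof.
move=> lF lG lP lP1 H H1 x; have [V oV [[f [sf [Ff Pf]]]|[g [sg [Gg Pg]]]]] := H x.
  exists V => //; left; exists f, sf; split=> //.
  have Ff' := deq_on_dderive Ff; rewrite (dderive_reg sf) in Ff'.
  have P1f := hormander_left (smooth_cderiven 1 sf) lP1 lG H1 oV.1 Ff'.
  apply: deq_on_trans (deq_onD (deq_on_dderive Pf) (deq_onN P1f)) _.
  by rewrite dderive_dmul // addrAC subrr add0r.
exists V => //; right; exists (cderive 1 g), (smooth_cderiven 1 sg); split=> //.
  by rewrite -(dderive_reg sg); exact: deq_on_dderive.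
have P1g := hormander_right sg lP1 (dderive_linear lF) H1 oV.1 Gg.
apply: deq_on_trans (deq_onD (deq_on_dderive Pg) (deq_onN P1g)) _.
by rewrite dderive_dmul // addrK.
Qed.

(** Differentiation commutes with translations and with weak limits, so the rule survives [e -> 0].
    Read as an existence statement, it moves a derivative from [F] to [G] and allows induction on
    the order of [G]. *)
Lemma is_star_leibniz F G P P1 : linear F -> linear G ->
  is_star F G P -> is_star (dderive F) G P1 -> is_star F (dderive G) (dderive P - P1).
Proof.
move=> lF lG [dP [Pe [H C]]] [dP1 [P1e [H1 C1]]]; split.
  exact/is_distributionB/dP1/is_distribution_dderive.
exists (fun e => dderive (Pe e) - P1e e); split.
  near=> e.
  have [dPe h] : is_distribution (Pe e) /\ is_hormander_product F (dtrans e G) (Pe e).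
    by near: e.
  have [dP1e h1] : is_distribution (P1e e) /\
      is_hormander_product (dderive F) (dtrans e G) (P1e e) by near: e.
  split; first exact/is_distributionB/dP1e/is_distribution_dderive.
  rewrite dtrans_dderive; apply: hormander_leibniz => //.
  - exact: dtrans_linear.
  - exact: dPe.1.
  - exact: dP1e.1.
move=> psi; rewrite !fctE.
by apply: ccvg_toD; apply: ccvg_toN; [exact: C|exact: C1].
Unshelve. all: by end_near. Qed.

Lemma hormander_sym F G P : is_hormander_product F G P -> is_hormander_product G F P.
Proof. by move=> H x; have [V oV [h|h]] := H x; exists V => //; [right|left]. Qed.

Lemma is_star_leibniz_r F G P P1 : linear F -> linear G ->
  is_star F G P -> is_star F (dderive G) P1 -> is_star (dderive F) G (dderive P - P1).
Proof.
move=> lF lG [dP [Pe [H C]]] [dP1 [P1e [H1 C1]]]; split.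
  exact/is_distributionB/dP1/is_distribution_dderive.
exists (fun e => dderive (Pe e) - P1e e); split.
  near=> e.
  have [dPe h] : is_distribution (Pe e) /\ is_hormander_product F (dtrans e G) (Pe e).
    by near: e.
  have [dP1e h1] : is_distribution (P1e e) /\
      is_hormander_product F (dtrans e (dderive G)) (P1e e) by near: e.
  split; first exact/is_distributionB/dP1e/is_distribution_dderive.
  apply: hormander_sym; apply: hormander_leibniz => //.
  - exact: dtrans_linear.
  - exact: dPe.1.
  - exact: dP1e.1.
  - exact: hormander_sym.
  - by rewrite -dtrans_dderive; exact: hormander_sym.
move=> psi; rewrite !fctE.
by apply: ccvg_toD; apply: ccvg_toN; [exact: C|exact: C1].
Unshelve. all: by end_near. Qed.

End locality.

(** * Translation invariance of the integral *)

Section translation.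
Context {R : realType}.
Local Notation mu := (@lebesgue_measure R).

Section shift.
Variable e : R.

Let sh : measurableTypeR R -> measurableTypeR R := fun x => x + e.

Let msh : measurable_fun setT sh.
Proof.
by apply: continuous_measurable_fun => x; apply: cvgD; [exact: cvg_id|exact: cvg_cst].
Qed.

HB.instance Definition _ := isMeasurableFun.Build _ _ _ _ sh msh.

(** The image measure gives half-open intervals their length, which characterizes Lebesgue
    measure. *)
Let lebesgue_measure_shift (A : set R) : measurable A ->
  mu A = pushforward mu sh A.
Proof.
move=> mA; apply: lebesgue_measure_unique => //= _ [[a b]] _ <-.
have -> : pushforward mu sh [set` `]a, b]] = mu [set` `]a - e, b - e]].
  rewrite /pushforward; congr (mu _); apply/seteqP; split=> x /=;
  by rewrite !in_itv /= ltrBlDr lerBrDr.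
have E1 := lebesgue_measure_itv `]a, b]; rewrite /= lte_fin in E1.
have E2 := lebesgue_measure_itv `]a - e, b - e]; rewrite /= lte_fin in E2.
rewrite [LHS]E1 [RHS]E2 ltrD2r; case: (a < b) => //.
by rewrite -!EFinD; congr (_%:E); ring.
Qed.

Lemma rlocb_shift (f : R -> R) : rlocb f -> rlocb (fun x => f (x + e)).
Proof.
move=> [mf bf]; split; first exact: (measurableT_comp mf msh).
move=> M; have [C HC] := bf (M + `|e|); exists C => x xM; apply: HC.
by rewrite (le_trans (ler_normD _ _)) // lerD2r.
Qed.

Lemma bsupp_shift (f : R -> R) : bsupp f -> bsupp (fun x => f (x + e)).
Proof.
move=> [M HM]; exists (M + `|e|) => x h; apply: HM.
have : `|x| <= `|x + e| + `|e| by rewrite -{1}(addrK e x) ler_normB.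
lra.
Qed.

Lemma rint_shift (f : R -> R) : rlocb f -> bsupp f ->
  rint (fun x => f (x + e)) = rint f.
Proof.
move=> lf sf; rewrite /rint /Rintegral; congr fine.
have i := rlocb_integrable (rlocb_shift lf) (bsupp_shift sf).
have mf : measurable_fun setT (EFin \o f) by apply/measurable_EFinP; case: lf.
have := @integral_pushforward _ _ _ _ R sh msh mu setT (EFin \o f) mf i measurableT.
rewrite preimage_setT => /esym E; rewrite [LHS]E.
apply: eq_measure_integral => A mA _; exact/esym/lebesgue_measure_shift.
Qed.

End shift.

Lemma locb_shift e (f : R -> R[i]) : locb f -> locb (fun x => f (x + e)).
Proof. by move=> [lr lj]; split; [exact: (rlocb_shift e lr)|exact: (rlocb_shift e lj)]. Qed.

Lemma cintegral_shift e (f : R -> R[i]) : locb f -> cbsupp f ->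
  cintegral (fun x => f (x + e)) = cintegral f.
Proof.
move=> [lr lj] /cbsupp_bsupp[sr sj]; rewrite !cintegralE.
have E1 := rint_shift e lr sr; have E2 := rint_shift e lj sj.
by congr (_ +i* _); [exact: E1|exact: E2].
Qed.

Lemma dtrans_reg e (g : R -> R[i]) : locb g ->
  dtrans e (reg g) = reg (fun x => g (x + e)).
Proof.
move=> lg; apply/funext => psi; rewrite /dtrans /reg.
rewrite -(cintegral_shift e (f := fun x => g x * tshift e psi x)).
- by congr cintegral; apply/funext => x; rewrite /= addrK.
- exact: locbM lg (locb_tfun _).
- exact: cbsuppM.
Qed.

Lemma dtrans_ddern e n (F : functional R) : dtrans e (ddern n F) = ddern n (dtrans e F).
Proof. by elim: n => // n IH; rewrite !ddernS dtrans_dderive IH. Qed.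

End translation.

(** * Piecewise smooth functions: local bounds and one-sided limits *)

Section piecewise_smooth_theory.
Context {R : realType}.
Implicit Types (f g : R -> R[i]).

Lemma locally_bounded (f : R -> R) :
  (forall x : R, exists C : R, \forall y \near x, `|f y| <= C) ->
  forall M : R, exists C : R, forall x, `|x| <= M -> `|f x| <= C.
Proof.
move=> H M.
have /compact_near_coveringP := @segment_compact R (- M) M.
move=> /(_ R (pinfty_nbhs R) (fun C x => `|f x| <= C)) [].
  move=> x _; have [C HC] := H x.
  exists ([set y | `|f y| <= C], [set D | C <= D]) => /=.
    by split; [exact: HC|apply: nbhs_pinfty_ge; exact: num_real].
  by move=> [y D] /= [h1 h2]; exact: le_trans h2.
move=> C [_ HC]; exists (C + 1) => x xM; apply: HC; first by rewrite ltrDl.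
by rewrite /= in_itv /= -ler_norml.
Qed.

Lemma cvg_near_bounded (F : set_system R) (FF : Filter F) (f : R -> R) (l : R) :
  f y @[y --> F] --> l -> \forall y \near F, `|f y| <= `|l| + 1.
Proof.
move=> /cvgrPdist_le /(_ 1 ltr01); apply: filterS => y h.
by rewrite -[f y](subKr l) (le_trans (ler_normB _ _)) // lerD2l.
Qed.

Lemma near_bounded_sides (f : R -> R) (x l r : R) : f y @[y --> x^'-] --> l ->
  f y @[y --> x^'+] --> r -> exists C : R, \forall y \near x, `|f y| <= C.
Proof.
move=> /cvg_near_bounded h1 /cvg_near_bounded h2.
exists (`|f x| + (`|l| + 1) + (`|r| + 1)).
move: h1 h2; rewrite !near_withinE => h1 h2; near=> y.
have [yx|yx|->] := ltgtP y x.
- have : `|f y| <= `|l| + 1 by move: yx; near: y.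
  have := normr_ge0 (f x); have := normr_ge0 r; lra.
- have : `|f y| <= `|r| + 1 by move: yx; near: y.
  have := normr_ge0 (f x); have := normr_ge0 l; lra.
- have := normr_ge0 r; have := normr_ge0 l; lra.
Unshelve. all: by end_near. Qed.

Lemma pws_open (s : seq R) : open (~` [set` s]).
Proof.
apply: closed_openC; apply: compact_closed; first exact: norm_hausdorff.
exact/finite_compact/finite_seq.
Qed.

(** Measurability comes from continuity on the open complement of the finite set [s]; boundedness
    near a point of [s] comes from the two one-sided limits, and compactness does the rest. *)
Lemma rlocb_pws (s : seq R) (f : R -> R) :
  (forall x, x \notin s -> {for x, continuous f}) ->
  (forall x, x \in s -> (exists l : R, f y @[y --> x^'-] --> l) /\
                        (exists l : R, f y @[y --> x^'+] --> l)) -> rlocb f.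
Proof.
move=> cf lf; split; last first.
  apply: locally_bounded => x; have [/lf[[l hl] [r hr]]|/cf h] := boolP (x \in s).
    exact: near_bounded_sides hl hr.
  by exists (`|f x| + 1); exact: cvg_near_bounded h.
have ms : measurable ([set` s] : set R).
  apply: countable_measurable; [exact: measurable_set1|].
  exact: (finite_set_countable (finite_seq s)).
rewrite -(setUv [set` s]); apply/measurable_funU => //; first exact: measurableC.
split.
  move=> _ Y mY; apply: countable_measurable; first exact: measurable_set1.
  apply: finite_set_countable; apply: sub_finite_set (finite_seq s).
  exact: subIsetl.
apply: open_continuous_measurable_fun; first exact: pws_open.
by move=> x; rewrite inE /= => /negP; exact: cf.
Qed.

Lemma locb_piecewise_smooth f : piecewise_smooth f -> locb f.
Proof.
move=> [s [sf lf]]; split; apply: (@rlocb_pws s).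
- by move=> x xs; have := sf 0%N x xs; rewrite cderive0 => /cderivable_continuous[].
- move=> x xs; have := lf 0%N x xs; rewrite cderive0 => -[[l [hl _]] [r [hr _]]].
  by split; [exists (cRe l)|exists (cRe r)].
- by move=> x xs; have := sf 0%N x xs; rewrite cderive0 => /cderivable_continuous[].
- move=> x xs; have := lf 0%N x xs; rewrite cderive0 => -[[l [_ hl]] [r [_ hr]]].
  by split; [exists (cIm l)|exists (cIm r)].
Qed.

Lemma cderivable_ccvg f x : cderivable f x ->
  ccvg_to x^'- f (f x) /\ ccvg_to x^'+ f (f x).
Proof.
move=> /cderivable_continuous[c1 c2]; split; split.
- exact: cvg_at_left_filter.
- exact: cvg_at_left_filter.
- exact: cvg_at_right_filter.
- exact: cvg_at_right_filter.
Qed.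

Lemma piecewise_smooth_rlim f x : piecewise_smooth f ->
  exists v : nat -> R[i], forall k, ccvg_to x^'+ (cderive k f) (v k).
Proof.
move=> [s [sf lf]]; 
have /choice[v Hv] : forall k, exists l, ccvg_to x^'+ (cderive k f) l.
  move=> k; have [xs|xs] := boolP (x \in s); first by have [_] := lf k x xs.
  by exists (cderive k f x); have [] := cderivable_ccvg (sf k x xs).
by exists v.
Qed.

Lemma piecewise_smooth_llim f x : piecewise_smooth f ->
  exists v : nat -> R[i], forall k, ccvg_to x^'- (cderive k f) (v k).
Proof.
move=> [s [sf lf]]; 
have /choice[v Hv] : forall k, exists l, ccvg_to x^'- (cderive k f) l.
  move=> k; have [xs|xs] := boolP (x \in s); first by have [] := lf k x xs.
  by exists (cderive k f x); have [] := cderivable_ccvg (sf k x xs).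
by exists v.
Qed.

End piecewise_smooth_theory.

(** * The product of singular coefficients *)

Section star_base.
Context {R : realType}.
Local Notation normc := (@Normc.normc R).
Implicit Types (f g : R -> R[i]) (psi : testfun R).

Lemma near_right_notin (s : seq R) : \forall e \near (0 : R)^'+, e \notin s.
Proof.
elim: s => [|d s IH]; first by apply: nearW => e.
have H : \forall e \near (0 : R)^'+, e != d.
  have [d0|d0] := ltP 0 d.
    by near=> e; rewrite lt_eqF //; near: e; exact: nbhs_right_lt.
  by near=> e; rewrite gt_eqF //; apply: le_lt_trans d0 _.
near=> e; rewrite inE negb_or; apply/andP; split; first by near: e.
by near: e.
Unshelve. all: by end_near. Qed.

Lemma cvg_addr_right (y : R) : y + e @[e --> 0^'+] --> y^'+.
Proof.
move=> A; rewrite /at_right /within /= => /nbhs_ballP[r /= r0 H].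
apply/nbhs_ballP; exists r => //= e; rewrite /ball /= sub0r normrN => er e0.
by apply: H; rewrite ?ltrDl // /ball /= opprD addNKr normrN.
Qed.

Lemma cvg_subr_left (y : R) : y - e @[e --> 0^'+] --> y^'-.
Proof.
move=> A; rewrite /at_left /within /= => /nbhs_ballP[r /= r0 H].
apply/nbhs_ballP; exists r => //= e; rewrite /ball /= sub0r normrN => er e0.
by apply: H; rewrite ?gtrBl // /ball /= opprB addrC subrK.
Qed.

Lemma ccvg_to_comp (T U : Type) (FF : set_system T) (GG : set_system U)
  (h : T -> U) (g : U -> R[i]) l :
  h t @[t --> FF] --> GG -> ccvg_to GG g l -> ccvg_to FF (fun t => g (h t)) l.
Proof. by move=> hF [c1 c2]; split; [exact: cvg_comp c1|exact: cvg_comp c2]. Qed.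

Lemma ccvg_to_sum (T : Type) (FF : set_system T) (PF : Filter FF) n
  (g : 'I_n -> T -> R[i]) (l : 'I_n -> R[i]) :
  (forall i, ccvg_to FF (g i) (l i)) ->
  ccvg_to FF (fun t => \sum_i g i t) (\sum_i l i).
Proof.
elim: n g l => [|n IH] g l H.
  by rewrite big_ord0; under eq_fun do rewrite big_ord0; exact: ccvg_to_cst.
rewrite big_ord_recr; under eq_fun do rewrite big_ord_recr.
by apply: ccvg_toD; [exact: (IH (fun i => g (widen_ord _ i)))|exact: H].
Qed.

Lemma ccvg_jetmul (T : Type) (FF : set_system T) (PF : Filter FF) j
  (v_ : T -> nat -> R[i]) v (y_ : T -> R) y psi :
  (forall k, ccvg_to FF (v_ ^~ k) (v k)) -> y_ t @[t --> FF] --> y ->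
  ccvg_to FF (fun t => jetmul j (v_ t) (y_ t) psi) (jetmul j v y psi).
Proof.
elim: j v_ v psi => [|j IH] v_ v psi cv cy.
  apply: ccvg_toM; first exact: cv.
  have [c1 c2] := smooth_continuous (tfun_smooth psi).
  by split; [exact: cvg_comp cy (c1 y)|exact: cvg_comp cy (c2 y)].
apply: ccvg_toD; apply: ccvg_toN; first exact: IH.
by apply: (IH (fun t k => v_ t k.+1) (fun k => v k.+1)) => // k; exact: cv.
Qed.

Lemma locb_normc f : locb f ->
  forall M : R, exists2 C : R, 0 <= C & forall x, `|x| <= M -> normc (f x) <= C.
Proof.
move=> [[_ br] [_ bj]] M; have [C HC] := br M; have [C' HC'] := bj M.
exists (`|C| + `|C'|); first exact: addr_ge0.
move=> x xM; apply: (le_trans (normc_le _)); apply: lerD.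
- by apply: (le_trans (HC _ xM)); exact: ler_norm.
- by apply: (le_trans (HC' _ xM)); exact: ler_norm.
Qed.

Lemma rintegrable_itv (a b : R) : rintegrable (fun x : R => (x \in `[a, b])%:R : R).
Proof.
apply: rlocb_integrable; first exact: rlocb_itv.
exists (`|a| + `|b|) => x h; rewrite in_itv /=; case: andP => // -[h1 h2].
move: h; rewrite ltNge => /negP; case.
have a0 : `|a| >= - a by rewrite -normrN ler_norm.
have b0 := ler_norm b; have a1 := normr_ge0 a; have b1 := normr_ge0 b.
by rewrite ler_norml; apply/andP; split; lra.
Qed.

(** Dominated convergence is a statement about sequences. Truncating them at 1 keeps all translates
    of a test function inside one bounded set. *)
Lemma ccvg_at_right_seq (h : R -> R[i]) l :
  (forall u : nat -> R, (forall n, 0 < u n <= 1) -> u n @[n --> \oo] --> (0 : R) ->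
    ccvg_to \oo (fun n => h (u n)) l) -> ccvg_to 0^'+ h l.
Proof.
move=> H.
suff K (u : nat -> R) : (forall n, 0 < u n) /\ u n @[n --> \oo] --> (0 : R) ->
    ccvg_to \oo (fun n => h (u n)) l.
  by split; apply/cvg_at_rightP => u /K[].
move=> [u0 uc]; have u1 : \forall n \near \oo, u n <= 1.
  by move/cvgrPdist_le : uc => /(_ 1 ltr01); apply: filterS => n;
    rewrite sub0r normrN; exact: le_trans (ler_norm _).
apply: ccvg_to_near (H (fun n => Num.min (u n) 1) _ _).
- by apply: filterS u1 => n un; rewrite min_l.
- by move=> n; rewrite lt_min u0 ltr01 ge_min lexx orbT.
- by apply: cvg_trans uc; apply: near_eq_cvg; apply: filterS u1 => n un; rewrite min_l.
Qed.

Lemma ccvg_reg_mul f g (s : seq R) psi : locb f -> locb g ->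
  (forall x, x \notin s -> cderivable g x) ->
  ccvg_to 0^'+ (fun e => reg (fun x => f x * g (x + e)) psi)
               (reg (fun x => f x * g x) psi).
Proof.
move=> lf lg dg; apply: ccvg_at_right_seq => u u01 uc.
have [M M0 HM] := tsupp_bounded psi.
have [C C0 HC] := locb_normc lf M.
(* The radius is [M + 1] because [g] is evaluated at [x + u n] with [u n <= 1]. *)
have [D D0 HD] := locb_normc lg (M + 1).
have [E E0 HE] := locb_normc (locb_tfun psi) M.
apply: (@ccvg_dct _ s _ _ (fun x => C * D * E * (x \in `[- M, M])%:R)).
- by move=> n; apply: locbM (locb_tfun _); apply: locbM => //; exact: locb_shift.
- by apply: locbM (locb_tfun _); exact: locbM.
- by apply: rintegrableZ; exact: rintegrable_itv.
- move=> n x; rewrite in_itv /= -ler_norml; have [xM|xM] := leP `|x| M; last first.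
    by rewrite HM // !mulr0 normr0.
  have [h1 h2] := ler_normc (f x * g (x + u n) * psi x).
  have /andP[un0 un1] := u01 n.
  have h : normc (f x * g (x + u n) * psi x) <= C * D * E * 1.
    rewrite mulr1 !Normc.normcM !ler_pM ?mulr_ge0 ?normc_ge0 //; [exact: HC| |exact: HE].
    by apply: HD; rewrite (le_trans (ler_normD _ _)) // lerD // gtr0_norm.
  by split; [exact: le_trans h1 h|exact: le_trans h2 h].
- move=> x xs; apply: ccvg_toM; last exact: ccvg_to_cst.
  apply: ccvg_toM; first exact: ccvg_to_cst.
  have [c1 c2] := cderivable_continuous (dg x xs).
  have cx : x + u n @[n --> \oo] --> x.
    by rewrite -[X in _ --> X]addr0; apply: cvgD => //; exact: cvg_cst.
  by split; [exact: cvg_comp cx c1|exact: cvg_comp cx c2].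
Qed.

(** The difference quotients are literally the same, so this covers piecewise smooth functions, to
    which [derive1n_affine] does not apply. *)
Lemma derive1_shift (e : R) (h : R -> R) :
  derive1 (fun y => h (y + e)) = fun y => derive1 h (y + e).
Proof. by apply/funext => y; rewrite /derive1; under eq_fun do rewrite -addrA. Qed.

Lemma derive1n_shift (e : R) (h : R -> R) n :
  derive1n n (fun y => h (y + e)) = fun y => derive1n n h (y + e).
Proof. by elim: n => // n IH; rewrite !derive1nS IH derive1_shift. Qed.

Lemma cderive_shift (e : R) f n x :
  cderive n (fun y => f (y + e)) x = cderive n f (x + e).
Proof.
rewrite /cderive.
have := derive1n_shift e (cRe \o f) n => /(congr1 (fun h => h x)) E1.
have := derive1n_shift e (cIm \o f) n => /(congr1 (fun h => h x)) E2.
by congr (_ +i* _); [exact: E1|exact: E2].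
Qed.

Lemma jetmul_ext j v w (y : R) : (forall k, v k = w k) -> jetmul j v y = jetmul j w y.
Proof. by move=> E; congr (jetmul j _ y); apply/funext. Qed.

(** If [y] lies in [U] then [f1] and [f] have the same jet at [y]; otherwise both Dirac sums vanish
    on [U]. *)
Lemma deq_on_product U f f1 (sf1 : smooth f1) g n (d : 'I_n -> R[i]) y : open U ->
  (forall x, U x -> f1 x = f x) ->
  deq_on U (reg (fun x => f x * g x) + \sum_j d j *: jetmul j (fun k => cderive k f y) y)
    (dmul sf1 (reg g + \sum_j d j *: ddern j (delta y))).
Proof.
move=> oU E; rewrite dmulD dmul_reg dmul_sum; apply: deq_onD.
  by apply: deq_on_reg_ext => x Ux; rewrite mulrC E.
move=> psi pU; rewrite !fct_sumE; apply: eq_bigr => j _.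
rewrite dmulZ !fctE dmul_ddelta; congr (_ *: _).
have [Uy|nUy] := pselect (U y); last by rewrite !jetmul_notin // => /pU.
congr (_ psi); apply: jetmul_ext => k.
by apply: (cderive_eq_on oU) => // x Ux; rewrite E.
Qed.

Lemma reg_smooth_part U f f1 n (c : 'I_n -> R[i]) y : ~ U y ->
  (forall x, U x -> f1 x = f x) ->
  deq_on U (reg f + \sum_j c j *: ddern j (delta y)) (reg f1).
Proof.
move=> nUy E psi pU; rewrite fctE fct_sumE big1 ?addr0; last first.
  by move=> j _; rewrite fctE ddelta_notin ?scaler0 // => /pU.
by rewrite (deq_on_reg_ext (g := f1) _ pU) // => x Ux; rewrite E.
Qed.

Lemma jetmul_sum_notin U n (c : 'I_n -> R[i]) v y : ~ U y ->
  deq_on U (\sum_j c j *: jetmul j v y) 0.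
Proof.
move=> nUy psi pU; rewrite fct_sumE big1 // => j _.
by rewrite fctE jetmul_notin ?scaler0 // => /pU.
Qed.

Lemma dtrans_sing e g n (d : 'I_n -> R[i]) y : locb g ->
  dtrans e (reg g + \sum_j d j *: ddern j (delta y)) =
  reg (fun x => g (x + e)) + \sum_j d j *: ddern j (delta (y - e)).
Proof.
move=> lg; rewrite -(dtrans_reg e lg); apply/funext => psi; rewrite /dtrans !fctE.
congr (_ + _); rewrite !fct_sumE; apply: eq_bigr => j _; rewrite !fctE; congr (_ *: _).
exact: (congr1 (fun F => F psi) (dtrans_ddern e j (delta y))).
Qed.

(* Shifting [g] to the left by [e] moves its Diracs to [y - e], where [f] is smooth:
   hence the left limits of [f], and the right limits of [g] for the Diracs of [f]. *)
Lemma is_star_piecewise f g n m (c : 'I_n -> R[i]) (d : 'I_m -> R[i]) (xi : R) vf vg :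
  piecewise_smooth f -> piecewise_smooth g ->
  (forall k, ccvg_to xi^'- (cderive k f) (vf k)) ->
  (forall k, ccvg_to xi^'+ (cderive k g) (vg k)) ->
  is_star (reg f + \sum_j c j *: ddern j (delta xi))
          (reg g + \sum_j d j *: ddern j (delta xi))
    (reg (fun x => f x * g x) + \sum_j c j *: jetmul j vg xi
      + \sum_j d j *: jetmul j vf xi).
Proof.
move=> pf pg lf rg.
have bf := locb_piecewise_smooth pf; have bg := locb_piecewise_smooth pg.
have dsum (l : nat) (a : 'I_l -> R[i]) v y : is_distribution (\sum_j a j *: jetmul j v y).
  by apply: is_distribution_sum => j; exact/is_distributionZ/is_distribution_jetmul.
split.
  by apply: is_distributionD => //; apply: is_distributionD => //;
    exact/is_distribution_reg/locbM.
exists (fun e => reg (fun x => f x * g (x + e))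
   + \sum_j c j *: jetmul j (fun k => cderive k g (xi + e)) xi
   + \sum_j d j *: jetmul j (fun k => cderive k f (xi - e)) (xi - e)); split; last first.
  move=> psi; rewrite !fctE.
  have E : (fun e => (reg (fun x => f x * g (x + e))
     + \sum_j c j *: jetmul j (fun k => cderive k g (xi + e)) xi
     + \sum_j d j *: jetmul j (fun k => cderive k f (xi - e)) (xi - e)) psi) =
    (fun e => reg (fun x => f x * g (x + e)) psi
     + \sum_j c j * jetmul j (fun k => cderive k g (xi + e)) xi psi
     + \sum_j d j * jetmul j (fun k => cderive k f (xi - e)) (xi - e) psi).
    by apply/funext => e; rewrite !fctE !fct_sumE.
  rewrite E !fct_sumE; apply: ccvg_toD; first apply: ccvg_toD.
  - by have [s [sg _]] := pg; apply: (@ccvg_reg_mul _ _ s) => // x xs;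
      have := sg 0%N x xs; rewrite cderive0.
  - apply: ccvg_to_sum => j; apply: ccvg_toM; first exact: ccvg_to_cst.
    apply: ccvg_jetmul; last exact: cvg_cst.
    by move=> k; apply: ccvg_to_comp (rg k); exact: cvg_addr_right.
  - apply: ccvg_to_sum => j; apply: ccvg_toM; first exact: ccvg_to_cst.
    apply: ccvg_jetmul.
      by move=> k; apply: ccvg_to_comp (lf k); exact: cvg_subr_left.
    by move=> A nA; apply: (cvg_subr_left (y := xi)); exact: (cvg_within _ nA).
(* [xi] joins both lists, so that the Diracs count as singularities even where [f] or [g] happens to
   be smooth at [xi]. *)
have [s [sf _]] := pf; have [t [sg _]] := pg.
pose s' := xi :: s; pose t' := xi :: t.
have sf' : smooth_on (~` [set` s']) f.
  by move=> n' x /= /negP; rewrite inE negb_or => /andP[_]; exact: sf.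
have sg' : smooth_on (~` [set` t']) g.
  by move=> n' x /= /negP; rewrite inE negb_or => /andP[_]; exact: sg.
near=> e.
(* Only finitely many [e], the differences between points of the two lists, bring a singularity of
   the translated [g] onto one of [f]. *)
have disj x : x \in s' -> x + e \in t' -> False.
  have : e \notin [seq z - y | y <- s', z <- t'] by near: e; exact: near_right_notin.
  move=> ne xs xt; move/negP: ne; apply; apply/allpairsP; exists (x, x + e).
  by rewrite /= addrAC subrr add0r.
split.
  apply: is_distributionD => //; apply: is_distributionD => //.
  by apply: is_distribution_reg; apply: locbM => //; exact: locb_shift.
rewrite dtrans_sing // => x.
(* Off [s'] the left factor is smooth near [x]; on [s'] the translated right factor is, by
   [disj]. *)
have [xs|xs] := boolP (x \in s'); last first.
  have [|r r0 [h sh H]] := smooth_on_extend (@pws_open R s') _ sf' (x := x).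
    exact/negP.
  exists (ball x r).
    by split; [exact: ball_open|exact: ballxx].
  have HU y : ball x r y -> h y = f y by rewrite /ball /= distrC => /H[].
  have nU : ~ ball x r xi.
    by rewrite /ball /= distrC => /H[/= hh _]; apply: hh; rewrite inE eqxx.
  left; exists h, sh; split; first exact: reg_smooth_part.
  rewrite addrAC -[X in deq_on _ _ X]addr0; apply: deq_onD.
    apply: deq_on_product => //; exact: ball_open.
  exact: jetmul_sum_notin.
have xt : x + e \notin t' by apply/negP; exact: disj.
have [|r r0 [h sh H]] := smooth_on_extend (@pws_open R t') _ sg' (x := x + e).
  exact/negP.
exists (ball x r).
  by split; [exact: ball_open|exact: ballxx].
have HU y : ball x r y -> h (1 * y + e) = g (y + e).
  rewrite mul1r /ball /= distrC => yr.
  by have [|_ ->] := H (y + e); rewrite // opprD addrACA subrr addr0.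
have nU : ~ ball x r (xi - e).
  rewrite /ball /= distrC => yr; have [|/= hh _] := H xi.
    by rewrite opprD addrA addrAC.
  by apply: hh; rewrite inE eqxx.
right; exists (fun y => h (1 * y + e)), (smooth_affine 1 e sh); split.
  exact: reg_smooth_part.
have -> : (fun x => f x * g (x + e)) = (fun x => g (x + e) * f x).
  by apply/funext => y; rewrite mulrC.
rewrite -[X in deq_on _ _ X]addr0; apply: deq_onD; last exact: jetmul_sum_notin.
have -> : (fun k => cderive k g (xi + e)) = (fun k => cderive k (fun y => g (y + e)) xi).
  by apply/funext => k; rewrite cderive_shift.
apply: deq_on_product => //; exact: ball_open.
Unshelve. all: by end_near. Qed.

End star_base.

(** * Products with coefficients singular at one point *)

Section star_singular.
Context {R : realType}.
Variable xi : R.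
Implicit Types (f g fm fp gm gp : R -> R[i]) (F G S : functional R).

Definition Om : set R := [set x | x < xi].
Definition Op : set R := [set x | xi < x].

Lemma cderive_pc_lt fm fp k x : x < xi -> cderive k (pc xi fm fp) x = cderive k fm x.
Proof.
by move=> xx; apply: (cderive_eq_on (@open_lt R xi)) => // y; exact: pc_lt.
Qed.

Lemma cderive_pc_gt fm fp k x : xi < x -> cderive k (pc xi fm fp) x = cderive k fp x.
Proof.
by move=> xx; apply: (cderive_eq_on (@open_gt R xi)) => // y; exact: pc_gt.
Qed.

Lemma pc_llim fm fp k : smooth fm -> ccvg_to xi^'- (cderive k (pc xi fm fp)) (cderive k fm xi).
Proof.
move=> sm; have [h _] := cderivable_ccvg (smooth_cderivable xi (smooth_cderiven k sm)).
apply: ccvg_to_near h; near=> x; rewrite cderive_pc_lt //.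
Unshelve. all: by end_near. Qed.

Lemma pc_rlim fm fp k : smooth fp -> ccvg_to xi^'+ (cderive k (pc xi fm fp)) (cderive k fp xi).
Proof.
move=> sp; have [_ h] := cderivable_ccvg (smooth_cderivable xi (smooth_cderiven k sp)).
apply: ccvg_to_near h; near=> x; rewrite cderive_pc_gt //.
Unshelve. all: by end_near. Qed.

Lemma piecewise_smooth_pc fm fp : smooth fm -> smooth fp ->
  piecewise_smooth (pc xi fm fp).
Proof.
move=> sm sp; exists [:: xi]; split=> n x; rewrite inE; last first.
  by move=> /eqP ->; split; eexists; [exact: pc_llim|exact: pc_rlim].
rewrite neq_lt => /orP[xx|xx].
  have h : smooth_on Om (pc xi fm fp).
    apply: (@smooth_on_eq _ _ fm); first exact: open_lt.
      by move=> y yx; rewrite pc_lt.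
    exact: smooth_onW.
  exact: h.
have h : smooth_on Op (pc xi fm fp).
  apply: (@smooth_on_eq _ _ fp); first exact: open_gt.
    by move=> y yx; rewrite pc_gt.
  exact: smooth_onW.
exact: h.
Qed.

Lemma pcM fm fp gm gp x :
  pc xi fm fp x * pc xi gm gp x = pc xi (fun x => fm x * gm x) (fun x => fp x * gp x) x.
Proof.
have [xx|xx|->] := ltgtP x xi; last by rewrite !pc_xi mul0r.
- by rewrite !pc_lt.
- by rewrite !pc_gt.
Qed.

Lemma delta_span_linear m y S : delta_span m y S -> linear S.
Proof. by move=> /is_distribution_delta_span[]. Qed.

Lemma singular_linear fm fp m S : smooth fm -> smooth fp -> delta_span m xi S ->
  linear (reg (pc xi fm fp) + S).
Proof.
move=> sm sp sS; apply: linear_addf; last exact: delta_span_linear sS.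
exact/reg_linear/locb_piecewise_smooth/piecewise_smooth_pc.
Qed.

Lemma dderive_singular fm fp m S : smooth fm -> smooth fp -> delta_span m xi S ->
  exists2 S', delta_span m.+1 xi S' &
  dderive (reg (pc xi fm fp) + S) = reg (pc xi (cderive 1 fm) (cderive 1 fp)) + S'.
Proof.
move=> sm sp sS; exists ((fp xi - fm xi) *: delta xi + dderive S).
  apply: delta_spanD; last exact: delta_span_dderive.
  exact/delta_spanZ/(@delta_span_ddern _ _ 0%N).
by rewrite dderiveD dderive_reg_pc // addrA.
Qed.

Lemma delta_span_deq0 U m S : ~ U xi -> delta_span m xi S -> deq_on U S 0.
Proof. by move=> nU sS psi pU; rewrite (delta_span_notin sS) // => /pU. Qed.

Lemma deq_on_singular_lt fm fp m S : delta_span m xi S ->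
  deq_on Om (reg (pc xi fm fp) + S) (reg fm).
Proof.
move=> sS; rewrite -[reg fm]addr0; apply: deq_onD.
  by apply: deq_on_reg_ext => x; exact: pc_lt.
by apply: delta_span_deq0 sS; rewrite /Om /= ltxx.
Qed.

Lemma deq_on_singular_gt fm fp m S : delta_span m xi S ->
  deq_on Op (reg (pc xi fm fp) + S) (reg fp).
Proof.
move=> sS; rewrite -[reg fp]addr0; apply: deq_onD.
  by apply: deq_on_reg_ext => x; exact: pc_gt.
by apply: delta_span_deq0 sS; rewrite /Op /= ltxx.
Qed.

Lemma delta_span_jetmul_sum m v (c : nat -> R[i]) :
  delta_span m xi (\sum_(j < m) c j *: jetmul j v xi).
Proof.
apply: delta_span_sum => j; have [S sS ->] := jetmul_lead j v xi.
apply: delta_spanD; first exact/delta_spanZ/delta_span_ddern.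
by apply: delta_spanW sS; exact: ltnW.
Qed.

(** The singular points of [g] are arbitrary here, so no closed formula is sought: only existence,
    and the value on either side of [xi]. The coefficient is quantified inside the induction because
    lowering the order of the right factor differentiates the left one. *)
Lemma is_star_singular_left n g : piecewise_smooth g ->
  forall fm fp m S (sm : smooth fm) (sp : smooth fp), delta_span m xi S ->
  exists P, [/\ is_star (reg (pc xi fm fp) + S) (ddern n (reg g)) P,
    deq_on Om P (dmul sm (ddern n (reg g))) & deq_on Op P (dmul sp (ddern n (reg g)))].
Proof.
move=> pg; have lg := reg_linear (locb_piecewise_smooth pg).
elim: n => [|n IH] fm fp m S sm sp sS.
  have [c cE] := sS.
  have [vg rg] := piecewise_smooth_rlim xi pg.
  have H := @is_star_piecewise _ (pc xi fm fp) g m 0 (fun j : 'I_m => c j) (fun=> 0) xi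
    _ vg (piecewise_smooth_pc sm sp) pg (fun k => pc_llim fp k sm) rg.
  rewrite !big_ord0 !addr0 -cE in H; eexists; split; first exact: H.
  - rewrite dmul_reg -[X in deq_on _ _ X]addr0; apply: deq_onD.
      by apply: deq_on_reg_ext => x xx; rewrite pc_lt // mulrC.
    by apply: delta_span_deq0 (delta_span_jetmul_sum _ _ _); rewrite /Om /= ltxx.
  - rewrite dmul_reg -[X in deq_on _ _ X]addr0; apply: deq_onD.
      by apply: deq_on_reg_ext => x xx; rewrite pc_gt // mulrC.
    by apply: delta_span_deq0 (delta_span_jetmul_sum _ _ _); rewrite /Op /= ltxx.
have [P [sP Pm Pp]] := IH fm fp m S sm sp sS.
have [S' sS' E] := dderive_singular sm sp sS.
have [P1 [sP1 P1m P1p]] := IH _ _ _ _ (smooth_cderiven 1 sm) (smooth_cderiven 1 sp) sS'.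
rewrite -E in sP1.
have lG : linear (ddern n (reg g)) by exact: ddern_linear.
exists (dderive P - P1); split.
- exact: is_star_leibniz (singular_linear sm sp sS) lG sP sP1.
- apply: deq_on_trans (deq_onD (deq_on_dderive Pm) (deq_onN P1m)) _.
  by rewrite dderive_dmul // addrAC subrr add0r.
- apply: deq_on_trans (deq_onD (deq_on_dderive Pp) (deq_onN P1p)) _.
  by rewrite dderive_dmul // addrAC subrr add0r.
Qed.

Lemma is_star_singular_right n g : piecewise_smooth g ->
  forall fm fp m S (sm : smooth fm) (sp : smooth fp), delta_span m xi S ->
  exists P, [/\ is_star (ddern n (reg g)) (reg (pc xi fm fp) + S) P,
    deq_on Om P (dmul sm (ddern n (reg g))) & deq_on Op P (dmul sp (ddern n (reg g)))].
Proof.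
move=> pg; have lg := reg_linear (locb_piecewise_smooth pg).
elim: n => [|n IH] fm fp m S sm sp sS.
  have [c cE] := sS.
  have [vg rg] := piecewise_smooth_llim xi pg.
  have H := @is_star_piecewise _ g (pc xi fm fp) 0 m (fun=> 0) (fun j : 'I_m => c j) xi
    vg _ pg (piecewise_smooth_pc sm sp) rg (fun k => pc_rlim fm k sp).
  rewrite !big_ord0 !addr0 -cE in H; eexists; split; first exact: H.
  - rewrite dmul_reg -[X in deq_on _ _ X]addr0; apply: deq_onD.
      by apply: deq_on_reg_ext => x xx; rewrite pc_lt.
    by apply: delta_span_deq0 (delta_span_jetmul_sum _ _ _); rewrite /Om /= ltxx.
  - rewrite dmul_reg -[X in deq_on _ _ X]addr0; apply: deq_onD.
      by apply: deq_on_reg_ext => x xx; rewrite pc_gt.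
    by apply: delta_span_deq0 (delta_span_jetmul_sum _ _ _); rewrite /Op /= ltxx.
have [P [sP Pm Pp]] := IH fm fp m S sm sp sS.
have [S' sS' E] := dderive_singular sm sp sS.
have [P1 [sP1 P1m P1p]] := IH _ _ _ _ (smooth_cderiven 1 sm) (smooth_cderiven 1 sp) sS'.
rewrite -E in sP1.
have lG : linear (ddern n (reg g)) by exact: ddern_linear.
exists (dderive P - P1); split.
- exact: is_star_leibniz_r lG (singular_linear sm sp sS) sP sP1.
- apply: deq_on_trans (deq_onD (deq_on_dderive Pm) (deq_onN P1m)) _.
  by rewrite dderive_dmul // addrAC subrr add0r.
- apply: deq_on_trans (deq_onD (deq_on_dderive Pp) (deq_onN P1p)) _.
  by rewrite dderive_dmul // addrAC subrr add0r.
Qed.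

(** Here the limits in [is_star_piecewise] are the jets of smooth branches, so the Dirac parts
    become genuine multiplications: by the right branch [gp] for the first factor, by the left
    branch [fm] for the second. *)
Lemma star_singular fm fp gm gp m n S1 S2
  (sfm : smooth fm) (sfp : smooth fp) (sgm : smooth gm) (sgp : smooth gp) :
  delta_span m xi S1 -> delta_span n xi S2 ->
  star (reg (pc xi fm fp) + S1) (reg (pc xi gm gp) + S2) =
  reg (pc xi (fun x => fm x * gm x) (fun x => fp x * gp x)) + dmul sgp S1 + dmul sfm S2.
Proof.
move=> sS1 sS2; have [c cE] := sS1; have [d dE] := sS2.
apply: star_eq; [exact: singular_linear sS1|exact: singular_linear sS2|].
have := @is_star_piecewise _ (pc xi fm fp) (pc xi gm gp) m n (fun j : 'I_m => c j)
    (fun j : 'I_n => d j) xi _ _ (piecewise_smooth_pc sfm sfp)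
    (piecewise_smooth_pc sgm sgp) (fun k => pc_llim fp k sfm) (fun k => pc_rlim gm k sgp).
rewrite -cE -dE.
have -> : \sum_(j < m) c j *: jetmul j (fun k => cderive k gp xi) xi = dmul sgp S1.
  by rewrite cE dmul_sum; apply: eq_bigr => j _; rewrite dmulZ dmul_ddelta.
have -> : \sum_(j < n) d j *: jetmul j (fun k => cderive k fm xi) xi = dmul sfm S2.
  by rewrite dE dmul_sum; apply: eq_bigr => j _; rewrite dmulZ dmul_ddelta.
have -> : (fun x => pc xi fm fp x * pc xi gm gp x) =
    pc xi (fun x => fm x * gm x) (fun x => fp x * gp x).
  by apply/funext => x; exact: pcM.
by [].
Qed.

Section leibniz.
Variables (m : nat) (fm fp : R -> R[i]) (S : functional R).
Hypotheses (sm : smooth fm) (sp : smooth fp) (sS : delta_span m xi S).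
Variables (n : nat) (g : R -> R[i]).
Hypothesis pg : piecewise_smooth g.

Let a := reg (pc xi fm fp) + S.
Let phi := ddern n (reg g).

Lemma ddern_singular i : exists gm gp m' S', [/\ smooth gm, smooth gp, delta_span m' xi S' &
  ddern i a = reg (pc xi gm gp) + S'].
Proof.
elim: i => [|i [gm [gp [m' [S' [s1 s2 s3 E]]]]]]; first by exists fm, fp, m, S.
have [S'' sS'' E'] := dderive_singular s1 s2 s3.
exists (cderive 1 gm), (cderive 1 gp), m'.+1, S''; split.
- exact: smooth_cderiven.
- exact: smooth_cderiven.
- exact: sS''.
- by rewrite ddernS E.
Qed.

(** Both products on the right exist by [is_star_singular_left], whatever the singularities of
    [phi]; the product rule then identifies the third. *)
Lemma star_leibniz_left i k : star (ddern i a) (ddern k.+1 phi) =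
  dderive (star (ddern i a) (ddern k phi)) - star (ddern i.+1 a) (ddern k phi).
Proof.
have [gm [gp [m' [S' [s1 s2 s3 E]]]]] := ddern_singular i.
have [S'' sS'' E'] := dderive_singular s1 s2 s3.
have lphi : linear (ddern k phi).
  rewrite /phi ddern_add; apply: ddern_linear.
  exact/reg_linear/locb_piecewise_smooth.
have [P [sP _ _]] := is_star_singular_left (k + n) pg s1 s2 s3.
have [P1 [sP1 _ _]] := is_star_singular_left (k + n) pg
   (smooth_cderiven 1 s1) (smooth_cderiven 1 s2) sS''.
rewrite -E -ddern_add -/phi in sP; rewrite -E' -E -ddernS -ddern_add -/phi in sP1.
have la : linear (ddern i a) by rewrite E; exact: singular_linear s3.
rewrite (star_eq la lphi sP) (star_eq (dderive_linear la) lphi sP1).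
apply: star_eq => //; first exact: dderive_linear.
exact: is_star_leibniz.
Qed.

Lemma star_leibniz_right i k : star (ddern k.+1 phi) (ddern i a) =
  dderive (star (ddern k phi) (ddern i a)) - star (ddern k phi) (ddern i.+1 a).
Proof.
have [gm [gp [m' [S' [s1 s2 s3 E]]]]] := ddern_singular i.
have [S'' sS'' E'] := dderive_singular s1 s2 s3.
have lphi : linear (ddern k phi).
  rewrite /phi ddern_add; apply: ddern_linear.
  exact/reg_linear/locb_piecewise_smooth.
have [P [sP _ _]] := is_star_singular_right (k + n) pg s1 s2 s3.
have [P1 [sP1 _ _]] := is_star_singular_right (k + n) pg
   (smooth_cderiven 1 s1) (smooth_cderiven 1 s2) sS''.
rewrite -E -ddern_add -/phi in sP; rewrite -E' -E -ddernS -ddern_add -/phi in sP1.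
have la : linear (ddern i a) by rewrite E; exact: singular_linear s3.
rewrite (star_eq lphi la sP) (star_eq lphi (dderive_linear la) sP1).
apply: star_eq => //; first exact: dderive_linear.
exact: is_star_leibniz_r.
Qed.

Lemma star_left_on k : deq_on Om (star a (ddern k phi)) (dmul sm (ddern k phi)) /\
  deq_on Op (star a (ddern k phi)) (dmul sp (ddern k phi)).
Proof.
have [P [sP Pm Pp]] := is_star_singular_left (k + n) pg sm sp sS.
rewrite -ddern_add -/phi -/a in sP Pm Pp.
rewrite (star_eq _ _ sP) //; first exact: singular_linear sS.
by rewrite /phi ddern_add; apply: ddern_linear; exact/reg_linear/locb_piecewise_smooth.
Qed.

Lemma star_right_on k : deq_on Om (star (ddern k phi) a) (dmul sm (ddern k phi)) /\
  deq_on Op (star (ddern k phi) a) (dmul sp (ddern k phi)).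
Proof.
have [P [sP Pm Pp]] := is_star_singular_right (k + n) pg sm sp sS.
rewrite -ddern_add -/phi -/a in sP Pm Pp.
rewrite (star_eq _ _ sP) //; last exact: singular_linear sS.
by rewrite /phi ddern_add; apply: ddern_linear; exact/reg_linear/locb_piecewise_smooth.
Qed.

(** Substituting the product rule into [a * phi''''], [a * phi'''] and [a' * phi'''] makes every
    term except the second derivative cancel: the binomial sum is the expansion of
    [D^2 (a * phi'')]. *)
Lemma star_leibniz2_left :
  \sum_(i < 3) 'C(2, i)%:R *: star (ddern i a) (ddern (4 - i) phi) =
  ddern 2 (star a (ddern 2 phi)).
Proof.
rewrite !big_ord_recl big_ord0 /= /bump /= !addn0 addr0 bin0 bin1 binn !scale1r.
have E1 : star (ddern 1 a) (ddern 3 phi) = _ := star_leibniz_left 1 2.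
have E2 : star a (ddern 3 phi) = _ := star_leibniz_left 0 2.
have E3 : star a (ddern 4 phi) = _ := star_leibniz_left 0 3.
change (star a (ddern 4 phi) + (2 *: star (ddern 1 a) (ddern 3 phi) +
  star (ddern 2 a) (ddern 2 phi)) = dderive (dderive (star a (ddern 2 phi)))).
rewrite E3 -[ddern 0 a]/a E2 E1 -[ddern 0 a]/a dderiveD dderiveN.
apply/funext => psi; rewrite !fctE /GRing.scale /=; ring.
Qed.

Lemma star_leibniz2_right :
  \sum_(i < 3) 'C(2, i)%:R *: star (ddern (4 - i) phi) (ddern i a) =
  ddern 2 (star (ddern 2 phi) a).
Proof.
rewrite !big_ord_recl big_ord0 /= /bump /= !addn0 addr0 bin0 bin1 binn !scale1r.
have E1 : star (ddern 3 phi) (ddern 1 a) = _ := star_leibniz_right 1 2.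
have E2 : star (ddern 3 phi) a = _ := star_leibniz_right 0 2.
have E3 : star (ddern 4 phi) a = _ := star_leibniz_right 0 3.
change (star (ddern 4 phi) a + (2 *: star (ddern 3 phi) (ddern 1 a) +
  star (ddern 2 phi) (ddern 2 a)) = dderive (dderive (star (ddern 2 phi) a))).
rewrite E3 -[ddern 0 a]/a E2 E1 -[ddern 0 a]/a dderiveD dderiveN.
apply/funext => psi; rewrite !fctE /GRing.scale /=; ring.
Qed.

End leibniz.
End star_singular.

(** * Linear differential equations *)

Section primitive.
Context {R : realType}.
Local Notation mu := (@lebesgue_measure R).
Implicit Types (f F G g : R -> R).

Definition primitive_of F f : Prop := forall x : R, is_derive x 1 F (f x).

Lemma exists_primitive f (x0 : R) : continuous f ->
  exists2 F, F x0 = 0 & primitive_of F f.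
Proof.
move=> cf.
pose I (a b : R) := Rintegral mu [set` Interval (BRight a) (BRight b)] f.
have itf a b : mu.-integrable [set` Interval (BRight a) (BRight b)] (EFin \o f).
  have : mu.-integrable [set` `[a, b]] (EFin \o f).
    apply: continuous_compact_integrable; first exact: segment_compact.
    exact: continuous_subspaceT.
  by apply: integrableS => //; apply: subset_itvr; rewrite bnd_simp.
pose F x := if x0 <= x then I x0 x else - I x x0.
(* Integrals from a base point are differentiable only to its right. Rebasing at some [c] to the
   left of both [x0] and [x] changes [F] by a constant and gives the derivative at [x]. *)
have FE c x : c <= x0 -> c <= x -> F x = I c x - I c x0.
  move=> c0 cx; rewrite /F; case: leP => h.
    by rewrite /I Rintegral_itvB.
  by rewrite /I -opprB Rintegral_itvB // bnd_simp ltW.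
exists F; first by rewrite (FE x0) ?subrr.
move=> x; pose c := Num.min x x0 - 1.
have cx : c < x by rewrite /c ltrBlDr ltr_pwDr // ge_min lexx.
have c0 : c < x0 by rewrite /c ltrBlDr ltr_pwDr // ge_min lexx orbT.
have xx1 : x < x + 1 by rewrite ltrDl.
have [|dI IE] := @continuous_FTC1 _ f (BRight c) x (x + 1) xx1 (itf _ _) _ (cf x).
  exact: cx.
have H : is_derive x 1 (fun y => I c y - I c x0) (f x).
  have d1 : is_derive x 1 (I c) (f x).
    by apply: DeriveDef; [exact: dI|rewrite -derive1E].
  by apply: is_derive_eq; rewrite subr0.
apply: near_eq_is_derive H.
apply: (near_open (@open_gt R c) cx) => y /= cy.
by rewrite (FE c) // ltW.
Qed.

Lemma ge0_derive_le F f (a b : R) : primitive_of F f ->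
  (forall t, a <= t <= b -> 0 <= f t) -> a <= b -> F a <= F b.
Proof.
move=> dF f0 ab.
have [|c cab E] := @MVT_segment R F f a b ab (fun t _ => dF t).
  apply: continuous_subspaceT => t.
  by apply/differentiable_continuous/derivable1_diffP; case: (dF t).
rewrite -subr_ge0 E mulr_ge0 ?subr_ge0 //; apply: f0.
by move: cab; rewrite in_itv.
Qed.

(** [G + F] and [G - F] are monotone from [x0], increasing to the right and decreasing to the left,
    and vanish at [x0]. *)
Lemma derive_majorant F f G g (x0 x : R) : primitive_of F f ->
  primitive_of G g -> F x0 = 0 -> G x0 = 0 ->
  (x0 <= x /\ forall t, x0 <= t <= x -> `|f t| <= g t) \/
  (x <= x0 /\ forall t, x <= t <= x0 -> `|f t| <= - g t) ->
  `|F x| <= G x.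
Proof.
move=> dF dG F0 G0 H.
have dD (t : R) : is_derive t 1 (fun y => G y - F y) (g t - f t) by exact: is_deriveB.
have dS (t : R) : is_derive t 1 (fun y => G y + F y) (g t + f t) by exact: is_deriveD.
have dD' (t : R) : is_derive t 1 (fun y => - (G y - F y)) (- (g t - f t)) by exact: is_deriveN.
have dS' (t : R) : is_derive t 1 (fun y => - (G y + F y)) (- (g t + f t)) by exact: is_deriveN.
rewrite ler_norml; case: H => -[xx fg].
- have h1 := ge0_derive_le dD _ xx; have h2 := ge0_derive_le dS _ xx.
  rewrite /= F0 G0 subr0 addr0 in h1 h2.
  apply/andP; split.
    rewrite -subr_ge0 opprK addrC; apply: h2 => t /fg; rewrite ler_norml => /andP[]; lra.
  by rewrite -subr_ge0; apply: h1 => t /fg; rewrite ler_norml => /andP[]; lra.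
- have h1 := ge0_derive_le dD' _ xx; have h2 := ge0_derive_le dS' _ xx.
  rewrite /= F0 G0 subr0 addr0 oppr0 !oppr_le0 in h1 h2.
  apply/andP; split.
    rewrite -subr_ge0 opprK addrC; apply: h2 => t /fg; rewrite ler_norml => /andP[]; lra.
  by rewrite -subr_ge0; apply: h1 => t /fg; rewrite ler_norml => /andP[]; lra.
Qed.

Lemma is_derive_pow (x0 B : R) n (t : R) :
  is_derive t 1 (fun y => B * (y - x0) ^+ n.+1 / n.+1%:R) (B * (t - x0) ^+ n).
Proof.
have d1 : is_derive t 1 (fun y : R => y - x0) 1 by apply: is_derive_eq; rewrite subr0.
have d2 := @is_deriveX _ _ (fun y : R => y - x0) n.+1 t 1 1 d1.
have d3 := @is_deriveZ _ _ _ _ (B / n.+1%:R) t 1 _ d2.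
have -> : (fun y => B * (y - x0) ^+ n.+1 / n.+1%:R) =
    (B / n.+1%:R) \*: ((fun y : R => y - x0) ^+ n.+1).
  by apply/funext => y; rewrite /= fctE mulrAC.
apply: is_derive_eq; rewrite /GRing.scale /= mulr1.
by rewrite mulrA divfK // pnatr_eq0.
Qed.

Lemma primitive_pow_le F f (x0 B M : R) n : primitive_of F f ->
  F x0 = 0 -> (forall t, `|t - x0| <= M -> `|f t| <= B * `|t - x0| ^+ n) ->
  forall x, `|x - x0| <= M -> `|F x| <= B * `|x - x0| ^+ n.+1 / n.+1%:R.
Proof.
move=> dF F0 fB x xM; have [xx|xx] := leP x0 x.
  rewrite [`|x - x0|]ger0_norm ?subr_ge0 //.
  apply: (derive_majorant dF (is_derive_pow x0 B n) F0) => //=.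
    by rewrite subrr expr0n mulr0 mul0r.
  left; split=> // t /andP[t1 t2].
  have e : `|t - x0| = t - x0 by rewrite ger0_norm ?subr_ge0.
  rewrite -[X in _ <= _ * X ^+ _]e; apply: fB.
  by apply: le_trans xM; rewrite e ger0_norm ?subr_ge0 // lerD2r.
rewrite [`|x - x0|]ltr0_norm ?subr_lt0 // opprB.
(* To the left of [x0] the majorant must be a differentiable primitive, so the power of [|t - x0|]
   is written as a signed power of [t - x0]. *)
pose s : R := (-1) ^+ n.+1.
have ss : s * s = 1 by rewrite /s -expr2 sqrr_sign.
have E y k : (x0 - y) ^+ k = (-1) ^+ k * (y - x0) ^+ k :> R by rewrite -exprMn mulN1r opprB.
have -> : B * (x0 - x) ^+ n.+1 / n.+1%:R = (B * s) * (x - x0) ^+ n.+1 / n.+1%:R.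
  by rewrite E mulrA.
apply: (derive_majorant dF (is_derive_pow x0 (B * s) n) F0) => //=.
  by rewrite subrr expr0n mulr0 mul0r.
right; split; first exact: ltW.
move=> t /andP[t1 t2].
have e : `|t - x0| = x0 - t by rewrite distrC ger0_norm ?subr_ge0.
have -> : - (B * s * (t - x0) ^+ n) = B * `|t - x0| ^+ n.
  by rewrite e E /s exprS; ring.
apply: fB; rewrite e; apply: le_trans xM.
by rewrite distrC ger0_norm ?subr_ge0 ?lerD2l ?lerN2 // ltW.
Qed.

End primitive.

(** * Picard iteration for real linear systems *)

Section picard.
Context {R : realType}.
Variables (I : finType) (A : I -> I -> R -> R) (x0 : R) (y0 : I -> R).
Hypothesis cA : forall i j, continuous (A i j).

(** A total primitive operator, with default 0 when no primitive exists; it is meaningful on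
    continuous functions only, which is why continuity is established before each use. *)
Let prim (f : R -> R) : R -> R := xget (fun=> 0) [set F | F x0 = 0 /\ primitive_of F f].

Let primP f : continuous f -> prim f x0 = 0 /\ primitive_of (prim f) f.
Proof.
move=> cf; have [F F0 dF] := exists_primitive x0 cf.
by rewrite /prim; case: xgetP => [G _ []//|/(_ F)]; case.
Qed.

Let primitive_continuous (F f : R -> R) : primitive_of F f -> continuous F.
Proof. by move=> dF x; apply/differentiable_continuous/derivable1_diffP; case: (dF x). Qed.

Let rhs (y : I -> R -> R) (i : I) (x : R) : R := \sum_j A i j x * y j x.

Let crhs y i : (forall j, continuous (y j)) -> continuous (rhs y i).
Proof.
move=> cy; rewrite /rhs; elim: (index_enum I) => [|j r IH] x.
  rewrite /continuous_at big_nil; under eq_fun do rewrite big_nil; exact: cvg_cst.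
rewrite /continuous_at big_cons; under eq_fun do rewrite big_cons.
apply: cvgD; last exact: IH.
by apply: cvgM; [exact: cA|exact: cy].
Qed.

(** These are the increments: [u n.+1] integrates [A (u n)] from [x0], and the Picard iterates are
    the partial sums [S]. Linearity turns their convergence into that of a series. *)
Fixpoint picard_term (n : nat) : I -> R -> R :=
  if n is n'.+1 then fun i => prim (rhs (picard_term n') i) else fun i => cst (y0 i).

Let u := picard_term.

Let cu n i : continuous (u n i).
Proof.
elim: n i => [|n IH] i; first exact: cst_continuous.
by have [_ d] := primP (@crhs _ i IH); exact: primitive_continuous d.
Qed.

Let duS n i : primitive_of (u n.+1 i) (rhs (u n) i).
Proof. by have [_ d] := primP (@crhs _ i (@cu n)); exact: d. Qed.

Let uS0 n i : u n.+1 i x0 = 0.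
Proof. by have [] := primP (@crhs _ i (@cu n)). Qed.

Let S (N : nat) (i : I) (x : R) : R := \sum_(k < N) u k i x.

Let SS N i x : S N.+1 i x = S N i x + u N i x.
Proof. by rewrite /S big_ord_recr. Qed.

Let dS N i : primitive_of (S N.+1 i) (rhs (S N) i).
Proof.
elim: N => [|N IH] x.
  have -> : S 1 i = cst (y0 i) by apply/funext => y; rewrite SS /S big_ord0 add0r.
  have -> : rhs (S 0) i x = 0.
    by rewrite /rhs big1 // => j _; rewrite /S big_ord0 mulr0.
  exact: is_derive_cst.
have -> : S N.+2 i = S N.+1 i + u N.+1 i by apply/funext => y; rewrite SS fctE.
have -> : rhs (S N.+1) i x = rhs (S N) i x + rhs (u N) i x.
  by rewrite /rhs -big_split; apply: eq_bigr => j _; rewrite SS mulrDr.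
by apply: is_deriveD; [exact: IH|exact: duS].
Qed.

Let S0 N i : S N.+1 i x0 = y0 i.
Proof. by elim: N => [|N IH]; rewrite SS ?IH ?uS0 ?addr0 // /S big_ord0 add0r. Qed.

Let s (i : I) (x : R) : R := limn (fun N => S N i x).

Section bounds.
Variable M : R.
Hypothesis M0 : 0 <= M.

Let bound_rhs : exists2 K : R, 0 <= K & forall y i x (C : R), `|x - x0| <= M ->
  (forall j, `|y j x| <= C) -> `|rhs y i x| <= K * C.
Proof.
have H i j : exists C : R, forall x, `|x - x0| <= M -> `|A i j x| <= C.
  have [_ /(_ (`|x0| + M))[C HC]] := rlocb_continuous (@cA i j).
  exists C => x xM; apply: HC; rewrite -[x](subrK x0) (le_trans (ler_normD _ _)) //.
  by rewrite addrC lerD2l.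
have /choice[c Hc] : forall p : I * I, exists C : R, forall x, `|x - x0| <= M ->
    `|A p.1 p.2 x| <= C by move=> p; exact: H.
pose a : R := \sum_p `|c p|.
have a0 : 0 <= a by apply: sumr_ge0.
have Aa i j x : `|x - x0| <= M -> `|A i j x| <= a.
  move=> xM; apply: (le_trans (Hc (i, j) x xM)); apply: (le_trans (ler_norm _)).
  by rewrite /a (bigD1 (i, j)) //= lerDl sumr_ge0.
exists (#|I|%:R * a); first by rewrite mulr_ge0.
move=> y i x C xM yC; rewrite /rhs (le_trans (ler_norm_sum _ _ _)) //.
have -> : #|I|%:R * a * C = \sum_(j : I) a * C by rewrite sumr_const mulr_natl mulrnAl.
by apply: ler_sum => j _; rewrite normrM ler_pM // Aa.
Qed.

(** The exponential majorant. The induction carries the finer bound with [|x - x0|^n] in place of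
    [M^n], since that is what gains the [1 / n.+1] on integrating. *)
Let majorant : exists K C0 : R, [/\ 0 <= K, 0 <= C0,
  forall y i x (C : R), `|x - x0| <= M -> (forall j, `|y j x| <= C) -> `|rhs y i x| <= K * C &
  forall n i x, `|x - x0| <= M -> `|u n i x| <= C0 * exp_coeff (K * M) n].
Proof.
have [K K0 HK] := bound_rhs; pose C0 : R := \sum_i `|y0 i|; exists K, C0.
have C00 : 0 <= C0 by apply: sumr_ge0.
split=> // n i x xM.
have B : forall i x, `|x - x0| <= M -> `|u n i x| <= C0 * K ^+ n / n`!%:R * `|x - x0| ^+ n.
  elim: n {i x xM} => [|n IH] i x xM.
    by rewrite fact0 !expr0 divr1 !mulr1 /C0 (bigD1 i) //= lerDl sumr_ge0.
  have := @primitive_pow_le _ _ _ x0 (C0 * K ^+ n.+1 / n`!%:R) M n (duS n i) (uS0 n i) _ x xM.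
  rewrite factS natrM invfM exprS => P.
  have -> : C0 * (K * K ^+ n) * (n.+1%:R^-1 * n`!%:R^-1) * (`|x - x0| ^+ n.+1) =
    C0 * (K * K ^+ n) / n`!%:R * `|x - x0| ^+ n.+1 / n.+1%:R by ring.
  apply: P => t tM; have := HK (u n) i t _ tM (fun j => IH j t tM).
  by move=> h; apply: (le_trans h); rewrite le_eqVlt; apply/orP; left; apply/eqP; ring.
apply: (le_trans (B i x xM)); rewrite /exp_coeff /= exprMn -!mulrA ler_wpM2l //.
rewrite ler_wpM2l ?exprn_ge0 // mulrC ler_wpM2r ?invr_ge0 ?ler0n //.
by rewrite lerXn2r ?nnegrE ?normr_ge0.
Qed.

(** [T] is the sequence of partial sums of the exponential majorant and [L] its limit: the tail
    [L - T N] controls the distance to the limit uniformly for [|x - x0| <= M], and the mean value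
    theorem gives a common Lipschitz constant. *)
Let limits : exists L : R, exists T : nat -> R, exists K : R, [/\ [/\ 0 <= K, 0 <= L & forall i x, `|x - x0| <= M -> S N i x @[N --> \oo] --> s i x],
  T n @[n --> \oo] --> L,
  forall N i x, `|x - x0| <= M -> `|s i x - S N i x| <= L - T N,
  (forall i x y, `|x - x0| <= M -> `|y - x0| <= M -> `|s i x - s i y| <= K * L * `|x - y|) &
  forall y i x (C : R), `|x - x0| <= M -> (forall j, `|y j x| <= C) -> `|rhs y i x| <= K * C].
Proof.
have [K [C0 [K0 C00 HK Hu]]] := majorant.
pose b n : R := C0 * exp_coeff (K * M) n.
have b0 n : 0 <= b n by rewrite mulr_ge0 // exp_coeff_ge0 // mulr_ge0.
pose T n : R := \sum_(k < n) b k.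
have TE : T = series b by apply/funext => n; rewrite /T /series /= big_mkord.
have cb : cvgn (series b).
  by apply: is_cvg_seriesZ; exact: is_cvg_series_exp_coeff.
pose L : R := limn T.
have cT : T n @[n --> \oo] --> L by rewrite /L TE.
have ndT : nondecreasing_seq T.
  by apply/nondecreasing_seqP => n; rewrite /T big_ord_recr lerDl.
have TL n : T n <= L by apply: nondecreasing_cvgn_le => //; rewrite TE.
have SE i x : (fun N => S N i x) = series (fun k => u k i x).
  by apply/funext => N; rewrite /S /series /= big_mkord.
have cS i x : `|x - x0| <= M -> S N i x @[N --> \oo] --> s i x.
  move=> xM; rewrite /s SE; apply: normed_cvg.
  apply: (@series_le_cvg _ (fun k => `|u k i x|) b _ b0 _ cb) => n //.
  exact: Hu.
have dist i x N m : `|x - x0| <= M -> (N <= m)%N -> `|S m i x - S N i x| <= T m - T N.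
  move=> xM; elim: m => [|m IH]; first by rewrite leqn0 => /eqP ->; rewrite !subrr normr0.
  rewrite leq_eqVlt => /orP[/eqP ->|]; first by rewrite !subrr normr0.
  rewrite ltnS => /IH h; rewrite SS /T big_ord_recr /= -/(T m).
  rewrite addrAC [leRHS]addrAC (le_trans (ler_normD _ _)) // lerD //; exact: Hu.
have lip N i x y : `|x - x0| <= M -> `|y - x0| <= M ->
    `|S N i x - S N i y| <= K * L * `|x - y|.
  move=> xM yM.
  have [->|N0] := eqVneq N 0%N.
    rewrite /S !big_ord0 subrr normr0 mulr_ge0 // mulr_ge0 //.
    by apply: le_trans (TL 0%N); rewrite /T big_ord0.
  case: N N0 => // N _.
  wlog xy : x y xM yM / x <= y.
    move=> h; have [xy|/ltW xy] := leP x y; first exact: h.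
    by rewrite distrC [`|x - y|]distrC; exact: h.
  have [|c cxy E] := @MVT_segment R (S N.+1 i) (rhs (S N) i) x y xy (fun t _ => dS N i t).
    by apply: continuous_subspaceT; exact: primitive_continuous (dS N i).
  rewrite distrC E normrM [`|y - x|]distrC ler_wpM2r // HK //.
    move: cxy xM yM; rewrite in_itv /= !ler_norml => /andP[? ?] /andP[? ?] /andP[? ?].
    by apply/andP; split; lra.
  move=> j; have cM : `|c - x0| <= M.
    move: cxy xM yM; rewrite in_itv /= !ler_norml => /andP[? ?] /andP[? ?] /andP[? ?].
    by apply/andP; split; lra.
  have := dist j c 0%N N cM (leq0n _).
  rewrite {2}/S {2}/T !big_ord0 !subr0 => /le_trans; apply; exact: TL.
exists L, T, K; split=> //.
- by split=> //; apply: le_trans (TL 0%N); rewrite /T big_ord0.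
- move=> N i x xM.
  apply: (@ler_cvg_to _ \oo _ _ (fun m => `|S m i x - S N i x|) (cst (L - T N))).
  + by apply: cvg_norm; apply: cvgB; [exact: cS|exact: cvg_cst].
  + exact: cvg_cst.
  + near=> m; apply: (le_trans (dist i x N m xM _)); last by rewrite lerD2r.
    by near: m; exact: nbhs_infty_ge.
- move=> i x y xM yM.
  apply: (@ler_cvg_to _ \oo _ _ (fun m => `|S m i x - S m i y|) (cst (K * L * `|x - y|))).
  + by apply: cvg_norm; apply: cvgB; exact: cS.
  + exact: cvg_cst.
  + by apply: nearW => m; exact: lip.
Unshelve. all: by end_near. Qed.

Lemma picard_lip : exists L : R, 0 <= L /\
  forall i x y, `|x - x0| <= M -> `|y - x0| <= M -> `|s i x - s i y| <= L * `|x - y|.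
Proof.
have [L [T [K [[K0 L0 _] _ _ H _]]]] := limits; exists (K * L); split=> //.
exact: mulr_ge0.
Qed.

Hypothesis cs : forall i, continuous (s i).

(** The iterate [S N.+1] minus the right-hand side vanishes at [x0] and has derivative
    [A (S N - s)], of size at most [K (L - T N)]; so both sides are limits of [S N.+1]. Continuity
    of [s], obtained from [picard_lip], gives [prim] its meaning. *)
Lemma picard_fixpoint i x : `|x - x0| <= M -> s i x = y0 i + prim (rhs s i) x.
Proof.
move=> xM; have [L [T [K [[K0 L0 cS] cT HsS _ HK]]]] := limits.
have [p0 dp] := primP (@crhs _ i cs).
have near_z N : `|S N.+1 i x - (y0 i + prim (rhs s i) x)| <= K * (L - T N) * `|x - x0|.
  pose D y := S N.+1 i y - (y0 i + prim (rhs s i) y).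
  have dD : primitive_of D (fun y => rhs (S N) i y - rhs s i y).
    move=> y; apply: is_deriveB; first exact: dS.
    have d0 : is_derive y 1 (cst (y0 i) + prim (rhs s i)) (0 + rhs s i y).
      by apply: is_deriveD; exact: dp.
    by rewrite add0r in d0.
  have D0 : D x0 = 0 by rewrite /D S0 p0 addr0 subrr.
  have := @primitive_pow_le _ _ _ x0 (K * (L - T N)) M 0 dD D0 _ x xM.
  rewrite expr1 divr1; apply => t tM; rewrite expr0 mulr1.
  have -> : rhs (S N) i t - rhs s i t = rhs (fun j y => S N j y - s j y) i t.
    by rewrite /rhs -sumrB; apply: eq_bigr => j _; rewrite mulrBr.
  by apply: HK => // j; rewrite distrC; exact: HsS.
have c1 : S N.+1 i x @[N --> \oo] --> s i x.
  by have := cS i x xM; rewrite -(@cvg_shiftS _ (fun N => S N i x)).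
have c2 : S N.+1 i x @[N --> \oo] --> y0 i + prim (rhs s i) x.
  apply/cvgrPdist_le => e e0.
  have c3 : K * (L - T N) * `|x - x0| @[N --> \oo] --> K * (L - L) * `|x - x0|.
    apply: cvgM; last exact: cvg_cst.
    by apply: cvgM; [exact: cvg_cst|apply: cvgB => //; exact: cvg_cst].
  rewrite subrr mulr0 mul0r in c3.
  move/cvgrPdist_le : c3 => /(_ e e0); apply: filterS => N.
  rewrite sub0r normrN => h; rewrite distrC; apply: (le_trans (near_z N)).
  exact: le_trans (ler_norm _) h.
exact: cvg_unique c1 c2.
Qed.

End bounds.

Lemma linear_ode_exists : exists y : I -> R -> R, (forall i, y i x0 = y0 i) /\
  forall i, primitive_of (y i) (fun x => \sum_j A i j x * y j x).
Proof.
have cs i : continuous (s i).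
  (* One unit more than the distance to [x0] leaves room for the neighbours of [x] within distance
     1. *)
  move=> x; pose M := `|x - x0| + 1.
  have M0 : 0 <= M by rewrite addr_ge0.
  have [L [L0 HL]] := picard_lip M0.
  apply/cvgrPdist_le => e e0.
  have xM : `|x - x0| <= M by rewrite lerDl.
  have L1 : 0 < L + 1 by rewrite ltr_wpDl.
  near=> y; have yx : `|x - y| <= Num.min 1 (e / (L + 1)).
    near: y; apply: cvgr_dist_le; first exact: cvg_id.
    by rewrite lt_min ltr01 divr_gt0.
  rewrite le_min in yx; have /andP[y1 y2] := yx.
  apply: (le_trans (HL i x y xM _)).
    have -> : y - x0 = (x - x0) - (x - y) by ring.
    by apply: (le_trans (ler_normB _ _)); rewrite lerD2l.
  move: y2; rewrite ler_pdivlMr // mulrC; apply: le_trans.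
  by rewrite ler_wpM2r // lerDl.
have E i : s i = fun x => y0 i + prim (rhs s i) x.
  apply/funext => x; apply: (@picard_fixpoint (`|x - x0|)) => //.
exists s; split=> i.
  by rewrite E; have [-> _] := primP (@crhs _ i cs); rewrite addr0.
move=> x; have [_ dp] := primP (@crhs _ i cs).
have d0 : is_derive x 1 (cst (y0 i) + prim (rhs s i)) (0 + rhs s i x).
  by apply: is_deriveD; exact: dp.
by rewrite add0r in d0; rewrite {1}E.
Unshelve. all: by end_near. Qed.

End picard.

(** * Complex linear systems with smooth coefficients *)

Section complex_ode.
Context {R : realType}.
Implicit Types (f g h : R -> R[i]) (psi : testfun R) (U : set R).

Lemma kderivable_sum (I : Type) (r : seq I) n (f : I -> R -> R) :
  (forall i, kderivable n (f i)) -> kderivable n (fun x => \sum_(i <- r) f i x).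
Proof.
move=> kf; elim: r => [|i r IH].
  have -> : (fun x => \sum_(i <- [::]) f i x) = cst 0.
    by apply/funext => x; rewrite big_nil.
  by move=> k x _; rewrite derive1n_cst0; exact: derivable_cst.
have -> : (fun x => \sum_(i <- i :: r) f i x) = f i \+ (fun x => \sum_(i <- r) f i x).
  by apply/funext => x; rewrite big_cons.
exact: (kderivableD (kf i) IH).
Qed.

Lemma rsmooth_primitive (F f : R -> R) : primitive_of F f -> rsmooth f -> rsmooth F.
Proof.
move=> dF sf [|n] x; first by case: (dF x).
rewrite derive1Sn; have -> : derive1 F = f.
  by apply/funext => y; rewrite derive1E; case: (dF y).
exact: sf.
Qed.

Lemma cderive_primitive (Fr Fi : R -> R) f :
  primitive_of Fr (cRe \o f) -> primitive_of Fi (cIm \o f) ->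
  forall x, cderive 1 (fun x => Fr x +i* Fi x) x = f x.
Proof.
move=> dr di x; rewrite /cderive /= !derive1E.
have -> : cRe \o (fun x => Fr x +i* Fi x) = Fr by [].
have -> : cIm \o (fun x => Fr x +i* Fi x) = Fi by [].
by case: (dr x) => _ ->; case: (di x) => _ -> /=; case: (f x).
Qed.

Lemma exists_cprimitive f (x0 : R) : smooth f ->
  exists2 F, smooth F & F x0 = 0 /\ forall x, cderive 1 F x = f x.
Proof.
move=> sf; have [cr ci] := smooth_continuous sf; have [sr si] := sf.
have [Fr r0 dr] := exists_primitive x0 cr; have [Fi i0 di] := exists_primitive x0 ci.
exists (fun x => Fr x +i* Fi x).
  by split; [exact: (rsmooth_primitive dr sr)|exact: (rsmooth_primitive di si)].
by split; [rewrite r0 i0|exact: cderive_primitive].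
Qed.

Lemma cderive_eq0_cst f : smooth f -> (forall x, cderive 1 f x = 0) ->
  forall x y, f x = f y.
Proof.
move=> [sr si] d0 x y.
have dr (z : R) : is_derive z 1 (cRe \o f) (0 : R).
  apply: DeriveDef; first exact: (sr 0%N).
  by rewrite -derive1E; have := congr1 cRe (d0 z).
have di (z : R) : is_derive z 1 (cIm \o f) (0 : R).
  apply: DeriveDef; first exact: (si 0%N).
  by rewrite -derive1E; have := congr1 cIm (d0 z).
apply: complex_eq.
- exact: (is_derive_0_is_cst x y dr).
- exact: (is_derive_0_is_cst x y di).
Qed.

Lemma smooth_sum (I : Type) (r : seq I) (f : I -> R -> R[i]) :
  (forall i, smooth (f i)) -> smooth (fun x => \sum_(i <- r) f i x).
Proof.
move=> sf; elim: r => [|i r IH].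
  have -> : (fun x => \sum_(i <- [::]) f i x) = cst 0.
    by apply/funext => x; rewrite big_nil.
  exact: smooth_cst.
have -> : (fun x => \sum_(i <- i :: r) f i x) = (fun x => f i x + \sum_(i <- r) f i x).
  by apply/funext => x; rewrite big_cons.
exact: (smoothDp (sf i) IH).
Qed.

Lemma cderive1_sum (I : Type) (r : seq I) (f : I -> R -> R[i]) x :
  (forall i, smooth (f i)) ->
  cderive 1 (fun x => \sum_(i <- r) f i x) x = \sum_(i <- r) cderive 1 (f i) x.
Proof.
move=> sf; elim: r => [|i r IH].
  have -> : (fun x => \sum_(i <- [::]) f i x) = cst 0.
    by apply/funext => y; rewrite big_nil.
  by rewrite big_nil cderive_cst.
have -> : (fun x => \sum_(i <- i :: r) f i x) = (fun x => f i x + \sum_(i <- r) f i x).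
  by apply/funext => y; rewrite big_cons.
rewrite cderive1D; [|exact: smooth_cderivable|exact/smooth_cderivable/smooth_sum].
by rewrite big_cons IH.
Qed.

Lemma cderive1_mul f g x : smooth f -> smooth g ->
  cderive 1 (fun y => f y * g y) x = cderive 1 f x * g x + f x * cderive 1 g x.
Proof.
by move=> sf sg; rewrite cderive1M //; apply: smooth_cderivable; [exact: sf|exact: sg].
Qed.

(** The real system for the real parts ([false]) and imaginary parts ([true]), with [B] the matrix
    of multiplication by [A]. Smoothness bootstraps: each derivative of a solution is a sum of
    products of entries of [B] and solutions. *)
Lemma clinear_ode_exists n (A : 'I_n -> 'I_n -> R -> R[i]) (x0 : R) (y0 : 'I_n -> R[i]) :
  (forall i j, smooth (A i j)) ->
  exists y : 'I_n -> R -> R[i], [/\ forall i, smooth (y i), forall i, y i x0 = y0 i &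
    forall i x, cderive 1 (y i) x = \sum_j A i j x * y j x].
Proof.
move=> sA; pose J : finType := ('I_n * bool)%type.
pose B (p q : J) : R -> R := if p.2 == q.2 then cRe \o A p.1 q.1
  else if p.2 then cIm \o A p.1 q.1 else \- (cIm \o A p.1 q.1).
pose z0 (p : J) : R := if p.2 then cIm (y0 p.1) else cRe (y0 p.1).
have sB p q : rsmooth (B p q).
  have [sr si] := sA p.1 q.1; rewrite /B; case: ifP => _; first exact: sr.
  by case: ifP => _; [exact: si|exact: rsmoothN si].
have cB p q : continuous (B p q).
  by move=> x; exact/differentiable_continuous/derivable1_diffP/(sB p q 0%N).
have [z [z0E dz]] := @linear_ode_exists R J B x0 z0 cB.
have zE p : derive1 (z p) = fun x => \sum_q (B p q \* z q) x.
  by apply/funext => x; rewrite derive1E; case: (dz p x).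
have kz m p : kderivable m (z p).
  elim: m p => [//|m IH] p; apply/kderivableS; split=> [x|].
    by case: (dz p x).
  rewrite zE; apply: kderivable_sum => q; apply: kderivableM; last exact: IH.
  exact: ((rsmoothP _).1 (sB p q) m).
have sz p : rsmooth (z p) by apply/rsmoothP => m; exact: kz.
exists (fun i x => z (i, false) x +i* z (i, true) x); split.
- by move=> i; split; exact: sz.
- by move=> i; rewrite !z0E /z0 /=; case: (y0 i).
move=> i x; rewrite /cderive /=.
have -> : cRe \o (fun x => z (i, false) x +i* z (i, true) x) = z (i, false) by [].
have -> : cIm \o (fun x => z (i, false) x +i* z (i, true) x) = z (i, true) by [].
have pairE (F : J -> R) : \sum_q F q = \sum_j (F (j, true) + F (j, false)).
  rewrite (eq_bigr (fun q => F (q.1, q.2))); last by case.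
  by rewrite -(pair_bigA _ (fun j c => F (j, c))) /=; apply: eq_bigr => j _; rewrite big_bool.
rewrite !zE !pairE.
have cRe_sum (F : 'I_n -> R[i]) : cRe (\sum_j F j) = \sum_j cRe (F j).
  by elim/big_rec2: _ => // j a b _ <-; rewrite cReD.
have cIm_sum (F : 'I_n -> R[i]) : cIm (\sum_j F j) = \sum_j cIm (F j).
  by elim/big_rec2: _ => // j a b _ <-; rewrite cImD.
apply: complex_eq; rewrite /= ?cRe_sum ?cIm_sum; apply: eq_bigr => j _.
- by rewrite /B /= cReM /=; ring.
- by rewrite /B /= cImM /=; ring.
Qed.

(** [W] solves [W' = A W] and [V] the adjoint equation [V' = - V A], both from the identity at 0, so
    [V W] has zero derivative. *)
Lemma fundamental_matrix n (A : 'I_n -> 'I_n -> R -> R[i]) :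
  (forall i j, smooth (A i j)) ->
  exists W V : 'I_n -> 'I_n -> R -> R[i],
  [/\ forall i j, smooth (W i j) /\ smooth (V i j),
   forall i k x, cderive 1 (W i k) x = \sum_j A i j x * W j k x,
   forall k j x, cderive 1 (V k j) x = - \sum_l V k l x * A l j x,
   forall i j x, \sum_k W i k x * V k j x = (i == j)%:R &
   forall i j x, \sum_k V i k x * W k j x = (i == j)%:R].
Proof.
move=> sA.
have /choice[w Hw] : forall k : 'I_n, exists y : 'I_n -> R -> R[i],
   [/\ forall i, smooth (y i), forall i, y i 0 = (i == k)%:R &
    forall i x, cderive 1 (y i) x = \sum_j A i j x * y j x].
  by move=> k; exact: clinear_ode_exists.
have sA' i j : smooth (fun x => - A j i x) by exact: smoothNp.
have /choice[v Hv] : forall k : 'I_n, exists y : 'I_n -> R -> R[i],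
   [/\ forall i, smooth (y i), forall i, y i 0 = (k == i)%:R &
    forall i x, cderive 1 (y i) x = \sum_j - A j i x * y j x].
  by move=> k; exact: (@clinear_ode_exists n (fun i j x => - A j i x) 0).
pose W i k := w k i.
have sW i j : smooth (W i j) by have [h _ _] := Hw j; exact: (h i).
have sV i j : smooth (v i j) by have [h _ _] := Hv i; exact: (h j).
have dW i k x : cderive 1 (W i k) x = \sum_j A i j x * W j k x by have [_ _ h] := Hw k; exact: (h i x).
have dV k j x : cderive 1 (v k j) x = - \sum_l v k l x * A l j x.
  have [_ _ ->] := Hv k; rewrite -sumrN; apply: eq_bigr => l _.
  by rewrite mulNr mulrC.
have VW i j x : \sum_k v i k x * W k j x = (i == j)%:R.
  pose G x := \sum_k v i k x * W k j x.
  have sG : smooth G by apply: smooth_sum => k; exact: (smoothM (sV _ _) (sW _ _)).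
  have -> : \sum_k v i k x * W k j x = G x by [].
  rewrite (@cderive_eq0_cst G sG _ x 0).
    rewrite /G (bigD1 i) //= big1 ?addr0.
      have [_ -> _] := Hv i; rewrite /W; have [_ -> _] := Hw j.
      by rewrite eqxx mul1r.
    move=> k /negbTE ki; have [_ -> _] := Hv i.
    by rewrite eq_sym ki mul0r.
  move=> {}x; rewrite /G cderive1_sum; last by move=> k; exact: (smoothM (sV _ _) (sW _ _)).
  rewrite (eq_bigr (fun k => - (\sum_l v i l x * A l k x * W k j x)
                         + \sum_l v i k x * A k l x * W l j x)); last first.
    move=> k _; rewrite (cderive1_mul x (sV i k) (sW k j)).
    rewrite dV dW mulNr mulr_suml mulr_sumr; congr (- _ + _).
    by apply: eq_bigr => l _; rewrite mulrA.
  rewrite big_split /= sumrN exchange_big /= addNr.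
  by [].
exists W, v; split=> // i j x.
pose MV := \matrix_(a < n, b < n) v a b x.
pose MW := \matrix_(a < n, b < n) W a b x.
have : MV *m MW = 1%:M.
  apply/matrixP => a b; rewrite !mxE -[RHS](VW _ _ x).
  by apply: eq_bigr => k _; rewrite !mxE.
(* A left inverse of a square matrix is a right inverse; differentiating [W V] directly would give a
   commutator with [A] instead of 0. *)
move=> /mulmx1C /matrixP /(_ i j); rewrite !mxE => <-.
by apply: eq_bigr => k _; rewrite !mxE.
Qed.

(** [V y] has zero derivative and vanishes at [x0]; multiplying by [W] gives back [y]. *)
Lemma clinear_ode_unique n (A : 'I_n -> 'I_n -> R -> R[i]) (x0 : R)
    (y : 'I_n -> R -> R[i]) : (forall i j, smooth (A i j)) ->
  (forall i, smooth (y i)) -> (forall i, y i x0 = 0) ->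
  (forall i x, cderive 1 (y i) x = \sum_j A i j x * y j x) ->
  forall i x, y i x = 0.
Proof.
move=> sA sy y0 dy i x.
have [W [V [sWV _ dV WV _]]] := fundamental_matrix sA.
pose c k x := \sum_j V k j x * y j x.
have c0 k z : c k z = 0.
  have sc : smooth (c k).
    by apply: smooth_sum => j; exact: (smoothM (sWV k j).2 (sy j)).
  rewrite (@cderive_eq0_cst (c k) sc _ z x0).
    by rewrite /c big1 // => j _; rewrite y0 mulr0.
  move=> t; rewrite /c cderive1_sum; last first.
    by move=> j; exact: (smoothM (sWV k j).2 (sy j)).
  rewrite (eq_bigr (fun j => - (\sum_l V k l t * A l j t * y j t)
                         + \sum_l V k j t * A j l t * y l t)); last first.
    move=> j _; rewrite (cderive1_mul t (sWV k j).2 (sy j)) dV dy mulNr mulr_suml mulr_sumr; congr (- _ + _).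
    by apply: eq_bigr => l _; rewrite mulrA.
  by rewrite big_split /= sumrN exchange_big /= addNr.
have : \sum_k W i k x * c k x = y i x.
  rewrite /c (eq_bigr (fun k => \sum_j W i k x * V k j x * y j x)); last first.
    by move=> k _; rewrite mulr_sumr; apply: eq_bigr => j _; rewrite mulrA.
  rewrite exchange_big /= (eq_bigr (fun j => (i == j)%:R * y j x)); last first.
    by move=> j _; rewrite -mulr_suml WV.
  by rewrite (bigD1 i) //= eqxx mul1r big1 ?addr0 // => j /negbTE ji; rewrite eq_sym ji mul0r.
by move=> <-; rewrite big1 // => k _; rewrite c0 mulr0.
Qed.

End complex_ode.

(** * Distributional solutions are smooth *)

Section distribution_ode.
Context {R : realType}.
Implicit Types (f g h u : R -> R[i]) (psi : testfun R) (U : set R) (F : functional R).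

Lemma cderive_eq0_itv f (a b : R) : smooth f -> a <= b ->
  (forall t, a <= t <= b -> cderive 1 f t = 0) -> f a = f b.
Proof.
move=> [sr si] ab f0.
have part (h : R -> R) : rsmooth h -> (forall t, a <= t <= b -> derive1 h t = 0) -> h a = h b.
  move=> sh h0; have dh : primitive_of h (derive1 h).
    by move=> t; apply: DeriveDef; [exact: (sh 0%N t)|rewrite derive1E].
  have dNh : primitive_of (\- h) (\- derive1 h) by move=> t; exact: is_deriveN.
  apply/eqP; rewrite eq_le; apply/andP; split.
    by apply: (ge0_derive_le dh) => // t /h0 ->.
  rewrite -lerN2; apply: (ge0_derive_le dNh) => // t /h0 /= ->.
  by rewrite oppr0.
apply: complex_eq.
- by apply: (part _ sr) => t /f0 /(congr1 cRe).
- by apply: (part _ si) => t /f0 /(congr1 cIm).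
Qed.

Lemma rint_derive_itv (h : R -> R) (a b : R) : rsmooth h -> a < b ->
  (forall x, x <= a \/ b <= x -> derive1 h x = 0) -> rint (derive1 h) = h b - h a.
Proof.
move=> sh ab h0.
have ch : continuous (derive1 h).
  by move=> x; exact/differentiable_continuous/derivable1_diffP/(sh 1%N).
have dh (x : R) : derivable h x 1 by exact: (sh 0%N x).
rewrite -(rint_segment dh ch ab).
rewrite [RHS]Rintegral_mkcond /rint; congr Rintegral; apply/funext => x.
rewrite patchE; case: ifPn => //; rewrite mem_setE in_itv /= negb_and -!ltNge.
by move=> /orP[/ltW xa|/ltW bx]; apply: h0; [left|right].
Qed.

Lemma testfun_primitive psi (a b : R) : a < b ->
  (forall x, x <= a \/ b <= x -> psi x = 0) -> cintegral psi = 0 ->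
  exists2 Psi : testfun R, tderive Psi = psi & tsupp Psi `<=` [set` `[a, b]].
Proof.
move=> ab psi0 I0; have [F sF [Fa dF]] := exists_cprimitive a (tfun_smooth psi).
have Fb : F b = 0.
  have [sr si] := sF; have := I0; rewrite cintegralE.
  have -> : cRe \o psi = derive1 (cRe \o F).
    by apply/funext => x /=; rewrite -dF.
  have -> : cIm \o psi = derive1 (cIm \o F).
    by apply/funext => x /=; rewrite -dF.
  rewrite !(rint_derive_itv _ ab) //.
  - move=> [] /=; rewrite Fa /= !subr0 => h1 h2.
    by apply: complex_eq.
  - by move=> x /psi0; rewrite -dF => /(congr1 cIm).
  - by move=> x /psi0; rewrite -dF => /(congr1 cRe).
have F0 x : x < a \/ b < x -> F x = 0.
  move=> [/ltW xa|/ltW bx].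
    rewrite (cderive_eq0_itv sF xa) // => t /andP[_ ta].
    by rewrite dF psi0 //; left.
  rewrite -(cderive_eq0_itv sF bx) // => t /andP[bt _].
  by rewrite dF psi0 //; right.
have [Psi E sP] := exists_testfun sF F0; exists Psi => //.
apply: testfun_ext => x; rewrite tderiveE -dF; congr (cderive 1 _ x).
exact/funext.
Qed.

(** A primitive of a test function is supported in the convex hull of the support, hence the
    restriction to intervals [U]. The margins leave [psi] zero at the end points and make the
    interval nondegenerate. *)
Lemma tsupp_hull U (x0 : R) psi : open U -> is_interval U -> U x0 -> tsupp psi `<=` U ->
  exists a b : R, [/\ a < b, [set` `[a, b]] `<=` U & forall x, x <= a \/ b <= x -> psi x = 0].
Proof.
move=> oU iU Ux0 pU.
have margin (x : R) : U x -> exists2 e : R, 0 < e & U (x - e) /\ U (x + e).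
  move=> Ux; have /nbhs_ballP[e /= e0 He] : nbhs x U by exact: open_nbhs_nbhs.
  exists (e / 2); first by rewrite divr_gt0.
  split; apply: He; rewrite /ball /= ?opprD ?addrA ?opprK ?addKr ?subrr ?add0r.
    by rewrite gtr0_norm; lra.
  by rewrite normrN gtr0_norm; lra.
suff [a [b [ab Ua Ub h]]] : exists a b : R, [/\ a < b, U a, U b &
    forall x, tsupp psi x -> a < x < b].
  exists a, b; split=> // [x|x xab].
    by rewrite /= in_itv /=; exact: iU.
  by apply: tsupp0 => /h; case: xab => H /andP[h1 h2]; lra.
have [[y Ky]|K0] := pselect (tsupp psi !=set0); last first.
  have [e e0 [_ Ue]] := margin x0 Ux0; exists x0, (x0 + e); split=> //; first by lra.
  by move=> x Kx; exfalso; apply: K0; exists x.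
have cid : {within tsupp psi, continuous (id : R -> R)}.
  by apply: continuous_subspaceT => z; exact: cvg_id.
have K0 : tsupp psi !=set0 by exists y.
have [c /set_mem Kc Hc] := compact_EVT_max K0 (@tfun_compact _ psi) cid.
have [d /set_mem Kd Hd] := compact_EVT_min K0 (@tfun_compact _ psi) cid.
have [e e0 [_ Ue]] := margin c (pU c Kc); have [e' e0' [Ue' _]] := margin d (pU d Kd).
have H x : tsupp psi x -> d <= x <= c.
  by move=> /mem_set Kx; apply/andP; split; [exact: Hd|exact: Hc].
exists (d - e'), (c + e); split=> //; first by have /andP[h1 h2] := H y Ky; lra.
by move=> x /H /andP[h1 h2]; apply/andP; split; lra.
Qed.

(* Every test function in [U] is a multiple of a fixed one of integral 1 plus the
   derivative of a test function in [U]. *)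
Lemma deq_on_dderive0 F U (x0 : R) : linear F -> open U -> is_interval U -> U x0 ->
  deq_on U (dderive F) 0 -> exists c, deq_on U F (reg (cst c)).
Proof.
move=> lF oU iU Ux0 dF0.
have l1 : linear (reg (cst 1 : R -> R[i])) by exact/reg_linear/locb_smooth/smooth_cst.
have regc c psi : reg (cst c) psi = c * reg (cst 1) psi.
  rewrite /reg -cintegralZ; last exact: (reg_integrable psi (locb_smooth (smooth_cst 1))).
  by congr cintegral; apply/funext => x; rewrite /= mul1r.
have [th tU th0] : exists2 th : testfun R, tsupp th `<=` U & reg (cst 1) th != 0.
  apply: contrapT => H.
  have E : deq_on U (reg (cst 1)) (reg (cst 0)).
    move=> psi pU; rewrite [RHS]regc mul0r; apply/eqP; apply: contrapT => /negP h.
    by apply: H; exists psi.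
  have /eqP := reg_smooth_inj (smooth_cst 1) (smooth_cst 0) oU E Ux0.
  by rewrite oner_eq0.
exists (F th / reg (cst 1) th) => psi pU; rewrite regc.
pose k := reg (cst 1) psi / reg (cst 1) th.
have eU : tsupp (psi - k *: th) `<=` U.
  apply: (@subset_trans _ (tsupp psi `|` tsupp th)); last by move=> x [/pU|/tU].
  apply: tsupp_sub; first by apply: closedU; exact: closed_tsupp.
  move=> x /not_orP[h1 h2].
  by rewrite tfunD tfunN tfunZ (tsupp0 h1) (tsupp0 h2) mulr0 subr0.
have eI : cintegral (psi - k *: th) = 0.
  transitivity (reg (cst 1) (psi - k *: th)).
    by rewrite /reg; congr cintegral; apply/funext => x; rewrite /= mul1r.
  by rewrite linear_add // linear_opp // linear_scale // /k divfK // subrr.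
have [a [b [ab abU e0]]] := tsupp_hull oU iU Ux0 eU.
have [Psi dPsi sPsi] := testfun_primitive ab e0 eI.
have : F (psi - k *: th) = 0.
  rewrite -dPsi; have := dF0 Psi (subset_trans sPsi abU).
  by rewrite dderiveE => /eqP; rewrite oppr_eq0 => /eqP.
rewrite linear_add // linear_opp // linear_scale // => /eqP.
by rewrite subr_eq0 => /eqP ->; rewrite /k; ring.
Qed.

(** Derivatives are removed one at a time: [D^n F] differs from a primitive of [u] by a distribution
    with zero derivative, which is a constant. Since [v] is smooth on the whole line, this controls
    [F] up to the boundary of [U]. *)
Lemma deq_on_ddern_reg F U (x0 : R) n u : linear F -> open U -> is_interval U -> U x0 ->
  smooth u -> deq_on U (ddern n F) (reg u) -> exists2 v, smooth v & deq_on U F (reg v).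
Proof.
move=> lF oU iU Ux0; elim: n u => [|n IH] u su E; first by exists u.
have [v sv [_ dv]] := exists_cprimitive 0 su.
have lD : linear (ddern n F - reg v).
  rewrite -scaleN1r; apply: linear_addf; first exact: ddern_linear.
  exact/linear_scalef/reg_linear/locb_smooth.
have [c Ec] : exists c, deq_on U (ddern n F - reg v) (reg (cst c)).
  apply: (deq_on_dderive0 lD oU iU Ux0).
  rewrite dderiveD dderiveN (dderive_reg sv) -ddernS.
  have -> : cderive 1 v = u by apply/funext.
  by move=> psi pU; rewrite !fctE E // subrr.
apply: (IH (fun x => v x + c)); first exact: (smoothDp sv (smooth_cst c)).
rewrite (regD (locb_smooth sv) (locb_smooth (smooth_cst c))).
by move=> psi pU; have := Ec psi pU; rewrite !fctE => <-; rewrite addrC subrK.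
Qed.

Lemma linear_sum F n (f : 'I_n -> testfun R) : linear F -> F (\sum_i f i) = \sum_i F (f i).
Proof.
move=> lF; elim/big_rec2: _ => [|i x y _ <-]; first exact: linear_at0.
exact: linear_add.
Qed.

Lemma tfun_sum n (f : 'I_n -> testfun R) x : (\sum_i f i) x = \sum_i f i x.
Proof. by elim/big_rec2: _ => [|i a b _ <-]. Qed.

Lemma reg_cst0 : reg (cst 0 : R -> R[i]) = 0.
Proof.
apply/funext => psi; have := cintegralZ 0 (reg_integrable psi (locb_smooth (smooth_cst 1))).
rewrite mul0r => E; transitivity (0 : R[i]); last by [].
by rewrite -[RHS]E /reg; congr cintegral; apply/funext => x; rewrite /= !mul0r.
Qed.

Lemma reg_sum (I : Type) (r : seq I) (f : I -> R -> R[i]) : (forall i, smooth (f i)) ->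
  reg (fun x => \sum_(i <- r) f i x) = \sum_(i <- r) reg (f i).
Proof.
move=> sf; elim: r => [|i r IH].
  rewrite big_nil -reg_cst0; congr reg; apply/funext => x; by rewrite big_nil.
rewrite big_cons -IH -regD; first last.
- exact/locb_smooth/(smooth_sum r sf).
- exact/locb_smooth/sf.
by congr reg; apply/funext => x; rewrite big_cons.
Qed.

(* If [V] is the inverse of a fundamental matrix then [V Y] has zero derivative. *)
Lemma distribution_ode n (A : 'I_n -> 'I_n -> R -> R[i]) (sA : forall i j, smooth (A i j))
    (Y : 'I_n -> functional R) U (x0 : R) :
  (forall i, linear (Y i)) -> open U -> is_interval U -> U x0 ->
  (forall i psi, tsupp psi `<=` U -> dderive (Y i) psi = \sum_j Y j (tmul (sA i j) psi)) ->
  exists y : 'I_n -> R -> R[i], [/\ forall i, smooth (y i),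
    forall i x, cderive 1 (y i) x = \sum_j A i j x * y j x &
    forall i, deq_on U (Y i) (reg (y i))].
Proof.
move=> lY oU iU Ux0 dY.
have [W [V [sWV dW dV WV _]]] := fundamental_matrix sA.
have sW i j := (sWV i j).1; have sV i j := (sWV i j).2.
pose Z k : functional R := \sum_j dmul (sV k j) (Y j).
have ZE k psi : Z k psi = \sum_j Y j (tmul (sV k j) psi) by rewrite /Z fct_sumE.
have lZ k : linear (Z k).
  move=> c f g; rewrite !ZE scaler_sumr -big_split /=; apply: eq_bigr => j _.
  exact: (dmul_linear (sV k j) (lY j) c f g).
have Z0 k : deq_on U (dderive (Z k)) 0.
  move=> psi pU; rewrite /Z dderive_sum.
  under eq_bigr do rewrite (dderive_dmul _ (lY _)).
  rewrite fct_sumE big_split /=.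
  have -> : \sum_j dmul (sV k j) (dderive (Y j)) psi =
      \sum_j \sum_l Y l (tmul (sA j l) (tmul (sV k j) psi)).
    by apply: eq_bigr => j _; rewrite dmulE dY // => x /tsuppMr /pU.
  rewrite exchange_big /= -big_split /= big1 // => j _.
  rewrite dmulE -linear_sum // -linear_add //.
  rewrite -[RHS](linear_at0 (lY j)); congr (Y j); apply: testfun_ext => x.
  rewrite tfunD tfun_sum tmulE dV tfun0 mulNr mulr_suml.
  rewrite -[RHS](subrr (\sum_l V k l x * A l j x * psi x)) addrC; congr (_ - _).
  by apply: eq_bigr => l _; rewrite !tmulE; ring.
have /choice[c Hc] : forall k, exists c, deq_on U (Z k) (reg (cst c)).
  by move=> k; exact: (deq_on_dderive0 (lZ k) oU iU Ux0 (Z0 k)).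
have sc i k : smooth (fun x => c k * W i k x) by exact: (smoothM (smooth_cst (c k)) (sW i k)).
exists (fun i x => \sum_k c k * W i k x); split.
- by move=> i; exact: smooth_sum (sc i).
- move=> i x; rewrite (cderive1_sum _ x (sc i)).
  transitivity (\sum_k \sum_j A i j x * (c k * W j k x)).
    apply: eq_bigr => k _; rewrite cderive1Z; last exact/smooth_cderivable/sW.
    by rewrite dW mulr_sumr; apply: eq_bigr => j _; ring.
  by rewrite exchange_big; apply: eq_bigr => j _; rewrite mulr_sumr.
move=> i psi pU; rewrite reg_sum // fct_sumE.
transitivity (\sum_k Z k (tmul (sW i k) psi)); last first.
  apply: eq_bigr => k _; rewrite Hc; last by move=> x /tsuppMr /pU.
  by rewrite /reg; congr cintegral; apply/funext => x; rewrite tmulE /=; ring.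
under eq_bigr do rewrite ZE.
rewrite exchange_big /= (eq_bigr (fun j => (i == j)%:R * Y j psi)).
  by rewrite (bigD1 i) //= eqxx mul1r big1 ?addr0 // => j /negbTE ji; rewrite eq_sym ji mul0r.
move=> j _; rewrite -linear_sum // -linear_scale //; congr (Y j); apply: testfun_ext => x.
rewrite tfun_sum tfunZ -(WV i j x) mulr_suml; apply: eq_bigr => k _.
by rewrite !tmulE; ring.
Qed.

End distribution_ode.

(** * The regular fourth-order equation [(p u'')'' = q u] *)

Section fourth_order_ode.
Context {R : realType}.
Variables (p q : R -> R[i]).
Hypotheses (sp : smooth p) (sq : smooth q) (p0 : forall x, p x != 0).
Implicit Types (u v : R -> R[i]) (psi : testfun R) (U : set R) (F : functional R).

Definition ode4 u : Prop :=
  forall x, cderive 2 (fun t => p t * cderive 2 u t) x = q x * u x.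

(* The first-order system for the quasi-derivatives [u, u', p u'', (p u'')']. *)
Let A (i j : 'I_4) : R -> R[i] := nth (cst 0) (nth [::]
  [:: [:: cst 0; cst 1]; [:: cst 0; cst 0; fun x => (p x)^-1];
      [:: cst 0; cst 0; cst 0; cst 1]; [:: q]] i) j.

Let sA i j : smooth (A i j).
Proof.
have s0 := smooth_cst (0 : R[i]); have s1 := smooth_cst (1 : R[i]).
have si := smoothV sp p0.
case: i => [[|[|[|[|i]]]] Hi]; case: j => [[|[|[|[|j]]]] Hj]; rewrite /A /=.
- exact s0. - exact s1. - exact s0. - exact s0. - exact (False_ind _ (notF Hj)).
- exact s0. - exact s0. - exact si. - exact s0. - exact (False_ind _ (notF Hj)).
- exact s0. - exact s0. - exact s0. - exact s1. - exact (False_ind _ (notF Hj)).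
- exact sq. - exact s0. - exact s0. - exact s0. - exact (False_ind _ (notF Hj)).
- exact (False_ind _ (notF Hi)). - exact (False_ind _ (notF Hi)). - exact (False_ind _ (notF Hi)). - exact (False_ind _ (notF Hi)). - exact (False_ind _ (notF Hi)).
Qed.

Let quasi u (i : 'I_4) : R -> R[i] := nth (cst 0)
  [:: u; cderive 1 u; fun t => p t * cderive 2 u t;
      cderive 1 (fun t => p t * cderive 2 u t)] i.

Let smooth_pu u : smooth u -> smooth (fun t => p t * cderive 2 u t).
Proof. by move=> su; exact: (smoothM sp (smooth_cderiven 2 su)). Qed.

Let smooth_quasi u : smooth u -> forall i, smooth (quasi u i).
Proof.
move=> su [[|[|[|[|i]]]] Hi]; rewrite /quasi.
- exact su.
- exact (smooth_cderiven 1 su).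
- exact (smooth_pu su).
- exact (smooth_cderiven 1 (smooth_pu su)).
- exact (False_ind _ (notF Hi)).
Qed.

Let quasi_system u : smooth u -> ode4 u ->
  forall i x, cderive 1 (quasi u i) x = \sum_j A i j x * quasi u j x.
Proof.
move=> su ou; case=> -[|[|[|[|//]]]] ? x;
  rewrite !big_ord_recl big_ord0 /A /quasi /= ?(mul0r, mul1r, add0r, addr0) //.
- by rewrite mulKf // -cderiveS.
- by rewrite -cderiveS ou.
Qed.

Let system_quasi (y : 'I_4 -> R -> R[i]) : (forall i, smooth (y i)) ->
  (forall i x, cderive 1 (y i) x = \sum_j A i j x * y j x) ->
  ode4 (y 0) /\ forall i, y i = quasi (y 0) i.
Proof.
move=> sy dy.
have sum4 i x : cderive 1 (y i) x = A i 0 x * y 0 x + A i 1 x * y 1 x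
     + A i 2 x * y 2 x + A i 3 x * y 3 x.
  rewrite dy !big_ord_recl big_ord0 addr0 !addrA.
  have e3 : lift ord0 (lift ord0 (lift ord0 ord0)) = 3 :> 'I_4 by exact/val_inj.
  have e2 : lift ord0 (lift ord0 ord0) = 2 :> 'I_4 by exact/val_inj.
  have e1 : lift ord0 ord0 = 1 :> 'I_4 by exact/val_inj.
  have e0 : ord0 = 0 :> 'I_4 by exact/val_inj.
  by rewrite e3 e2 e1 e0.
have y1 : y 1 = cderive 1 (y 0).
  by apply/funext => x; rewrite sum4 /A /=; ring.
have y2 : y 2 = fun t => p t * cderive 2 (y 0) t.
  apply/funext => x; rewrite cderiveS -y1 sum4 /A /= !mul0r !add0r !addr0.
  by rewrite mulVKf.
have y3 : y 3 = cderive 1 (fun t => p t * cderive 2 (y 0) t).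
  by apply/funext => x; rewrite -y2 sum4 /A /=; ring.
split.
  by move=> x; rewrite cderiveS -y3 sum4 /A /=; ring.
by case=> -[|[|[|[|//]]]] k; rewrite /quasi /= -?y3 -?y2 -?y1; congr y; exact/val_inj.
Qed.

Lemma cderive3_quasi u x : smooth u ->
  cderive 1 (fun t => p t * cderive 2 u t) x = cderive 1 p x * cderive 2 u x + p x * cderive 3 u x.
Proof. by move=> su; rewrite (cderive1_mul x sp (smooth_cderiven 2 su)) -cderiveS. Qed.

Lemma ode4_exists (x0 : R) (C : nat -> R[i]) :
  exists2 u, smooth u & ode4 u /\ forall k, (k < 4)%N -> cderive k u x0 = C k.
Proof.
(* The quasi-derivatives of a function with jet [C]: the last one is
   [(p u'')' = p' u'' + p u''']. *)
pose y0 (i : 'I_4) := nth 0 [:: C 0%N; C 1%N; p x0 * C 2%N;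
  cderive 1 p x0 * C 2%N + p x0 * C 3%N] i.
have [y [sy y0E dy]] := clinear_ode_exists x0 y0 sA.
have [od Q] := system_quasi sy dy; exists (y 0); [exact (sy 0)|split; first exact od].
have J i : quasi (y 0) i x0 = y0 i by rewrite -Q y0E.
have J2 : cderive 2 (y 0) x0 = C 2%N.
  by have := J 2; rewrite /quasi /y0 /=; apply: mulfI.
move=> [|[|[|[|//]]]] _.
- by rewrite cderive0; exact: (J 0).
- exact: (J 1).
- exact: J2.
- have := J 3; rewrite /quasi /y0 /= (cderive3_quasi x0 (sy 0)) J2 => /addrI.
  exact: mulfI.
Qed.

Lemma cderive1_sub (f g : R -> R[i]) x : smooth f -> smooth g ->
  cderive 1 (fun t => f t - g t) x = cderive 1 f x - cderive 1 g x.
Proof.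
move=> sf sg; have E : (fun t => f t - g t) = (fun t => f t + (- 1) * g t).
  by apply/funext => t; rewrite mulN1r.
rewrite E cderive1D; first last.
- exact: (smooth_cderivable _ (smoothM (smooth_cst (- 1)) sg)).
- exact: (smooth_cderivable _ sf).
by rewrite cderive1Z ?mulN1r //; exact: (smooth_cderivable _ sg).
Qed.

Lemma ode4_unique u v (x0 : R) : smooth u -> smooth v -> ode4 u -> ode4 v ->
  (forall k, (k < 4)%N -> cderive k u x0 = cderive k v x0) -> u = v.
Proof.
move=> su sv ou ov uv.
suff h i x : quasi u i x - quasi v i x = 0.
  by apply/funext => x; apply/eqP; rewrite -subr_eq0; apply/eqP; exact: (h 0).
move: i x; apply: (@clinear_ode_unique _ _ A x0 (fun i x => quasi u i x - quasi v i x) sA).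
- by move=> i; exact: (smoothBp (smooth_quasi su i) (smooth_quasi sv i)).
- have E0 : u x0 = v x0 by have := uv 0%N isT; rewrite !cderive0.
  have E1 := uv 1%N isT; have E2 := uv 2%N isT; have E3 := uv 3%N isT.
  case=> [[|[|[|[|i]]]] Hi]; rewrite /quasi /=.
  + by rewrite E0 subrr.
  + by rewrite E1 subrr.
  + by rewrite E2 subrr.
  + apply/eqP; rewrite subr_eq0; apply/eqP.
    have E := f_equal2 (fun a b => cderive 1 p x0 * a + p x0 * b) E2 E3.
    exact (etrans (cderive3_quasi x0 su) (etrans E (esym (cderive3_quasi x0 sv)))).
  + exact (False_ind _ (notF Hi)).
move=> i x; have E := f_equal2 (fun a b => a - b) (quasi_system su ou i x) (quasi_system sv ov i x).
apply: (etrans (cderive1_sub x (smooth_quasi su i) (smooth_quasi sv i)) (etrans E _)).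
by rewrite -sumrB; apply: eq_bigr => j _; rewrite mulrBr.
Qed.

(** The quasi-derivatives make sense for distributions, since they only involve products with the
    smooth [p]; they satisfy the same first-order system. *)
Lemma distribution_ode4 F U (x0 : R) : linear F -> open U -> is_interval U -> U x0 ->
  deq_on U (ddern 2 (dmul sp (ddern 2 F))) (dmul sq F) ->
  exists u, [/\ smooth u, ode4 u & deq_on U F (reg u)].
Proof.
move=> lF oU iU Ux0 E.
pose Y (i : 'I_4) : functional R := nth 0 [:: F; dderive F; dmul sp (ddern 2 F);
  dderive (dmul sp (ddern 2 F))] i.
have lp : linear (dmul sp (ddern 2 F)) by exact/dmul_linear/ddern_linear.
have lY i : linear (Y i).
  case: i => -[|[|[|[|//]]]] ?; rewrite /Y /=.
  - exact: lF.
  - exact: dderive_linear.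
  - exact: lp.
  - exact: dderive_linear.
have dY i psi : tsupp psi `<=` U -> dderive (Y i) psi = \sum_j Y j (tmul (sA i j) psi).
  move=> pU.
  (* Every row of [A] has a single nonzero entry, so each sum reduces to one term. *)
  have row (i' j0 : 'I_4) : (forall j, j != j0 -> A i' j = cst 0) ->
      \sum_j Y j (tmul (sA i' j) psi) = Y j0 (tmul (sA i' j0) psi).
    move=> h; rewrite (bigD1 j0) //= big1 ?addr0 // => j jj.
    rewrite -[RHS](linear_at0 (lY j)); congr (Y j); apply: testfun_ext => x.
    by rewrite tmulE (h j jj) mul0r.
  have id1 (i' j : 'I_4) (G : functional R) : A i' j = cst 1 -> G (tmul (sA i' j) psi) = G psi.
    by move=> h; congr G; apply: testfun_ext => x; rewrite tmulE h mul1r.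
  case: i => [[|[|[|[|i]]]] Hi]; last exact (False_ind _ (notF Hi)).
  - rewrite (row _ 1) ?id1 //; case=> [[|[|[|[|j]]]] Hj] //.
  - rewrite (row _ 2); last by case=> [[|[|[|[|j]]]] Hj].
    transitivity (ddern 2 F psi); first by [].
    rewrite /Y /= dmulE; congr (ddern 2 F _); apply: testfun_ext => x.
    by rewrite !tmulE /A /= mulVKf.
  - by rewrite (row _ 3) ?id1 //; case=> [[|[|[|[|j]]]] Hj].
  - rewrite (row _ 0); last by case=> [[|[|[|[|j]]]] Hj].
    by apply: (etrans (E psi pU)); rewrite dmulE; congr F; apply: testfun_ext => x.
have [y [sy dy Yy]] := distribution_ode lY oU iU Ux0 dY.
have [od _] := system_quasi sy dy.
by exists (y 0); split; [exact (sy 0)|exact od|exact: (Yy 0)].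
Qed.

End fourth_order_ode.

(** * Orders and Dirac coefficients *)

Section order_coefficients.
Context {R : realType}.
Local Notation mu := (@lebesgue_measure R).
Local Notation normc := (@Normc.normc R).
Implicit Types (f g h : R -> R[i]) (psi P : testfun R) (F : functional R).

Lemma iter_tderiveE k psi x : iter k tderive psi x = cderive k psi x.
Proof.
suff -> : (iter k tderive psi : R -> _) = cderive k psi by [].
by elim: k => [|k IH]; rewrite ?cderive0 // cderiveS -IH.
Qed.

Lemma iter_tderiveZ k c psi : iter k tderive (c *: psi) = c *: iter k tderive psi.
Proof. by elim: k => //= k ->; rewrite tderiveZ. Qed.

Lemma ddern_eval k F psi : ddern k F psi = (-1) ^+ k * F (iter k tderive psi).
Proof.
elim: k psi => [|k IH] psi; first by rewrite expr0 mul1r.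
by rewrite ddernS dderiveE IH exprS mulN1r mulNr iterSr.
Qed.

Lemma exists_dilation P (y : R) m : exists Pm : testfun R, forall k x,
  iter k tderive Pm x = (m.+1%:R ^+ k)%:C * iter k tderive P (m.+1%:R * x + - (m.+1%:R * y)).
Proof.
have [M M0 HM] := tsupp_bounded P.
have [|Pm E _] := @exists_testfun R (fun x => P (m.+1%:R * x + - (m.+1%:R * y))) (y - M) (y + M)
    (smooth_affine _ _ (tfun_smooth P)).
  move=> x xM; apply: HM; rewrite -mulrN -mulrDr normrM ger0_norm //.
  have h : M < `|x - y|.
    by rewrite lter_normr; apply/orP; case: xM => h; [right|left]; lra.
  by rewrite (lt_le_trans h) // ler_peMl // ler1n.
exists Pm => k x; rewrite !iter_tderiveE.
have -> : (Pm : R -> R[i]) = (fun x => P (m.+1%:R * x + - (m.+1%:R * y))) by exact/funext.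
by rewrite (cderive_affine _ _ _ (tfun_smooth P)).
Qed.

(** [P] is [x^j] times a plateau: each multiplication by [x] shifts the Taylor coefficients at 0,
    and [d] is [(-1)^j j!]. *)
Lemma exists_moment j : exists P (d : R[i]), d != 0 /\
  forall l, (l <= j)%N -> ddern l (delta 0) P = (l == j)%:R * d.
Proof.
elim: j => [|j [P [d [d0 H]]]].
  have [P [P1 _ _]] := exists_plateau 0 (@ltr01 R).
  exists P, 1; split; first exact: oner_neq0.
  by case=> // _; rewrite mul1r; apply: P1; rewrite subrr normr0.
exists (tmul (smooth_X 0) P), (- j.+1%:R * d); split.
  by rewrite mulf_neq0 // oppr_eq0 pnatr_eq0.
move=> l lj; have := congr1 (fun F => F P) (dmul_X_ddelta l 0); rewrite dmulE => ->.
rewrite fctE /GRing.scale /=; case: l lj => [|l] lj; first by rewrite oppr0 !mul0r.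
rewrite H // eqSS; have [->|] := eqVneq l j; first by rewrite !mul1r.
by rewrite !mul0r mulr0.
Qed.

(** A common roof for the locally bounded functions and the locally integrable ones in the
    definition of the order: domination by an integrable function on bounded sets is all that
    dominated convergence asks. *)
Definition locdom g : Prop :=
  [/\ measurable_fun setT (cRe \o g), measurable_fun setT (cIm \o g) &
   forall M : R, exists G : R -> R, [/\ rintegrable G, forall x, 0 <= G x &
     forall x, `|x| <= M -> normc (g x) <= G x]].

(** The dilated test functions stay bounded while their supports shrink to [y], so the integrand
    tends to 0 off the single point [y]. *)
Lemma locdom_cvg0 g P (y : R) (t : nat -> R) : locdom g -> (forall m, 0 <= t m <= 1) ->
  ccvg_to \oo (fun m => cintegral
    (fun x => g x * ((t m)%:C * P (m.+1%:R * x + - (m.+1%:R * y))))) 0.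
Proof.
move=> [mr mi dom] t01; have [M M0 HM] := tsupp_bounded P.
have [E E0 HE] := locb_normc (locb_tfun P) M.
have [G [iG G0 HG]] := dom (`|y| + M).
pose f m x : R[i] := (t m)%:C * P (m.+1%:R * x + - (m.+1%:R * y)).
have lf m : locb (f m).
  exact: locb_smooth (smoothM (smooth_cst _) (smooth_affine _ _ (tfun_smooth P))).
have far m x : M < m.+1%:R * `|x - y| -> f m x = 0.
  move=> h; rewrite /f HM ?mulr0 // -mulrN -mulrDr normrM ger0_norm //.
have bnd m x : normc (g x * f m x) <= E * G x.
  have [h|h] := ltP M (m.+1%:R * `|x - y|).
    by rewrite far // mulr0 Normc.normc0 mulr_ge0.
  rewrite Normc.normcM mulrC ler_pM ?normc_ge0 //.
    rewrite /f Normc.normcM -[leRHS]mul1r ler_pM ?normc_ge0 //.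
      by rewrite (le_trans (normc_le _)) //= normr0 addr0 ger0_norm; case/andP: (t01 m).
    have [h'|h'] := leP `|m.+1%:R * x + - (m.+1%:R * y)| M; first exact: HE.
    by rewrite HM // Normc.normc0.
  apply: HG; have hxy : `|x - y| <= M.
    by rewrite (le_trans _ h) // ler_peMl // ler1n.
  by rewrite -[x](subrK y) (le_trans (ler_normD _ _)) // addrC lerD2l.
have iEG : rintegrable (fun x => E * G x) by exact: rintegrableZ.
have cv x : x \notin [:: y] -> ccvg_to \oo (fun m => g x * f m x) 0.
  rewrite inE => xy; have xy0 : 0 < `|x - y| by rewrite normr_gt0 subr_eq0.
  apply: ccvg_to_near (ccvg_to_cst _ _); near=> m; rewrite far ?mulr0 //.
  rewrite -ltr_pdivrMr // (@lt_trans _ _ m%:R) ?ltr_nat //.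
  by near: m; exact: nbhs_infty_gtr.
have mf m : measurable_fun setT (cRe \o (fun x => g x * f m x)) /\
    measurable_fun setT (cIm \o (fun x => g x * f m x)).
  have [[m1 _] [m2 _]] := lf m; split.
    have -> : cRe \o (fun x => g x * f m x) =
        ((cRe \o g) \* (cRe \o f m)) \+ (\- ((cIm \o g) \* (cIm \o f m))).
      by apply/funext => x; rewrite /= cReM.
    by apply: measurable_funD; [|apply: measurable_funN]; apply: measurable_funM.
  have -> : cIm \o (fun x => g x * f m x) =
      ((cRe \o g) \* (cIm \o f m)) \+ ((cIm \o g) \* (cRe \o f m)).
    by apply/funext => x; rewrite /= cImM.
  by apply: measurable_funD; apply: measurable_funM.
have r0 : rint (cst 0 : R -> R) = 0 by rewrite /rint /Rintegral integral0.
have bnd' m x := ler_normc (g x * f m x).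
split; rewrite /= -[X in _ --> X]r0.
- apply: (@rint_dct R [:: y] (fun m => cRe \o (fun x => g x * f m x)) (cst 0) _ _ _ iEG).
  + by move=> m; exact: (mf m).1.
  + exact: measurable_cst.
  + by move=> m x; exact: le_trans (bnd' m x).1 (bnd m x).
  + by move=> x /cv[].
- apply: (@rint_dct R [:: y] (fun m => cIm \o (fun x => g x * f m x)) (cst 0) _ _ _ iEG).
  + by move=> m; exact: (mf m).2.
  + exact: measurable_cst.
  + by move=> m x; exact: le_trans (bnd' m x).2 (bnd m x).
  + by move=> x /cv[].
Unshelve. all: by end_near. Qed.

Lemma locdom_locb h : locb h -> locdom h.
Proof.
move=> lh; have [[m1 _] [m2 _]] := lh; split=> // M.
have [C C0 HC] := locb_normc lh M.
exists (fun x => C * (x \in `[- M, M])%:R); split.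
- by apply: rintegrableZ; exact: rintegrable_itv.
- by move=> x; rewrite mulr_ge0.
- by move=> x xM; rewrite in_itv /= -ler_norml xM mulr1; exact: HC.
Qed.

Lemma locdom_loc_integrable g : loc_integrable g -> locdom g.
Proof.
move=> [[m1 _ i1] [m2 _ i2]]; split=> // M.
have int (k : R -> R) : measurable_fun setT k ->
    (forall K : set R, K `<=` setT -> compact K -> (\int[mu]_(x in K) `|k x|%:E < +oo)%E) ->
    rintegrable ((fun x => `|k x|) \_ [set` `[- M, M]]).
  move=> mk ik; rewrite /rintegrable -restrict_EFin.
  have H := @integrable_mkcond _ _ R mu [set` `[- M, M]] (EFin \o (fun x => `|k x|)) (measurable_itv _).
  apply/H/integrableP; split.
    apply/measurable_EFinP; apply: measurableT_comp => //; exact: measurable_funTS.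
  under eq_integral do rewrite /= normr_id.
  by apply: ik => //; exact: segment_compact.
exists (fun x => ((fun x => `|cRe (g x)|) \_ [set` `[- M, M]]) x + ((fun x => `|cIm (g x)|) \_ [set` `[- M, M]]) x).
split.
- by apply: rintegrableD; [exact: (int _ m1 i1)|exact: (int _ m2 i2)].
- by move=> x; rewrite addr_ge0 // patchE; case: ifP.
- move=> x xM; have xI : x \in [set` `[- M, M]] by rewrite mem_setE in_itv /= -ler_norml.
  by rewrite !patchE xI; exact: normc_le.
Qed.

(* Test against [t^l * P((x - y) / t)] as [t] tends to 0, where only the [l]-th moment
   of [P] is seen by the Diracs: both regular parts vanish in the limit if [k <= l]. *)
Lemma order_coef g h (y : R) n (c : 'I_n -> R[i]) k : locdom g -> locdom h ->
  reg h + \sum_l c l *: ddern l (delta y) = ddern k (reg g) ->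
  forall l : 'I_n, (k <= l)%N -> c l = 0.
Proof.
(* Downward induction on [l]: the Diracs of order above [l] are already known to have zero
   coefficients, and those below are killed by the moments of [P]. *)
move=> dg dh E; suff H : forall d (l : 'I_n), (n - l <= d)%N -> (k <= l)%N -> c l = 0.
  by move=> l; exact: (H (n - l)%N).
elim=> [|d IH] l nl kl; first by move: nl; rewrite leqn0 subn_eq0 leqNgt ltn_ord.
have [P [e [e0 He]]] := exists_moment l.
pose t m : R := m.+1%:R^-1.
have t01 j m : 0 <= t m ^+ j <= 1.
  apply/andP; split; first by rewrite exprn_ge0 // invr_ge0.
  by rewrite exprn_ile1 ?invr_ge0 // invf_le1 ?ler1n.
(* Moving [k] derivatives onto the dilated function costs [m.+1 ^ k], so the scaling [t^l] leaves
   [t^(l - k)], bounded because [k <= l]. *)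
have Ig := locdom_cvg0 (iter k tderive P) y dg (t01 (l - k)%N).
have Ih := locdom_cvg0 P y dh (t01 (l : nat)).
have eq m : cintegral (fun x => h x * ((t m ^+ l)%:C * P (m.+1%:R * x + - (m.+1%:R * y)))) +
    c l * e = (-1) ^+ k * cintegral (fun x => g x * ((t m ^+ (l - k))%:C *
      iter k tderive P (m.+1%:R * x + - (m.+1%:R * y)))).
  have [Pm HPm] := exists_dilation P y m.
  have m0 : m.+1%:R != 0 :> R by rewrite pnatr_eq0.
  have := congr1 (fun F => F ((t m ^+ l)%:C *: Pm)) E; rewrite ddern_eval iter_tderiveZ fctE fct_sumE.
  have -> : reg h ((t m ^+ l)%:C *: Pm) =
      cintegral (fun x => h x * ((t m ^+ l)%:C * P (m.+1%:R * x + - (m.+1%:R * y)))).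
    rewrite /reg; congr cintegral; apply/funext => x; rewrite tfunZ.
    by have := HPm 0%N x; rewrite /= expr0 mul1r => ->.
  have -> : reg g ((t m ^+ l)%:C *: iter k tderive Pm) = cintegral (fun x => g x *
      ((t m ^+ (l - k))%:C * iter k tderive P (m.+1%:R * x + - (m.+1%:R * y)))).
    rewrite /reg; congr cintegral; apply/funext => x; rewrite tfunZ HPm; congr (_ * _); rewrite mulrA; congr (_ * _).
    by rewrite -rmorphM /= -{1}(subnK kl) exprD -mulrA -exprMn mulVf // expr1n mulr1.
  have A j : ddern j (delta y) ((t m ^+ l)%:C *: Pm) =
      (t m ^+ l * m.+1%:R ^+ j)%:C * ddern j (delta 0) P.
    by rewrite !ddern_eval /delta iter_tderiveZ tfunZ HPm subrr rmorphM /=; ring.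
  move=> <-; congr (_ + _); rewrite (bigD1 l) //= big1 ?addr0.
    rewrite fctE A -exprMn mulVf // expr1n mul1r (He l (leqnn l)) eqxx mul1r.
    by [].
  move=> j jl; rewrite fctE; have [jl'|lj] := ltnP j l.
    by rewrite A (He j (ltnW jl')) (ltn_eqF jl') mul0r mulr0 scaler0.
  have {}lj : (l < j)%N by rewrite ltn_neqAle lj andbT eq_sym; move: jl; apply: contra => /eqP ?; exact/eqP/val_inj.
  rewrite (IH j) ?scale0r //; last exact: leq_trans kl (ltnW lj).
  by rewrite leq_subLR; move: nl; rewrite leq_subLR addnS => /leq_trans; apply; rewrite -addSn leq_add2r.
have FF : Filter (\oo : set_system nat) by exact _.
have cv := ccvg_toD FF (ccvg_toM FF (ccvg_to_cst FF ((-1) ^+ k)) Ig) (ccvg_toN FF Ih).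
have ce : (-1) ^+ k * 0 + - 0 = c l * e.
  apply: ccvg_to_unique cv _; apply: ccvg_to_near (ccvg_to_cst _ _).
  by apply: nearW => m; rewrite -eq addrAC subrr add0r.
by move: ce => /esym /eqP; rewrite mulr0 oppr0 addr0 mulf_eq0 (negbTE e0) orbF => /eqP.
Qed.

End order_coefficients.

(** * Jump relations *)

Section jump_system.
Variable K : fieldType.
Implicit Types (A B p m : nat -> K).

(* The coefficients of [delta^(3)], ..., [delta] at [xi] in the equation for
   [phi = u_- H(xi - x) + u_+ H(x - xi)], where [p] and [m] are the jets at [xi] of
   [u_+] and [u_-]; [P], [P'] and [Q], [Q'] are the value and the derivative of
   [a_0 + a_1] to the right and to the left of [xi], and [M], [M'] those of
   [a_0- + a_1+]. *)
Definition jump (W P P' Q Q' M M' : K) A0 A1 B0 B1 p m : Prop :=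
  [/\ A0 1%N * p 2%N + A1 1%N * m 2%N + M * (p 0%N - m 0%N)
        - W * (B0 3%N * p 0%N + B1 3%N * m 0%N) = 0,
      A0 0%N * p 2%N - A0 1%N * p 3%N + A1 0%N * m 2%N - A1 1%N * m 3%N
        + M * (p 1%N - m 1%N) - M' * (p 0%N - m 0%N)
        - W * (B0 2%N * p 0%N - 3 * B0 3%N * p 1%N + B1 2%N * m 0%N - 3 * B1 3%N * m 1%N) = 0,
      P * p 2%N - Q * m 2%N
        - W * (B0 1%N * p 0%N - 2 * B0 2%N * p 1%N + 3 * B0 3%N * p 2%N
               + B1 1%N * m 0%N - 2 * B1 2%N * m 1%N + 3 * B1 3%N * m 2%N) = 0 &
      P' * p 2%N + P * p 3%N - Q' * m 2%N - Q * m 3%N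
        - W * (B0 0%N * p 0%N - B0 1%N * p 1%N + B0 2%N * p 2%N - B0 3%N * p 3%N
               + B1 0%N * m 0%N - B1 1%N * m 1%N + B1 2%N * m 2%N - B1 3%N * m 3%N) = 0].

(** The reflection that exchanges the two sides: solving for the left jet becomes an instance of
    solving for the right one, with divisors [- Q] and [- M]. *)
Lemma jump_swap W P P' Q Q' M M' A0 A1 B0 B1 p m :
  jump W P P' Q Q' M M' A0 A1 B0 B1 p m <->
  jump W (- Q) (- Q') (- P) (- P') (- M) (- M') A1 A0 B1 B0 m p.
Proof.
have E (x y : K) : x = y -> x = 0 <-> y = 0 by move=> ->.
rewrite /jump; split=> -[e3 e2 e1 e0]; split.
- by rewrite -[RHS]e3; ring.
- by rewrite -[RHS]e2; ring.
- by rewrite -[RHS]e1; ring.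
- by rewrite -[RHS]e0; ring.
- by rewrite -[RHS]e3; ring.
- by rewrite -[RHS]e2; ring.
- by rewrite -[RHS]e1; ring.
- by rewrite -[RHS]e0; ring.
Qed.

(** What (a), (b), (c) leave of the coefficients: since [delta^(j)] has order [j + 1], order at most
    [n] kills the coefficients from index [n] on. In (c) nothing is imposed on [A], which stops at
    index 1. *)
Definition regular_orders A B : Prop :=
  [\/ [/\ A 0%N = 0, A 1%N = 0 & B 3%N = 0],
      [/\ A 1%N = 0, B 2%N = 0 & B 3%N = 0]
    | [/\ B 1%N = 0, B 2%N = 0 & B 3%N = 0]].

Lemma eqdiv (c x y : K) : c != 0 -> c * x = y -> x = y / c.
Proof. by move=> c0 <-; rewrite mulrC mulKf. Qed.

(* In each case the four equations are triangular in a suitable order of the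
   unknowns: [p 0, p 1, p 2, p 3], or [p 0, p 2, p 1, p 3], or [p 2, p 0, p 3, p 1]. *)
Lemma jump_solve W P P' Q Q' M M' A0 A1 B0 B1 m : P != 0 -> M != 0 -> regular_orders A0 B0 ->
  exists f : nat -> K, forall p, jump W P P' Q Q' M M' A0 A1 B0 B1 p m <->
    forall k, (k < 4)%N -> p k = f k.
Proof.
move=> P0 M0.
have L f p : (forall k, (k < 4)%N -> p k = nth 0 f k) <->
   [/\ p 0%N = nth 0 f 0, p 1%N = nth 0 f 1, p 2%N = nth 0 f 2 & p 3%N = nth (0 : K) f 3].
  split=> [h|[h0 h1 h2 h3] [|[|[|[|//]]]] //]; split; exact: h.
(* In all three cases the equations at [delta^(3)] and [delta^(2)] are solved for [p 0] and [p 1]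
   with divisor [M], those at [delta^(1)] and [delta] for [p 2] and [p 3] with divisor [P]; the
   cases differ in which unknowns still occur in which equation. *)
case=> [[a0 a1 b3]|[a1 b2 b3]|[b1 b2 b3]].
- pose x0 := (W * (B1 3%N * m 0%N) - A1 1%N * m 2%N) / M + m 0%N.
  pose x1 := (W * (B0 2%N * x0 + B1 2%N * m 0%N - 3 * B1 3%N * m 1%N)
     - A1 0%N * m 2%N + A1 1%N * m 3%N + M' * (x0 - m 0%N)) / M + m 1%N.
  pose x2 := (W * (B0 1%N * x0 - 2 * B0 2%N * x1
               + B1 1%N * m 0%N - 2 * B1 2%N * m 1%N + 3 * B1 3%N * m 2%N) + Q * m 2%N) / P.
  pose x3 := (W * (B0 0%N * x0 - B0 1%N * x1 + B0 2%N * x2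
               + B1 0%N * m 0%N - B1 1%N * m 1%N + B1 2%N * m 2%N - B1 3%N * m 3%N)
     - P' * x2 + Q' * m 2%N + Q * m 3%N) / P.
  exists (nth 0 [:: x0; x1; x2; x3]) => p; rewrite L /= /jump a0 a1 b3.
  split=> [[e3 e2 e1 e0]|[-> -> -> ->]].
    have h0 : p 0%N = x0.
      rewrite /x0; apply/eqP; rewrite -subr_eq; apply/eqP; apply: eqdiv => //.
      by apply/eqP; rewrite -subr_eq0 -e3; apply/eqP; ring.
    have h1 : p 1%N = x1.
      rewrite /x1; apply/eqP; rewrite -subr_eq; apply/eqP; apply: eqdiv => //.
      by apply/eqP; rewrite -subr_eq0 -e2 -h0; apply/eqP; ring.
    have h2 : p 2%N = x2.
      by apply: eqdiv => //; apply/eqP; rewrite -subr_eq0 -e1 -h0 -h1; apply/eqP; ring.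
    have h3 : p 3%N = x3.
      by apply: eqdiv => //; apply/eqP; rewrite -subr_eq0 -e0 -h0 -h1 -h2; apply/eqP; ring.
    by [].
  split.
  + by rewrite /x0; field.
  + by rewrite {1}/x1; field.
  + by rewrite {1}/x2; field.
  + by rewrite {1}/x3; field.
- pose x0 := (W * (B1 3%N * m 0%N) - A1 1%N * m 2%N) / M + m 0%N.
  pose x2 := (W * (B0 1%N * x0
               + B1 1%N * m 0%N - 2 * B1 2%N * m 1%N + 3 * B1 3%N * m 2%N) + Q * m 2%N) / P.
  pose x1 := (W * (B1 2%N * m 0%N - 3 * B1 3%N * m 1%N) - A0 0%N * x2
     - A1 0%N * m 2%N + A1 1%N * m 3%N + M' * (x0 - m 0%N)) / M + m 1%N.
  pose x3 := (W * (B0 0%N * x0 - B0 1%N * x1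
               + B1 0%N * m 0%N - B1 1%N * m 1%N + B1 2%N * m 2%N - B1 3%N * m 3%N)
     - P' * x2 + Q' * m 2%N + Q * m 3%N) / P.
  exists (nth 0 [:: x0; x1; x2; x3]) => p; rewrite L /= /jump a1 b2 b3.
  split=> [[e3 e2 e1 e0]|[-> -> -> ->]].
    have h0 : p 0%N = x0.
      rewrite /x0; apply/eqP; rewrite -subr_eq; apply/eqP; apply: eqdiv => //.
      by apply/eqP; rewrite -subr_eq0 -e3; apply/eqP; ring.
    have h2 : p 2%N = x2.
      by apply: eqdiv => //; apply/eqP; rewrite -subr_eq0 -e1 -h0; apply/eqP; ring.
    have h1 : p 1%N = x1.
      rewrite /x1; apply/eqP; rewrite -subr_eq; apply/eqP; apply: eqdiv => //.
      by apply/eqP; rewrite -subr_eq0 -e2 -h0 -h2; apply/eqP; ring.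
    have h3 : p 3%N = x3.
      by apply: eqdiv => //; apply/eqP; rewrite -subr_eq0 -e0 -h0 -h1 -h2; apply/eqP; ring.
    by [].
  split.
  + by rewrite /x0; field.
  + by rewrite {1}/x1; field.
  + by rewrite {1}/x2; field.
  + by rewrite {1}/x3; field.
- pose x2 := (W * (B1 1%N * m 0%N - 2 * B1 2%N * m 1%N + 3 * B1 3%N * m 2%N) + Q * m 2%N) / P.
  pose x0 := (W * (B1 3%N * m 0%N) - A0 1%N * x2 - A1 1%N * m 2%N) / M + m 0%N.
  pose x3 := (W * (B0 0%N * x0
               + B1 0%N * m 0%N - B1 1%N * m 1%N + B1 2%N * m 2%N - B1 3%N * m 3%N)
     - P' * x2 + Q' * m 2%N + Q * m 3%N) / P.
  pose x1 := (W * (B1 2%N * m 0%N - 3 * B1 3%N * m 1%N) - A0 0%N * x2 + A0 1%N * x3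
     - A1 0%N * m 2%N + A1 1%N * m 3%N + M' * (x0 - m 0%N)) / M + m 1%N.
  exists (nth 0 [:: x0; x1; x2; x3]) => p; rewrite L /= /jump b1 b2 b3.
  split=> [[e3 e2 e1 e0]|[-> -> -> ->]].
    have h2 : p 2%N = x2.
      by apply: eqdiv => //; apply/eqP; rewrite -subr_eq0 -e1; apply/eqP; ring.
    have h0 : p 0%N = x0.
      rewrite /x0; apply/eqP; rewrite -subr_eq; apply/eqP; apply: eqdiv => //.
      by apply/eqP; rewrite -subr_eq0 -e3 -h2; apply/eqP; ring.
    have h3 : p 3%N = x3.
      by apply: eqdiv => //; apply/eqP; rewrite -subr_eq0 -e0 -h0 -h2; apply/eqP; ring.
    have h1 : p 1%N = x1.
      rewrite /x1; apply/eqP; rewrite -subr_eq; apply/eqP; apply: eqdiv => //.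
      by apply/eqP; rewrite -subr_eq0 -e2 -h0 -h2 -h3; apply/eqP; ring.
    by [].
  split.
  + by rewrite {1}/x0; field.
  + by rewrite {1}/x1; field.
  + by rewrite {1}/x2; field.
  + by rewrite {1}/x3; field.
Qed.

End jump_system.

(** * Explicit Dirac coefficients, boundary conditions and orders *)

Section pc_algebra.
Context {R : realType}.
Variable xi : R.
Implicit Types (f g fm fp gm gp : R -> R[i]) (F G S : functional R).

Lemma ddernD n F G : ddern n (F + G) = ddern n F + ddern n G.
Proof. by elim: n => // n IH; rewrite !ddernS IH dderiveD. Qed.

Lemma ddernZ n c F : ddern n (c *: F) = c *: ddern n F.
Proof. by elim: n => // n IH; rewrite !ddernS IH dderiveZ. Qed.

Lemma pc_eq fm fp gm gp : (forall x, x < xi -> fm x = gm x) ->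
  (forall x, xi < x -> fp x = gp x) -> pc xi fm fp = pc xi gm gp.
Proof.
move=> hm hp; apply/funext => x; have [xx|xx|->] := ltgtP x xi; last by rewrite !pc_xi.
- by rewrite !pc_lt // hm.
- by rewrite !pc_gt // hp.
Qed.

Lemma reg_pcD fm fp gm gp : smooth fm -> smooth fp -> smooth gm -> smooth gp ->
  reg (pc xi fm fp) + reg (pc xi gm gp) =
  reg (pc xi (fun x => fm x + gm x) (fun x => fp x + gp x)).
Proof.
move=> s1 s2 s3 s4.
rewrite -(regD (locb_pc xi (locb_smooth s1) (locb_smooth s2))
               (locb_pc xi (locb_smooth s3) (locb_smooth s4))).
by congr reg; apply/funext => x; rewrite /pc; ring.
Qed.

Lemma reg_pcZ c fm fp : smooth fm -> smooth fp ->
  c *: reg (pc xi fm fp) = reg (pc xi (fun x => c * fm x) (fun x => c * fp x)).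
Proof.
move=> s1 s2; rewrite -(regZ c (locb_pc xi (locb_smooth s1) (locb_smooth s2))).
by congr reg; apply/funext => x; rewrite /pc; ring.
Qed.

Lemma ddern2_reg_pc fm fp : smooth fm -> smooth fp ->
  ddern 2 (reg (pc xi fm fp)) = reg (pc xi (cderive 2 fm) (cderive 2 fp)) +
    ((fp xi - fm xi) *: ddern 1 (delta xi) +
     (cderive 1 fp xi - cderive 1 fm xi) *: delta xi).
Proof.
move=> sm sp; rewrite ddernS [ddern 1 _](dderive_reg_pc xi sm sp) dderiveD dderiveZ.
rewrite (dderive_reg_pc xi (smooth_cderiven 1 sm) (smooth_cderiven 1 sp)) -!cderiveS.
by rewrite -addrA [X in _ + X]addrC.
Qed.

Lemma delta_span_ddern_iter m n S : delta_span m xi S -> delta_span (n + m) xi (ddern n S).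
Proof. by move=> sS; elim: n => // n IH; rewrite ddernS; exact: delta_span_dderive. Qed.

Lemma delta_span_jump (c d : R[i]) : delta_span 2 xi (c *: ddern 1 (delta xi) + d *: delta xi).
Proof.
by apply: delta_spanD; apply: delta_spanZ; [|apply: (@delta_span_ddern _ _ 0)];
  try exact: delta_span_ddern.
Qed.

Lemma jetmulS j v : jetmul j.+1 v xi = dderive (jetmul j v xi) - jetmul j (fun k => v k.+1) xi.
Proof. by []. Qed.

Lemma jetmul1 v : jetmul 1 v xi = v 0%N *: ddern 1 (delta xi) - v 1%N *: delta xi.
Proof. by rewrite /= dderiveZ. Qed.

Lemma jetmul2 v : jetmul 2 v xi = v 0%N *: ddern 2 (delta xi)
  - (2 * v 1%N) *: ddern 1 (delta xi) + v 2%N *: delta xi.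
Proof.
rewrite jetmulS !jetmul1.
rewrite dderiveD dderiveN !dderiveZ.
rewrite -[dderive (ddern 1 (delta xi))]/(ddern 2 (delta xi)) -[dderive (delta xi)]/(ddern 1 (delta xi)).
move: (v 0%N) (v 1%N) (v 2%N) (ddern 2 (delta xi)) (ddern 1 (delta xi)) (delta xi).
move=> v0 v1 v2 d2 d1 d0; apply/funext => psi; rewrite !fctE /GRing.scale /=; ring.
Qed.

Lemma jetmul3 v : jetmul 3 v xi = v 0%N *: ddern 3 (delta xi)
  - (3 * v 1%N) *: ddern 2 (delta xi) + (3 * v 2%N) *: ddern 1 (delta xi)
  - v 3%N *: delta xi.
Proof.
rewrite jetmulS !jetmul2.
rewrite !dderiveD dderiveN !dderiveZ -[dderive (ddern 2 (delta xi))]/(ddern 3 (delta xi)).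
rewrite -[dderive (ddern 1 (delta xi))]/(ddern 2 (delta xi)) -[dderive (delta xi)]/(ddern 1 (delta xi)).
move: (v 0%N) (v 1%N) (v 2%N) (v 3%N) (ddern 3 (delta xi)) (ddern 2 (delta xi)).
move: (ddern 1 (delta xi)) (delta xi) => d1 d0 v0 v1 v2 v3 d3 d2.
apply/funext => psi; rewrite !fctE /GRing.scale /=; ring.
Qed.

Lemma delta_span0_eq0 S : delta_span 0 xi S -> S = 0.
Proof. by move=> [c ->]; rewrite big_ord0. Qed.

Lemma delta_sum2 (A : nat -> R[i]) : \sum_(j < 2) A j *: ddern j (delta xi) =
  A 0%N *: delta xi + A 1%N *: ddern 1 (delta xi) :> functional R.
Proof. by rewrite !big_ord_recl big_ord0 addr0. Qed.

Lemma delta_sum4 (A : nat -> R[i]) : \sum_(j < 4) A j *: ddern j (delta xi) =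
  A 0%N *: delta xi + A 1%N *: ddern 1 (delta xi) + A 2%N *: ddern 2 (delta xi)
  + A 3%N *: ddern 3 (delta xi) :> functional R.
Proof. by rewrite !big_ord_recl big_ord0 addr0 !addrA. Qed.

Lemma dmul_sum2 (g : R -> R[i]) (sg : smooth g) (A v : nat -> R[i]) : (forall k, v k = cderive k g xi) ->
  dmul sg (\sum_(j < 2) A j *: ddern j (delta xi)) =
  (A 0%N * v 0%N - A 1%N * v 1%N) *: delta xi + (A 1%N * v 0%N) *: ddern 1 (delta xi).
Proof.
move=> vE; rewrite delta_sum2 dmulD !dmulZ dmul_delta dmul_ddelta jetmul1 -!vE -{1}(cderive0 g) -vE.
move: (ddern 1 (delta xi)) (delta xi) => d1 d0.
apply/funext => psi; rewrite !fctE /GRing.scale /=; ring.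
Qed.

Lemma dmul_sum4 (g : R -> R[i]) (sg : smooth g) (A v : nat -> R[i]) : (forall k, v k = cderive k g xi) ->
  dmul sg (\sum_(j < 4) A j *: ddern j (delta xi)) =
  (A 0%N * v 0%N - A 1%N * v 1%N + A 2%N * v 2%N - A 3%N * v 3%N) *: delta xi
  + (A 1%N * v 0%N - 2 * A 2%N * v 1%N + 3 * A 3%N * v 2%N) *: ddern 1 (delta xi)
  + (A 2%N * v 0%N - 3 * A 3%N * v 1%N) *: ddern 2 (delta xi)
  + (A 3%N * v 0%N) *: ddern 3 (delta xi).
Proof.
move=> vE; rewrite delta_sum4 !dmulD !dmulZ dmul_delta !dmul_ddelta jetmul1 jetmul2 jetmul3.
rewrite -!vE -{1}(cderive0 g) -vE.
move: (ddern 3 (delta xi)) (ddern 2 (delta xi)) (ddern 1 (delta xi)) (delta xi) => d3 d2 d1 d0.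
apply/funext => psi; rewrite !fctE /GRing.scale /=; ring.
Qed.

Lemma ddelta_free4 e0 e1 e2 e3 : e0 *: delta xi + e1 *: ddern 1 (delta xi)
   + e2 *: ddern 2 (delta xi) + e3 *: ddern 3 (delta xi) = 0 <->
  [/\ e3 = 0, e2 = 0, e1 = 0 & e0 = 0].
Proof.
split=> [|[-> -> -> ->]]; last by rewrite !scale0r !addr0.
have := @ddelta_free _ 4 xi (fun k => nth 0 [:: e0; e1; e2; e3] k).
rewrite (delta_sum4 (nth 0 [:: e0; e1; e2; e3])) /= => H /H {}H.
by split; [exact: (H (@Ordinal 4 3 isT))|exact: (H (@Ordinal 4 2 isT))|exact: (H (@Ordinal 4 1 isT))|exact: (H (@Ordinal 4 0 isT))].
Qed.

Lemma boundary_cond_pc_lt fm fp (x0 : R) (C : 'cV[R[i]]_4) : smooth fm -> x0 < xi ->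
  boundary_cond (reg (pc xi fm fp)) x0 C <-> forall i : 'I_4, cderive i fm x0 = C i 0.
Proof.
move=> sm x0xi; split=> [[a [b [f [/andP[ax xb] sf E HC]]]] i|HC].
  have oU : open ([set x : R | a < x] `&` [set x : R | x < Num.min b xi]).
    by apply: openI; [exact: open_gt|exact: open_lt].
  have Ux0 : ([set x : R | a < x] `&` [set x : R | x < Num.min b xi]) x0.
    by split=> //=; rewrite lt_min xb.
  rewrite -HC; apply: (cderive_eq_on oU _ _ Ux0).
  apply: (reg_smooth_inj sm sf oU) => psi pU.
  rewrite -(E psi); last by move=> x /pU [/= h]; rewrite in_itv /= lt_min h => /andP[->].
  apply/esym/(@deq_on_reg_ext _ _ _ _ _ psi pU) => x [_] /=; rewrite lt_min => /andP[_ h].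
  exact: pc_lt.
exists (x0 - 1), xi, fm; split=> //; first by apply/andP; split=> //; rewrite ltrBlDr ltrDl.
by apply: deq_on_reg_ext => x /=; rewrite in_itv /= => /andP[_ h]; exact: pc_lt.
Qed.

Lemma boundary_cond_pc_gt fm fp (x0 : R) (C : 'cV[R[i]]_4) : smooth fp -> xi < x0 ->
  boundary_cond (reg (pc xi fm fp)) x0 C <-> forall i : 'I_4, cderive i fp x0 = C i 0.
Proof.
move=> sp x0xi; split=> [[a [b [f [/andP[ax xb] sf E HC]]]] i|HC].
  have oU : open ([set x : R | Num.max a xi < x] `&` [set x : R | x < b]).
    by apply: openI; [exact: open_gt|exact: open_lt].
  have Ux0 : ([set x : R | Num.max a xi < x] `&` [set x : R | x < b]) x0.
    by split=> //=; rewrite gt_max ax.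
  rewrite -HC; apply: (cderive_eq_on oU _ _ Ux0).
  apply: (reg_smooth_inj sp sf oU) => psi pU.
  rewrite -(E psi); last by move=> x /pU [/=]; rewrite in_itv /= gt_max => /andP[-> _] ->.
  apply/esym/(@deq_on_reg_ext _ _ _ _ _ psi pU) => x [/=]; rewrite gt_max => /andP[_ h] _.
  exact: pc_gt.
exists xi, (x0 + 1), fp; split=> //; first by apply/andP; split=> //; rewrite ltrDl.
by apply: deq_on_reg_ext => x /=; rewrite in_itv /= => /andP[h _]; exact: pc_gt.
Qed.

(** An upper bound on the order forces coefficients to vanish: [order_coef] with the piecewise
    regular part as [h]. *)
Lemma sing_coef_order fm fp n (A : nat -> R[i]) k : smooth fm -> smooth fp ->
  is_nth_derivative k (sing_coef xi fm fp (fun j : 'I_n => A j)) ->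
  forall j, (k <= j < n)%N -> A j = 0.
Proof.
move=> sm sp [G [g lg ->] E] j /andP[kj jn].
have lpc := locdom_locb (locb_pc xi (locb_smooth sm) (locb_smooth sp)).
exact: (order_coef (locdom_loc_integrable lg) lpc E (l := Ordinal jn)).
Qed.

Lemma order_cond_regular am ap bm bp (A B : nat -> R[i]) :
  smooth am -> smooth ap -> smooth bm -> smooth bp ->
  order_cond (sing_coef xi am ap (fun j : 'I_2 => A j))
             (sing_coef xi bm bp (fun j : 'I_4 => B j)) -> regular_orders A B.
Proof.
move=> sam sap sbm sbp.
have oA k n : (k <= n)%N -> has_order (sing_coef xi am ap (fun j : 'I_2 => A j)) k ->
    forall j, (n <= j < 2)%N -> A j = 0.
  move=> kn [h _] j /andP[nj j2]; apply: (sing_coef_order sam sap h).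
  by rewrite (leq_trans kn nj) j2.
have oB k n : (k <= n)%N -> has_order (sing_coef xi bm bp (fun j : 'I_4 => B j)) k ->
    forall j, (n <= j < 4)%N -> B j = 0.
  move=> kn [h _] j /andP[nj j4]; apply: (sing_coef_order sbm sbp h).
  by rewrite (leq_trans kn nj) j4.
case=> [[hA [k kn hB]]|[[k' kn' hA] [k kn hB]]|[_ [k kn hB]]].
- by apply: Or31; split; [exact: (oA 0 0)%N|exact: (oA 0 0)%N|exact: (oB _ _ kn)].
- by apply: Or32; split; [exact: (oA _ _ kn')|exact: (oB _ _ kn)|exact: (oB _ _ kn)].
- by apply: Or33; split; exact: (oB _ _ kn).
Qed.

(** Bookkeeping isolated over arbitrary functionals, so that [ring] acts on their values: [r1] to
    [r4] are the regular parts of the four products, whose contribution is the jump term [G]. *)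
Lemma ode_algebra (x1 x2 y1 y2 z1 z2 t1 t2 r1 r2 r3 r4 G : functional R) (W : R[i]) :
  ddern 2 (r1 + r2) = W *: (r3 + r4) + G ->
  ddern 2 ((r1 + y1 + x1) + (r2 + x2 + y2)) - W *: ((r3 + z1 + t1) + (r4 + t2 + z2)) =
  G + ddern 2 (y1 + y2 + (x1 + x2)) - W *: (z1 + z2 + (t1 + t2)).
Proof.
rewrite !ddernD; move: (ddern 2 r1) (ddern 2 r2) => {}r1 {}r2.
move: (ddern 2 x1) (ddern 2 x2) (ddern 2 y1) (ddern 2 y2) => {}x1 {}x2 {}y1 {}y2 H.
apply/funext => psi; have := congr1 (fun F : functional R => F psi) H.
rewrite !fctE /GRing.scale /= => {H}H.
transitivity ((r1 psi + r2 psi) - W * (r3 psi + r4 psi) + x1 psi + x2 psi + y1 psi + y2 psi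
  - W * (z1 psi + z2 psi + t1 psi + t2 psi)); first by ring.
by rewrite H; ring.
Qed.

Lemma jump_algebra (y1 y2 x z1 z2 t : functional R)
    (k1 k0 k W a0 a1 b0 b1 c0 c1 e0 e1 e2 e3 f0 f1 f2 f3 : R[i]) :
  k = k0 -> y1 = a0 *: delta xi + a1 *: ddern 1 (delta xi) ->
  y2 = b0 *: delta xi + b1 *: ddern 1 (delta xi) ->
  x = c0 *: delta xi + c1 *: ddern 1 (delta xi) ->
  z1 = e0 *: delta xi + e1 *: ddern 1 (delta xi) + e2 *: ddern 2 (delta xi)
    + e3 *: ddern 3 (delta xi) ->
  z2 = f0 *: delta xi + f1 *: ddern 1 (delta xi) + f2 *: ddern 2 (delta xi)
    + f3 *: ddern 3 (delta xi) -> t = 0 ->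
  k1 *: ddern 1 (delta xi) + k *: delta xi + ddern 2 (y1 + y2 + x) - W *: (z1 + z2 + t) =
  (k0 - W * (e0 + f0)) *: delta xi + (k1 - W * (e1 + f1)) *: ddern 1 (delta xi)
  + (a0 + b0 + c0 - W * (e2 + f2)) *: ddern 2 (delta xi)
  + (a1 + b1 + c1 - W * (e3 + f3)) *: ddern 3 (delta xi).
Proof.
move=> -> -> -> -> -> -> ->; rewrite !(ddernD, ddernZ) !ddern_add addr0.
move: (ddern 3 (delta xi)) (ddern 2 (delta xi)) (ddern 1 (delta xi)) (delta xi) => d3 d2 d1 d0.
apply/funext => psi; rewrite !fctE /GRing.scale /=; ring.
Qed.

End pc_algebra.

(** * The equation with two-sided data at [xi] *)

Section equation.
Context {R : realType}.
Variables (xi : R) (w : R[i]).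
Variables (a0m a0p a1m a1p b0m b0p b1m b1p : R -> R[i]).
Hypotheses (sa0m : smooth a0m) (sa0p : smooth a0p) (sa1m : smooth a1m) (sa1p : smooth a1p).
Hypotheses (sb0m : smooth b0m) (sb0p : smooth b0p) (sb1m : smooth b1m) (sb1p : smooth b1p).
Variables (A0 A1 B0 B1 : nat -> R[i]).
Hypothesis mixed_neq0 : a0m xi + a1p xi != 0.
Hypothesis minus_neq0 : forall x, a0m x + a1m x != 0.
Hypothesis plus_neq0 : forall x, a0p x + a1p x != 0.
Implicit Types (phi S : functional R) (um up : R -> R[i]).

Let a0 := sing_coef xi a0m a0p (fun j : 'I_2 => A0 j).
Let a1 := sing_coef xi a1m a1p (fun j : 'I_2 => A1 j).
Let b0 := sing_coef xi b0m b0p (fun j : 'I_4 => B0 j).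
Let b1 := sing_coef xi b1m b1p (fun j : 'I_4 => B1 j).
Let Sa0 : functional R := \sum_(j < 2) A0 j *: ddern j (delta xi).
Let Sa1 : functional R := \sum_(j < 2) A1 j *: ddern j (delta xi).
Let Sb0 : functional R := \sum_(j < 4) B0 j *: ddern j (delta xi).
Let Sb1 : functional R := \sum_(j < 4) B1 j *: ddern j (delta xi).

Let sSa0 : delta_span 2 xi Sa0. Proof. by exists A0. Qed.
Let sSa1 : delta_span 2 xi Sa1. Proof. by exists A1. Qed.
Let sSb0 : delta_span 4 xi Sb0. Proof. by exists B0. Qed.
Let sSb1 : delta_span 4 xi Sb1. Proof. by exists B1. Qed.

Let pm x := a0m x + a1m x.
Let pp x := a0p x + a1p x.
Let mx x := a0m x + a1p x.
Let qm x := w ^+ 2 * (b0m x + b1m x).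
Let qp x := w ^+ 2 * (b0p x + b1p x).
Let nx x := b0m x + b1p x.
Let spm : smooth pm := smoothDp sa0m sa1m.
Let spp : smooth pp := smoothDp sa0p sa1p.
Let smx : smooth mx := smoothDp sa0m sa1p.
Let snx : smooth nx := smoothDp sb0m sb1p.
Let sqm : smooth qm := smoothM (smooth_cst (w ^+ 2)) (smoothDp sb0m sb1m).
Let sqp : smooth qp := smoothM (smooth_cst (w ^+ 2)) (smoothDp sb0p sb1p).

Definition ode_lhs phi : functional R :=
  ddern 2 (star a0 (ddern 2 phi) + star (ddern 2 phi) a1)
  - w ^+ 2 *: (star b0 phi + star phi b1).

Lemma ode_lhsE phi : calA phi ->
  \sum_(i < 3) 'C(2, i)%:R *: (star (ddern i a0) (ddern (4 - i) phi)
      + star (ddern (4 - i) phi) (ddern i a1)) =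
  ddern 2 (star a0 (ddern 2 phi) + star (ddern 2 phi) a1).
Proof.
move=> [n [g [pg ->]]]; rewrite (eq_bigr _ (fun i _ => scalerDr _ _ _)) big_split /=.
rewrite (star_leibniz2_left sa0m sa0p sSa0 n pg) (star_leibniz2_right sa1m sa1p sSa1 n pg).
by rewrite -ddernD.
Qed.

(** Since [um] and [up] solve the regular equations, the function parts cancel and only
    distributions supported at [xi] remain: the jumps of [p u''] and of its derivative, and the
    Dirac parts of the products. *)
Lemma ode_lhs_pc um up m S (sum : smooth um) (sup : smooth up) : delta_span m xi S ->
  ode4 pm qm um -> ode4 pp qp up ->
  ode_lhs (reg (pc xi um up) + S) =
    (pp xi * cderive 2 up xi - pm xi * cderive 2 um xi) *: ddern 1 (delta xi)
    + (cderive 1 (fun x => pp x * cderive 2 up x) xi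
       - cderive 1 (fun x => pm x * cderive 2 um x) xi) *: delta xi
    + ddern 2 (dmul (smooth_cderiven 2 sup) Sa0 + dmul (smooth_cderiven 2 sum) Sa1
        + dmul smx ((up xi - um xi) *: ddern 1 (delta xi)
            + (cderive 1 up xi - cderive 1 um xi) *: delta xi + ddern 2 S))
    - w ^+ 2 *: (dmul sup Sb0 + dmul sum Sb1 + dmul snx S).
Proof.
move=> sS om op; pose sum2 := smooth_cderiven 2 sum; pose sup2 := smooth_cderiven 2 sup.
rewrite /ode_lhs [ddern 2 (reg _ + S)]ddernD (ddern2_reg_pc xi sum sup).
set J := (up xi - um xi) *: ddern 1 (delta xi) + _ *: delta xi.
have sJ : delta_span (2 + m) xi (J + ddern 2 S).
  apply: delta_spanD; last exact: delta_span_ddern_iter.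
  exact: (delta_spanW (leq_addr m 2) (delta_span_jump xi _ _)).
rewrite -[_ + J + ddern 2 S]addrA.
have E1 := star_singular sa0m sa0p sum2 sup2 sSa0 sJ.
have E2 := star_singular sum2 sup2 sa1m sa1p sJ sSa1.
have E3 := star_singular sb0m sb0p sum sup sSb0 sS.
have E4 := star_singular sum sup sb1m sb1p sS sSb1.
rewrite [star a0 _]E1 [star _ a1]E2 [star b0 _]E3 [star _ b1]E4 {E1 E2 E3 E4}.
have lJ := delta_span_linear sJ; have lS := delta_span_linear sS.
(* The Diracs of [phi''] are multiplied by the left branch of [a0] and by the right branch of [a1];
   the two add up to [mx]. The same happens to [S] with [b0], [b1] and [nx]. *)
rewrite (dmul_addl sa0m sa1p smx lJ (fun x => erefl)) (dmul_addl sb0m sb1p snx lS (fun x => erefl)).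
have H1 : reg (pc xi (fun x => a0m x * cderive 2 um x) (fun x => a0p x * cderive 2 up x)) +
   reg (pc xi (fun x => cderive 2 um x * a1m x) (fun x => cderive 2 up x * a1p x)) =
   reg (pc xi (fun x => pm x * cderive 2 um x) (fun x => pp x * cderive 2 up x)).
  rewrite reg_pcD; first last.
  - exact: (smoothM sup2 sa1p). - exact: (smoothM sum2 sa1m).
  - exact: (smoothM sa0p sup2). - exact: (smoothM sa0m sum2).
  by apply: (f_equal2 (fun f g => reg (pc xi f g))); apply/funext => x;
    rewrite /pm /pp mulrDl; congr (_ + _); exact: mulrC.
have H2 : w ^+ 2 *: (reg (pc xi (fun x => b0m x * um x) (fun x => b0p x * up x)) +
   reg (pc xi (fun x => um x * b1m x) (fun x => up x * b1p x))) =
   reg (pc xi (fun x => qm x * um x) (fun x => qp x * up x)).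
  have s1 := smoothM sup sb1p; have s2 := smoothM sum sb1m.
  have s3 := smoothM sb0p sup; have s4 := smoothM sb0m sum.
  rewrite (reg_pcD xi s4 s3 s2 s1) (reg_pcZ _ _ (smoothDp s4 s2) (smoothDp s3 s1)).
  by apply: (f_equal2 (fun f g => reg (pc xi f g))); apply/funext => x;
    rewrite /qm /qp -mulrA mulrDl; congr (_ * (_ + _)); exact: mulrC.
have H3 := ddern2_reg_pc xi (smoothM spm sum2) (smoothM spp sup2).
have H4 : reg (pc xi (cderive 2 (fun x => pm x * cderive 2 um x))
   (cderive 2 (fun x => pp x * cderive 2 up x))) = reg (pc xi (fun x => qm x * um x) (fun x => qp x * up x)).
  exact: (f_equal2 (fun f g => reg (pc xi f g)) (funext om) (funext op)).
rewrite -H1 H4 -H2 in H3.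
exact: ode_algebra H3.
Qed.

Lemma ddern2_mul_lead (f : R -> R[i]) (sf : smooth f) m c S : delta_span m xi S ->
  exists2 S', delta_span m.+4 xi S' &
  ddern 2 (dmul sf (ddern 2 (c *: ddern m (delta xi) + S))) =
  (c * f xi) *: ddern m.+4 (delta xi) + S'.
Proof.
move=> sS; have [S1 sS1 E1] := jetmul_lead m.+2 (fun k => cderive k f xi) xi.
exists (c *: ddern 2 S1 + ddern 2 (dmul sf (ddern 2 S))).
  apply: delta_spanD; first exact/delta_spanZ/(delta_span_ddern_iter 2 sS1).
  exact: (delta_span_ddern_iter 2 (delta_span_dmul sf (delta_span_ddern_iter 2 sS))).
rewrite [ddern 2 (_ + S)]ddernD ddernZ (dmulD sf) dmulZ ddern_add [dmul sf _](dmul_ddelta sf m.+2) E1.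
by rewrite cderive0 ddernD ddernZ ddernD ddernZ ddern_add scalerDr scalerA addrA.
Qed.

(* The term [D^2 (mx D^2 S)] has order higher than all the other singular terms, and
   [mx xi != 0]. *)
Lemma ode_lhs_singular_part um up m S (sum : smooth um) (sup : smooth up) : delta_span m xi S ->
  ode4 pm qm um -> ode4 pp qp up -> ode_lhs (reg (pc xi um up) + S) = 0 -> S = 0.
Proof.
move=> + om op; elim: m S => [|m IH] S sS E0; first exact: delta_span0_eq0 sS.
have [c [S1 sS1 SE]] := delta_span_recr sS; suff c0 : c = 0.
  by apply: IH E0; rewrite SE c0 scale0r add0r.
have := E0; rewrite (ode_lhs_pc sum sup sS om op).
have [S2 sS2 E2] := ddern2_mul_lead smx c sS1.
move=> E; suff : c * mx xi = 0.
  by move=> /eqP; rewrite mulf_eq0 (negbTE mixed_neq0) orbF => /eqP.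
pose J := (up xi - um xi) *: ddern 1 (delta xi) + (cderive 1 up xi - cderive 1 um xi) *: delta xi.
pose T := dmul (smooth_cderiven 2 sup) Sa0 + dmul (smooth_cderiven 2 sum) Sa1 + dmul smx J.
pose G := (pp xi * cderive 2 up xi - pm xi * cderive 2 um xi) *: ddern 1 (delta xi)
    + (cderive 1 (fun x => pp x * cderive 2 up x) xi
       - cderive 1 (fun x => pm x * cderive 2 um x) xi) *: delta xi.
pose Z := dmul sup Sb0 + dmul sum Sb1 + dmul snx S.
have sT : delta_span 2 xi T.
  apply: delta_spanD; last exact/delta_span_dmul/delta_span_jump.
  by apply: delta_spanD; exact: delta_span_dmul.
(* The [B] terms stop at [delta^(3)] and the product with [S] at [delta^(m)]: nothing here reaches
   [delta^(m + 4)], even for [m = 0]. *)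
have sZ : delta_span m.+4 xi Z.
  apply: delta_spanD; last by apply: delta_spanW (delta_span_dmul snx sS); rewrite !ltnS ltnW // ltnW.
  by apply: delta_spanD; apply: (@delta_spanW _ 4) => //; exact: delta_span_dmul.
apply: (@delta_span_lead_eq0 _ m.+4 xi _ (G + ddern 2 T + S2 - w ^+ 2 *: Z)).
  apply: delta_spanD; last exact/delta_spanN/delta_spanZ.
  apply: delta_spanD sS2; apply: delta_spanD.
    by apply: delta_spanW (delta_span_jump xi _ _).
  exact: (@delta_spanW _ 4 m.+4 xi _ isT (delta_span_ddern_iter 2 sT)).
have E3 : ddern 2 (dmul (smooth_cderiven 2 sup) Sa0 + dmul (smooth_cderiven 2 sum) Sa1
    + dmul smx (J + ddern 2 S)) = ddern 2 T + ((c * mx xi) *: ddern m.+4 (delta xi) + S2).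
  by rewrite (dmulD smx J) [_ + (_ + _)]addrA ddernD SE E2.
rewrite -[RHS]E E3 -/G -/Z.
move: (_ *: ddern m.+4 (delta xi)) (ddern 2 T) (w ^+ 2 *: Z) G S2 {E E0 sS2 E2 E3}.
move=> F1 F2 F3 F4 F5; apply/funext => psi; rewrite !fctE; ring.
Qed.

Definition jets um k : R[i] := cderive k um xi.

(** With [S = 0], what remains is a combination of [delta], ..., [delta^(3)], and these are linearly
    independent: [jump] lists its four coefficients. *)
Lemma ode_lhs_jump um up (sum : smooth um) (sup : smooth up) :
  ode4 pm qm um -> ode4 pp qp up ->
  ode_lhs (reg (pc xi um up)) = 0 <->
  jump (w ^+ 2) (pp xi) (cderive 1 pp xi) (pm xi) (cderive 1 pm xi) (mx xi) (cderive 1 mx xi)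
    A0 A1 B0 B1 (jets up) (jets um).
Proof.
move=> om op; have vp k : jets up k.+2 = cderive k (cderive 2 up) xi by rewrite cderive_cderive addn2.
have vm k : jets um k.+2 = cderive k (cderive 2 um) xi by rewrite cderive_cderive addn2.
have jp0 : up xi = jets up 0 by rewrite /jets cderive0.
have jm0 : um xi = jets um 0 by rewrite /jets cderive0.
have E1 := dmul_sum2 (smooth_cderiven 2 sup) A0 vp.
have E2 := dmul_sum2 (smooth_cderiven 2 sum) A1 vm.
have E4 := @dmul_sum4 _ xi _ sup B0 (jets up) (fun k => erefl).
have E5 := @dmul_sum4 _ xi _ sum B1 (jets um) (fun k => erefl).
have E3 : dmul smx ((up xi - um xi) *: ddern 1 (delta xi) +
      (cderive 1 up xi - cderive 1 um xi) *: delta xi + ddern 2 0) =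
    ((jets up 1 - jets um 1) * mx xi - (jets up 0 - jets um 0) * cderive 1 mx xi) *: delta xi
    + ((jets up 0 - jets um 0) * mx xi) *: ddern 1 (delta xi).
  have -> : ddern 2 (0 : functional R) = 0 by rewrite !ddernS !dderive0.
  rewrite addr0.
  pose J k : R[i] := nth 0 [:: jets up 1 - jets um 1; jets up 0 - jets um 0] k.
  have := @dmul_sum2 _ xi _ smx J (jets mx) (fun k => erefl).
  rewrite delta_sum2 /J /= jp0 jm0 addrC => E.
  by rewrite [LHS]E /jets cderive0.
have E6 := dmul0 snx.
have E0 := ode_lhs_pc sum sup (delta_span0 0 xi) om op; rewrite addr0 in E0.
(* Expands [(p u'')'] on both sides into [p' u'' + p u'''], so that only jets of [um] and [up] occur
   in the coefficient of [delta]. *)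
have K0 := f_equal2 (fun x y => x - y) (cderive3_quasi spp xi sup) (cderive3_quasi spm xi sum).
have F := etrans E0 (jump_algebra _ _ K0 E1 E2 E3 E4 E5 E6).
rewrite F {F K0 E0 E1 E2 E3 E4 E5 E6}.
apply: iff_trans (ddelta_free4 xi _ _ _ _) _.
rewrite -[cderive 2 up xi]/(jets up 2) -[cderive 3 up xi]/(jets up 3).
rewrite -[cderive 2 um xi]/(jets um 2) -[cderive 3 um xi]/(jets um 3).
move: (pp xi) (pm xi) (mx xi) (cderive 1 pp xi) (cderive 1 pm xi) (cderive 1 mx xi) (jets up) (jets um) (w ^+ 2).
move=> P Q M P' Q' M' p m W; rewrite /jump.
by split=> -[h3 h2 h1 h0];
  (split; [rewrite -[RHS]h3|rewrite -[RHS]h2|rewrite -[RHS]h1|rewrite -[RHS]h0]; ring).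
Qed.

(** On a side of [xi] each product is multiplication by a smooth branch, so the equation becomes the
    regular one there, whatever other singular points [phi] was allowed to have. *)
Lemma ode_side (U : set R) (x0 : R) phi (p0 p1 q0 q1 : R -> R[i]) (sp0 : smooth p0) (sp1 : smooth p1)
    (sq0 : smooth q0) (sq1 : smooth q1) :
  linear phi -> open U -> is_interval U -> U x0 -> (forall x, p0 x + p1 x != 0) ->
  deq_on U (star a0 (ddern 2 phi)) (dmul sp0 (ddern 2 phi)) ->
  deq_on U (star (ddern 2 phi) a1) (dmul sp1 (ddern 2 phi)) ->
  deq_on U (star b0 phi) (dmul sq0 phi) -> deq_on U (star phi b1) (dmul sq1 phi) ->
  ode_lhs phi = 0 ->
  exists u, [/\ smooth u, ode4 (fun x => p0 x + p1 x) (fun x => w ^+ 2 * (q0 x + q1 x)) u &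
    deq_on U phi (reg u)].
Proof.
move=> lphi oU iU Ux0 p01 E1 E2 E3 E4 E0.
have sp := smoothDp sp0 sp1; have sq := smoothDp sq0 sq1.
have swq : smooth (fun x => w ^+ 2 * (q0 x + q1 x)) := smoothM (smooth_cst (w ^+ 2)) sq.
have := @distribution_ode4 _ _ _ sp swq p01 phi U x0 lphi oU iU Ux0.
apply=> psi pU.
have l2 : linear (ddern 2 phi) by exact: ddern_linear.
rewrite (dmul_addl sp0 sp1 sp l2 (fun x => erefl)).
have H1 := deq_on_ddern 2 (deq_onD E1 E2) pU.
have H2 := deq_onZ (w ^+ 2) (deq_onD E3 E4) pU.
have := congr1 (fun F : functional R => F psi) E0; rewrite /ode_lhs.
rewrite [(_ - _) psi]/(_ psi - _ psi) H1 H2 => /eqP; rewrite subr_eq0 => /eqP ->.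
rewrite -(dmul_addl sq0 sq1 sq lphi (fun x => erefl)) fctE !dmulE.
rewrite -[RHS]/(phi (tmul swq psi)) -[LHS]/(w ^+ 2 * phi (tmul sq psi)) -linear_scale //.
by congr phi; apply: testfun_ext => x; rewrite tfunZ !tmulE mulrA.
Qed.

Lemma ode_solution_pc phi : calA phi -> ode_lhs phi = 0 ->
  exists um up, [/\ smooth um, smooth up, ode4 pm qm um, ode4 pp qp up & phi = reg (pc xi um up)].
Proof.
move=> [n [g [pg E]]] E0; have lg := locb_piecewise_smooth pg.
have lrg := reg_linear lg.
have lphi : linear phi by rewrite E; exact: ddern_linear.
have Lm k := star_left_on sa0m sa0p sSa0 n pg k; have Lb k := star_left_on sb0m sb0p sSb0 n pg k.
have Rm k := star_right_on sa1m sa1p sSa1 n pg k; have Rb k := star_right_on sb1m sb1p sSb1 n pg k.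
rewrite -E in Lm Lb Rm Rb.
have oOm : open (Om xi) by exact: open_lt.
have oOp : open (Op xi) by exact: open_gt.
have iOm : is_interval (Om xi).
  by move=> x y _ /= yx z /andP[_ zy]; rewrite /Om /=; exact: le_lt_trans yx.
have iOp : is_interval (Op xi).
  by move=> x y xx _ z /andP[zx _]; rewrite /Op /=; exact: lt_le_trans zx.
have Omx : Om xi (xi - 1) by rewrite /Om /= ltrBlDr ltrDl.
have Opx : Op xi (xi + 1) by rewrite /Op /= ltrDl.
have [um [sum om Eum]] := ode_side lphi oOm iOm Omx minus_neq0
  (Lm 2%N).1 (Rm 2%N).1 (Lb 0%N).1 (Rb 0%N).1 E0.
have [up [sup op Eup]] := ode_side lphi oOp iOp Opx plus_neq0
  (Lm 2%N).2 (Rm 2%N).2 (Lb 0%N).2 (Rb 0%N).2 E0.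
have Eum' := Eum; have Eup' := Eup; rewrite E in Eum' Eup'.
(* Knowing [phi] on the open sides says nothing yet about [xi]. Integrating back to the generator
   [g] gives branches smooth across [xi]. *)
have [Um sUm EUm] := deq_on_ddern_reg lrg oOm iOm Omx sum Eum'.
have [Up sUp EUp] := deq_on_ddern_reg lrg oOp iOp Opx sup Eup'.
have gE : reg g = reg (pc xi Um Up).
  have [s [dg _]] := pg.
  have cont x : x \notin s -> {for x, continuous (cRe \o g)} /\ {for x, continuous (cIm \o g)}.
    by move=> xs; have := dg 0%N x xs; rewrite cderive0; exact: cderivable_continuous.
  have contU (u : R -> R[i]) x : smooth u ->
      {for x, continuous (cRe \o u)} /\ {for x, continuous (cIm \o u)}.
    by move=> su; exact: (cderivable_continuous (smooth_cderivable x su)).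
  have lU := locb_pc xi (locb_smooth sUm) (locb_smooth sUp).
  apply: (@reg_eq_off _ (xi :: s) _ _ lg lU) => x.
  rewrite inE negb_or => /andP[xxi xs]; move: xxi; rewrite neq_lt => /orP[xx|xx].
    rewrite pc_lt //.
    exact: (fundamental_lemma lg (locb_smooth sUm) oOm xx (cont x xs) (contU Um x sUm) EUm).
  rewrite pc_gt //.
  exact: (fundamental_lemma lg (locb_smooth sUp) oOp xx (cont x xs) (contU Up x sUp) EUp).
(* Differentiating the two-branch form of [g] again [n] times creates only finitely many Diracs at
   [xi], which are then excluded by [ode_lhs_singular_part]. *)
have [gm [gp [m [S [sgm sgp sS Esing]]]]] := ddern_singular sUm sUp (delta_span0 0 xi) n.
rewrite addr0 -gE -E in Esing.
have Egm : forall x, x < xi -> gm x = um x.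
  apply: (reg_smooth_inj sgm sum oOm).
  by apply: deq_on_trans Eum; rewrite Esing; exact/deq_on_sym/deq_on_singular_lt/sS.
have Egp : forall x, xi < x -> gp x = up x.
  apply: (reg_smooth_inj sgp sup oOp).
  by apply: deq_on_trans Eup; rewrite Esing; exact/deq_on_sym/deq_on_singular_gt/sS.
rewrite (pc_eq Egm Egp) in Esing.
exists um, up; split=> //; rewrite Esing (@ode_lhs_singular_part um up m S sum sup sS om op) ?addr0 //.
by rewrite -Esing.
Qed.

Lemma calA_pc um up : smooth um -> smooth up -> calA (reg (pc xi um up)).
Proof. by move=> sum sup; exists 0%N, (pc xi um up); split=> //; exact: piecewise_smooth_pc. Qed.

Lemma ode_unique_solution_lt (x0 : R) (C : 'cV[R[i]]_4) : regular_orders A0 B0 -> x0 < xi ->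
  exists! phi, (calA phi /\ ode_lhs phi = 0) /\ boundary_cond phi x0 C.
Proof.
move=> reg0 x0xi.
have [um sum [om jm]] := ode4_exists spm sqm minus_neq0 x0 (fun k => C (inord k) 0).
(* The boundary data fix [um], hence its jet at [xi]; the jump relations then prescribe the jet [f]
   of [up] there, and conversely. *)
have [f Hf] := jump_solve (w ^+ 2) (cderive 1 pp xi) (pm xi) (cderive 1 pm xi) (cderive 1 mx xi)
  A1 B1 (jets um) (plus_neq0 xi) mixed_neq0 reg0.
have [up sup [op jp]] := ode4_exists spp sqp plus_neq0 xi f.
exists (reg (pc xi um up)); split.
  split; first split.
  - exact: calA_pc.
  - by apply/(ode_lhs_jump sum sup om op)/Hf.
  - by apply/(boundary_cond_pc_lt up C sum x0xi) => i; rewrite jm // inord_val.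
move=> psi [[cpsi Epsi] bpsi]; have [vm [vp [svm svp ovm ovp E]]] := ode_solution_pc cpsi Epsi.
move: Epsi bpsi; rewrite E => /(ode_lhs_jump svm svp ovm ovp) J.
move=> /(boundary_cond_pc_lt vp C svm x0xi) HC.
have Em : um = vm.
  apply: (ode4_unique (x0 := x0) spm sqm minus_neq0 sum svm om ovm) => k k4.
  by have := HC (inord k); rewrite inordK // => ->; exact: jm.
move: J; rewrite -Em => /Hf Jp.
have -> : up = vp => //.
by apply: (ode4_unique (x0 := xi) spp sqp plus_neq0 sup svp op ovp) => k k4; rewrite jp // -Jp.
Qed.

Lemma ode_unique_solution_gt (x0 : R) (C : 'cV[R[i]]_4) : regular_orders A1 B1 -> xi < x0 ->
  exists! phi, (calA phi /\ ode_lhs phi = 0) /\ boundary_cond phi x0 C.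
Proof.
move=> reg1 x0xi.
have [up sup [op jp]] := ode4_exists spp sqp plus_neq0 x0 (fun k => C (inord k) 0).
(* The divisors of the reflected system: the left value of [a_0 + a_1] takes the place of the right
   one, while the mixed value only changes sign. *)
have Q0 : - pm xi != 0 by rewrite oppr_eq0; exact: minus_neq0.
have M0 : - mx xi != 0 by rewrite oppr_eq0.
have [f Hf] := jump_solve (w ^+ 2) (- cderive 1 pm xi) (- pp xi) (- cderive 1 pp xi)
  (- cderive 1 mx xi) A0 B0 (jets up) Q0 M0 reg1.
have [um sum [om jm]] := ode4_exists spm sqm minus_neq0 xi f.
exists (reg (pc xi um up)); split.
  split; first split.
  - exact: calA_pc.
  - by apply/(ode_lhs_jump sum sup om op)/jump_swap/Hf.
  - by apply/(boundary_cond_pc_gt um C sup x0xi) => i; rewrite jp // inord_val.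
move=> psi [[cpsi Epsi] bpsi]; have [vm [vp [svm svp ovm ovp E]]] := ode_solution_pc cpsi Epsi.
move: Epsi bpsi; rewrite E => /(ode_lhs_jump svm svp ovm ovp) J.
move=> /(boundary_cond_pc_gt vm C svp x0xi) HC.
have Ep : up = vp.
  apply: (ode4_unique (x0 := x0) spp sqp plus_neq0 sup svp op ovp) => k k4.
  by have := HC (inord k); rewrite inordK // => ->; exact: jp.
move: J; rewrite -Ep => /jump_swap /Hf Jm.
have -> : um = vm => //.
by apply: (ode4_unique (x0 := xi) spm sqm minus_neq0 sum svm om ovm) => k k4; rewrite jm // -Jm.
Qed.

End equation.

Theorem corollary3p5 (R : realType) (xi : R) (w : R[i])
    (am ap bm bp : 'I_2 -> R -> R[i]) (A : 'M[R[i]]_2) (B : 'M[R[i]]_(2, 4))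
    (smooth_am : forall i, smooth (am i)) (smooth_ap : forall i, smooth (ap i))
    (smooth_bm : forall i, smooth (bm i)) (smooth_bp : forall i, smooth (bp i))
    (mixed_neq0 : am 0 xi + ap 1 xi != 0)
    (minus_neq0 : forall x, am 0 x + am 1 x != 0)
    (plus_neq0 : forall x, ap 0 x + ap 1 x != 0)
    (a : 'I_2 -> functional R)
    (aE : forall i, a i = sing_coef xi (am i) (ap i) (A i))
    (b : 'I_2 -> functional R)
    (bE : forall i, b i = sing_coef xi (bm i) (bp i) (B i)) :
  (order_cond (a 0) (b 0) ->
    forall x0 : R, x0 < xi -> forall C : 'cV[R[i]]_4,
      exists! phi, is_solution a b w phi /\ boundary_cond phi x0 C) /\
  (order_cond (a 1) (b 1) ->
    forall x0 : R, xi < x0 -> forall C : 'cV[R[i]]_4,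
      exists! phi, is_solution a b w phi /\ boundary_cond phi x0 C).
Proof.
(* The jump relations and [delta_span] use coefficient sequences over [nat]; [inord] extends the
   matrix rows, and only the indices in range are read. *)
pose An i (k : nat) := A i (inord k); pose Bn i (k : nat) := B i (inord k).
have aE' i : a i = sing_coef xi (am i) (ap i) (fun j : 'I_2 => An i j).
  by rewrite aE; congr sing_coef; apply/funext => j; rewrite /An inord_val.
have bE' i : b i = sing_coef xi (bm i) (bp i) (fun j : 'I_4 => Bn i j).
  by rewrite bE; congr sing_coef; apply/funext => j; rewrite /Bn inord_val.
have regular i : order_cond (a i) (b i) -> regular_orders (An i) (Bn i).
  by rewrite aE' bE'; exact: order_cond_regular.
have solE phi : is_solution a b w phi <-> calA phi /\
    ode_lhs xi w (am 0) (ap 0) (am 1) (ap 1) (bm 0) (bp 0) (bm 1) (bp 1)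
      (An 0) (An 1) (Bn 0) (Bn 1) phi = 0.
  rewrite /is_solution !aE' !bE' /ode_lhs.
  (* The Leibniz form replaces the binomial sum for any [phi] in [calA], before anything is known
     about its singular points. *)
  by split=> -[cphi]; rewrite ode_lhsE.
have ext (P Q : functional R -> Prop) : (forall phi, P phi <-> Q phi) ->
    (exists! phi, P phi) -> exists! phi, Q phi.
  by move=> PQ [phi [/PQ p u]]; exists phi; split=> // psi /PQ; exact: u.
split=> [/regular reg0 x0 x0xi C|/regular reg1 x0 x0xi C].
- apply: ext (ode_unique_solution_lt (xi := xi) w (smooth_am 0) (smooth_ap 0) (smooth_am 1) (smooth_ap 1)
    (smooth_bm 0) (smooth_bp 0) (smooth_bm 1) (smooth_bp 1) (An 1) (Bn 1) mixed_neq0 minus_neq0 plus_neq0 C reg0 x0xi).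
  move=> phi; have E := solE phi.
  by split=> -[h1 h2]; [exact (conj (E.2 h1) h2)|exact (conj (E.1 h1) h2)].
- apply: ext (ode_unique_solution_gt (xi := xi) w (smooth_am 0) (smooth_ap 0) (smooth_am 1) (smooth_ap 1)
    (smooth_bm 0) (smooth_bp 0) (smooth_bm 1) (smooth_bp 1) (An 0) (Bn 0) mixed_neq0 minus_neq0 plus_neq0 C reg1 x0xi).
  move=> phi; have E := solE phi.
  by split=> -[h1 h2]; [exact (conj (E.2 h1) h2)|exact (conj (E.1 h1) h2)].
Qed.
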